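(* Let $k$ be a field, set $Q=k[[x,y,z]]$ and $\mathfrak q=(x,y,z)$. Let $I\subseteq\mathfrak q^2$ be a homogeneous ideal such that $R=Q/I$ is compressed artinian of type $2$. Assume that $I=I_1\cap I_2$ for homogeneous ideals $I_1,I_2\subseteq\mathfrak q^2$ such that $Q/I_1$ and $Q/I_2$ are compressed (artinian) Gorenstein rings. Let $\chi^{s_1}+\chi^s$ be the socle polynomial of $R$ with $s_1\le s$, and assume that $s$ is even and $s\ge6$. Set $$N_1(s)=\frac{3s-5+\sqrt{24s+97}}{6}\qquad\text{and}\qquad N_2(s)=\frac{s-1+\sqrt{8s+25}}{2}.$$ There are inequalities $\frac s2+1\le s_1\le s$ and $N_1(s)<N_2(s)$, and the following assertions hold. (a) If $s_1<N_1(s)$, then $R$ is of class $\mathbf G(r)$ (for some $r\ge1$). (b) If $N_2(s)\le s_1$, then $R$ is of class $\mathbf H(0,0)$, i.e. Golod. (c) If $N_1(s)\le s_1<N_2(s)$, then $R$ is of class $\mathbf H(0,0)$ or $\mathbf G(r)$ (for some $r\ge1$).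
   Context: Homogeneous ideals of the power series ring $Q$ are ideals generated by homogeneous polynomials (standard grading). For an artinian local ring $(R,\mathfrak m,k)$: the socle is $\operatorname{Soc}R=(0:_R\mathfrak m)$; the type of $R$ is $\operatorname{rank}_k\operatorname{Soc}R$; the socle degree is the integer $s$ with $\mathfrak m^s\ne 0=\mathfrak m^{s+1}$; the socle polynomial is $\sum_{i=0}^s\operatorname{rank}_k\!\left(\frac{\mathfrak m^i\cap\operatorname{Soc}R}{\mathfrak m^{i+1}\cap\operatorname{Soc}R}\right)\chi^i$; the Hilbert function is $h_R(i)=\operatorname{rank}_k(\mathfrak m^i/\mathfrak m^{i+1})$. Put $h_Q(i)=\binom{i+2}{2}$ for $i\ge0$ and $h_Q(i)=0$ for $i<0$. Compressed: an artinian Gorenstein quotient $S$ of $Q$ (by an ideal in $\mathfrak q^2$) of socle degree $\sigma$ is compressed if $h_S(i)=\min\{h_Q(i),h_Q(\sigma-i)\}$ for all $i\ge0$. An artinian quotient $R$ of $Q$ (by an ideal in $\mathfrak q^2$) of type $2$ with socle polynomial $\chi^{c}+\chi^{s}$, $c\le s$, is compressed if $h_R(i)=\min\{h_Q(i),h_Q(c-i)+h_Q(s-i)\}$ for all $i\ge 0$. Classes: let $A=\operatorname{Tor}^Q_*(R,k)$ with its graded-commutative $k$-algebra structure (equivalently, the Koszul homology algebra of $R$). For $R=Q/I$ artinian of type $2$, with $I\subseteq\mathfrak q^2$ minimally generated by $m$ elements, $A_1,A_2,A_3$ have ranks $m$, $m+1$, $2$. $R$ is of class $\mathbf G(r)$,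 $r\ge1$, if there are bases $e_1,\dots,e_m$ of $A_1$, $f_1,\dots,f_{m+1}$ of $A_2$, $g_1,g_2$ of $A_3$ such that $e_if_i=g_1$ for $1\le i\le r$ and all products of basis elements not determined by these and graded commutativity are zero. $R$ is of class $\mathbf H(0,0)$ if all products in $A_{\ge1}$ are zero; the rings of this class are precisely the Golod rings. *)

(* Defs.v *)
From HB Require Import structures.
From mathcomp Require Import all_boot all_order all_algebra ring_quotient.
From mathcomp Require Import boolp classical_sets.
From mathcomp Require Import mpoly.

Set Implicit Arguments.
Unset Strict Implicit.
Unset Printing Implicit Defensive.

Import Order.TTheory GRing.Theory Num.Theory.

Local Open Scope ring_scope.
Local Open Scope classical_set_scope.
Local Open Scope quotient_scope.

(** The formal power series of k[[x_0, ..., x_(n-1)]]: a series is its family of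
    coefficients, indexed by exponent vectors. *)

Record mseries (n : nat) (k : fieldType) : Type :=
  MSeries { mscoef :> 'X_{1..n} -> k }.

Section PowerSeries.
Context {n : nat} {k : fieldType}.
Implicit Types (f g h : mseries n k) (m : 'X_{1..n}).

Lemma mseriesP f g : (forall m, f m = g m) -> f = g.
Proof. by case: f g => [f] [g] /= /funext ->. Qed.

HB.instance Definition _ := gen_eqMixin (mseries n k).
HB.instance Definition _ := gen_choiceMixin (mseries n k).

Definition ms0 : mseries n k := MSeries (fun=> 0).
Definition ms_opp f : mseries n k := MSeries (fun m => - f m).
Definition ms_add f g : mseries n k := MSeries (fun m => f m + g m).
Definition ms1 : mseries n k := MSeries (fun m => (m == 0%MM)%:R).
Definition ms_mul f g : mseries n k := MSeries (fun m =>
  \sum_(d : 'X_{1..n < (mdeg m).+1, (mdeg m).+1} | m == (d.1 + d.2)%MM)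
     f d.1 * g d.2).
Definition ms_scale (c : k) f : mseries n k := MSeries (fun m => c * f m).
Definition ms_var (i : 'I_n) : mseries n k := 
  MSeries (fun m => (m == U_(i)%MM)%:R).

Fact ms_addA : associative ms_add.
Proof. by move=> f g h; apply: mseriesP => m /=; rewrite addrA. Qed.
Fact ms_addC : commutative ms_add.
Proof. by move=> f g; apply: mseriesP => m /=; rewrite addrC. Qed.
Fact ms_add0 : left_id ms0 ms_add.
Proof. by move=> f; apply: mseriesP => m /=; rewrite add0r. Qed.
Fact ms_addN : left_inverse ms0 ms_opp ms_add.
Proof. by move=> f; apply: mseriesP => m /=; rewrite addNr. Qed.

HB.instance Definition _ :=
  GRing.isZmodule.Build (mseries n k) ms_addA ms_addC ms_add0 ms_addN.

(* The ring axioms are transferred from {mpoly k[n]} by truncation. *)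
Definition ms_trunc (d : nat) f : {mpoly k[n]} :=
  \sum_(m : 'X_{1..n < d.+1}) f m *: 'X_[m].

Lemma ms_truncE d f m : (mdeg m <= d)%N -> (ms_trunc d f)@_m = f m.
Proof.
move=> le_md; have lt_md : (mdeg m < d.+1)%N by [].
rewrite /ms_trunc raddf_sum /= (bigD1 (BMultinom lt_md)) //= mcoeffZ mcoeffX.
rewrite eqxx mulr1 big1 ?addr0 // => i ne_i; rewrite mcoeffZ mcoeffX.
by case: eqP => [eq_im|]; rewrite ?mulr0 //; case/eqP: ne_i; apply: val_inj.
Qed.

Lemma mcoeffM_low d (p p' q q' : {mpoly k[n]}) m :
  (forall m', (mdeg m' <= d)%N -> p@_m' = p'@_m') ->
  (forall m', (mdeg m' <= d)%N -> q@_m' = q'@_m') ->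
  (mdeg m <= d)%N -> (p * q)@_m = (p' * q')@_m.
Proof.
move=> eqp eqq le_md; rewrite !mcoeffM; apply: eq_bigr => -[a b] /= _.
by rewrite eqp ?eqq // (leq_trans _ le_md) // -ltnS bmdeg.
Qed.

Lemma ms_mulE d f g m : (mdeg m <= d)%N ->
  ms_mul f g m = (ms_trunc d f * ms_trunc d g)@_m.
Proof.
move=> le_md; rewrite mcoeffM; apply: eq_bigr => -[a b] /= _.
by rewrite !ms_truncE // (leq_trans _ le_md) // -ltnS bmdeg.
Qed.

Fact ms_mulA : associative ms_mul.
Proof.
move=> f g h; apply: mseriesP => m; rewrite !(@ms_mulE (mdeg m)) //.
pose T := ms_trunc (mdeg m).
transitivity ((T f * (T g * T h))@_m).
  apply: (@mcoeffM_low (mdeg m)) => // m' le_m'.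
  by rewrite ms_truncE // (ms_mulE _ _ le_m').
rewrite mulrA; apply: (@mcoeffM_low (mdeg m)) => // m' le_m'.
by rewrite ms_truncE // (ms_mulE _ _ le_m').
Qed.

Fact ms_mulC : commutative ms_mul.
Proof.
by move=> f g; apply: mseriesP => m; rewrite !(@ms_mulE (mdeg m)) // mulrC.
Qed.

Fact ms_mul1 : left_id ms1 ms_mul.
Proof.
move=> f; apply: mseriesP => m; rewrite (@ms_mulE (mdeg m)) //.
transitivity ((1 * ms_trunc (mdeg m) f)@_m); last by rewrite mul1r ms_truncE.
apply: (@mcoeffM_low (mdeg m)) => // m' le_m'.
by rewrite ms_truncE // mcoeff1.
Qed.

Fact ms_mulDl : left_distributive ms_mul ms_add.
Proof.
move=> f g h; apply: mseriesP => m /=; rewrite -big_split /=.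
by apply: eq_bigr => d _; rewrite mulrDl.
Qed.

Fact ms1_neq0 : ms1 != ms0.
Proof.
apply/eqP => /(congr1 (fun f => mscoef f 0%MM)) /eqP.
by rewrite /= eqxx oner_eq0.
Qed.

HB.instance Definition _ := GRing.Zmodule_isComNzRing.Build (mseries n k)
  ms_mulA ms_mulC ms_mul1 ms_mulDl ms1_neq0.

Fact ms_scaleA a b f : ms_scale a (ms_scale b f) = ms_scale (a * b) f.
Proof. by apply: mseriesP => m /=; rewrite mulrA. Qed.
Fact ms_scale1 : left_id 1 ms_scale.
Proof. by move=> f; apply: mseriesP => m /=; rewrite mul1r. Qed.
Fact ms_scaleDr : right_distributive ms_scale +%R.
Proof. by move=> a f g; apply: mseriesP => m /=; rewrite mulrDr. Qed.
Fact ms_scaleDl f : {morph ms_scale^~ f : a b / a + b}.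
Proof. by move=> a b; apply: mseriesP => m /=; rewrite mulrDl. Qed.

HB.instance Definition _ := GRing.Zmodule_isLmodule.Build k (mseries n k)
  ms_scaleA ms_scale1 ms_scaleDr ms_scaleDl.

Fact ms_scaleAl (a : k) f g : a *: (f * g) = a *: f * g.
Proof.
apply: mseriesP => m /=; rewrite mulr_sumr.
by apply: eq_bigr => d _; rewrite mulrA.
Qed.

HB.instance Definition _ := GRing.Lmodule_isLalgebra.Build k (mseries n k)
  ms_scaleAl.
HB.instance Definition _ := GRing.Lalgebra_isComAlgebra.Build k (mseries n k).

(* A homogeneous power series of degree d involves finitely many monomials:
   it is a homogeneous polynomial (possibly zero). *)
Definition ms_homog (d : nat) f := forall m, mdeg m != d -> f m = 0.

End PowerSeries.

Section QuotientAlgebra.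
Context {k : fieldType} {A : comAlgType k} (I : idealr A).
Implicit Types x y : {ideal_quot I}.

Definition quot_scale (c : k) x : {ideal_quot I} := \pi_{ideal_quot I} c%:A * x.

Fact quot_scaleA a b x : quot_scale a (quot_scale b x) = quot_scale (a * b) x.
Proof. by rewrite /quot_scale mulrA -rmorphM /= -scalerAl mul1r scalerA. Qed.
Fact quot_scale1 : left_id 1 quot_scale.
Proof. by move=> x; rewrite /quot_scale scale1r rmorph1 mul1r. Qed.
Fact quot_scaleDr : right_distributive quot_scale +%R.
Proof. by move=> a x y; rewrite /quot_scale mulrDr. Qed.
Fact quot_scaleDl x : {morph quot_scale^~ x : a b / a + b}.
Proof. by move=> a b; rewrite /quot_scale scalerDl rmorphD mulrDl. Qed.

HB.instance Definition _ := GRing.Zmodule_isLmodule.Build k {ideal_quot I}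
  quot_scaleA quot_scale1 quot_scaleDr quot_scaleDl.

Fact quot_scaleAl (a : k) x y : a *: (x * y) = a *: x * y.
Proof. exact: mulrA. Qed.

HB.instance Definition _ := GRing.Lmodule_isLalgebra.Build k {ideal_quot I}
  quot_scaleAl.
HB.instance Definition _ := GRing.Lalgebra_isComAlgebra.Build k {ideal_quot I}.

End QuotientAlgebra.

Section Ideals.
Context {R : comNzRingType}.
Implicit Types (G J m : set R).

Definition is_ideal J :=
  [/\ J 0, forall a b, J a -> J b -> J (a + b) & forall a b, J b -> J (a * b)].

Definition ideal_span G : set R :=
  [set a | exists n (c g : 'I_n -> R),
     (forall i, G (g i)) /\ a = \sum_i c i * g i].

Fixpoint idealX J (i : nat) : set R :=
  if i is i'.+1 then ideal_span [set a * b | a in J & b in idealX J i']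
  else setT.

Definition socle m : set R := [set a | forall b, m b -> a * b = 0].

Definition artinian :=
  forall J : nat -> set R, (forall n, is_ideal (J n)) ->
    (forall n, J n.+1 `<=` J n) ->
    exists N, forall n, (N <= n)%N -> J n = J N.

Definition socle_degree m (s : nat) :=
  idealX m s <> [set 0] /\ idealX m s.+1 = [set 0].

End Ideals.
Arguments artinian : clear implicits.

(** V / W is the subquotient defined by subspaces W `<=` V; its elements are
    given by representatives in V. *)

Section Rank.
Context {k : fieldType} {E : lmodType k}.
Implicit Types V W : set E.

Definition basis_mod V W n (v : 'I_n -> E) :=
  [/\ forall i, V (v i),
      forall u, V u -> exists c : 'I_n -> k, W (u - \sum_i c i *: v i)
    & forall c : 'I_n -> k, W (\sum_i c i *: v i) -> forall i, c i = 0].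

(* The value 0 in infinite rank is junk; over an artinian ring all the ranks
   below are finite. *)
Definition rank V W : nat :=
  xget 0%N [set n | exists v : 'I_n -> E, basis_mod V W v].

End Rank.

(** Here R is a local k-algebra with maximal ideal m such that k -> R / m is
    bijective, so that ranks over R / m are ranks over k. *)

Section LocalInvariants.
Context {k : fieldType} {R : comAlgType k} (m : set R).

Definition cm_type : nat := rank (socle m) [set 0].

Definition hilbert (i : nat) : nat := rank (idealX m i) (idealX m i.+1).

Definition socle_polynomial (p : {poly nat}) :=
  exists s, socle_degree m s /\
    p = \poly_(i < s.+1)
          rank (idealX m i `&` socle m) (idealX m i.+1 `&` socle m).

End LocalInvariants.

(** The Koszul complex K(t; R) = R (x) /\(k^n) of a sequence t of n elements of
    R.  An element is the family of its coordinates on the standard basis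
    eps_S = eps_(j_1) /\ ... /\ eps_(j_p), for S = {j_1 < ... < j_p}. *)

Section Koszul.
Context {n : nat} {k : fieldType} {R : comAlgType k} (t : 'I_n -> R).
Implicit Types (S T : {set 'I_n}).

Definition koszul : Type := {ffun {set 'I_n} -> R}.
HB.instance Definition _ := GRing.Lmodule.on koszul.
Implicit Types u v : koszul.

(* eps_T /\ eps_S = (-1) ^ (inversions T S) eps_(T u S) for disjoint T, S *)
Definition inversions T S : nat :=
  #|[pred ij : 'I_n * 'I_n | [&& ij.1 \in T, ij.2 \in S & (ij.2 < ij.1)%N]]|.

Definition wedge u v : koszul :=
  [ffun S : {set 'I_n} => \sum_(T in powerset S)
     (-1) ^+ inversions T (S :\: T) * u T * v (S :\: T)].

Definition koszul_diff u : koszul :=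
  [ffun S : {set 'I_n} => \sum_(i | i \notin S)
     (-1) ^+ inversions [set i]%SET S * t i * u (i |: S)%SET].

Definition koszul_deg (p : nat) : set koszul :=
  [set u | forall S, #|S| != p -> u S = 0].

Definition cycles (p : nat) : set koszul :=
  [set u | koszul_deg p u /\ koszul_diff u = 0].

Definition boundaries (p : nat) : set koszul :=
  [set koszul_diff w | w in koszul_deg p.+1].

End Koszul.

(** The algebra A = Tor^Q(R, k) is the Koszul homology algebra H(K(t; R)), where
    t is the image of the variables in R.  Elements of
    A_p = cycles p / boundaries p are given by representatives, and the product
    is induced by wedge. *)

Section Classes.
Context {k : fieldType} {R : comAlgType k} (t : 'I_3 -> R).
Local Notation Z := (cycles t).
Local Notation B := (boundaries t).

(* Products of total degree > 3 vanish since A_p = 0 for p > 3, and f_j e_i is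
   e_i f_j by graded commutativity; the bound r <= m makes e_1, ..., e_r exist.
   Indices start at 0. *)
Definition class_G (r : nat) :=
  exists (m : nat) (e : 'I_m -> koszul (R := R)) (f : 'I_m.+1 -> koszul)
         (g : 'I_2 -> koszul),
    [/\ (1 <= r <= m)%N,
        [/\ basis_mod (Z 1%N) (B 1%N) e, basis_mod (Z 2%N) (B 2%N) f
          & basis_mod (Z 3%N) (B 3%N) g],
        forall i j, B 2%N (wedge (e i) (e j))
      & forall (i : 'I_m) (j : 'I_m.+1), B 3%N
          (wedge (e i) (f j) -
           (if (i == j :> nat) && (i < r)%N then g ord0 else 0))].

Definition class_H00 :=
  forall (p q : nat) u v, (0 < p)%N -> (0 < q)%N ->
    Z p u -> Z q v -> B (p + q)%N (wedge u v).

End Classes.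

Section TrivariateQuotients.
Context {k : fieldType}.
Local Notation Q := (mseries 3 k).
Implicit Types I : idealr Q.

Definition q_ideal : set Q := ideal_span (range ms_var).

Definition in_q2 I := forall f, f \in I -> idealX q_ideal 2 f.

Definition homogeneous_ideal I :=
  exists G : set Q, (forall g, G g -> exists d, ms_homog d g) /\
    forall f, f \in I <-> ideal_span G f.

Definition quot_max I : set {ideal_quot I} :=
  [set \pi_{ideal_quot I} f | f in q_ideal].
Arguments quot_max : clear implicits.

Definition quot_var I (i : 'I_3) : {ideal_quot I} :=
  \pi_{ideal_quot I} (ms_var i).

(* The Hilbert function of Q, extended by 0 to negative degrees. *)
Definition hQ (i : int) : nat := if i is Posz j then 'C(j + 2, 2) else 0%N.

(* An artinian local ring is Gorenstein when its type is 1. *)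
Definition gorenstein_artinian I :=
  artinian {ideal_quot I} /\ cm_type (quot_max I) = 1%N.

Definition compressed_gorenstein I :=
  [/\ in_q2 I, gorenstein_artinian I
    & exists2 sigma, socle_degree (quot_max I) sigma &
        forall i : nat, hilbert (quot_max I) i =
          minn (hQ i%:Z) (hQ (sigma%:Z - i%:Z))].

Definition compressed_type2 I :=
  [/\ in_q2 I, artinian {ideal_quot I}, cm_type (quot_max I) = 2%N
    & exists c s : nat,
      [/\ (c <= s)%N, socle_polynomial (quot_max I) ('X^c + 'X^s)
        & forall i : nat, hilbert (quot_max I) i =
            minn (hQ i%:Z) (hQ (c%:Z - i%:Z) + hQ (s%:Z - i%:Z))]].

End TrivariateQuotients.
Arguments quot_max {k} I.
Arguments quot_var {k} I i.

Definition N1 {F : rcfType} (s : nat) : F :=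
  (3 * s%:R - 5 + Num.sqrt (24 * s%:R + 97)) / 6.

Definition N2 {F : rcfType} (s : nat) : F :=
  (s%:R - 1 + Num.sqrt (8 * s%:R + 25)) / 2.

(* Main.v *)
Require Import Defs.
From HB Require Import structures.
From mathcomp Require Import all_boot all_order all_algebra ring_quotient.
From mathcomp Require Import boolp classical_sets.
From mathcomp Require Import mpoly ring lra zify.

Set Implicit Arguments.
Unset Strict Implicit.
Unset Printing Implicit Defensive.

Import Order.TTheory GRing.Theory Num.Theory.
Local Open Scope ring_scope.
Local Open Scope classical_set_scope.
Local Open Scope quotient_scope.

(** Idea.  Write x = (x_0, x_1, x_2), s = 2 tau, and let I_d be the degree d part of I.  In vector
    notation a Koszul 1-cycle of R is a vector a with x . a in I, a 2-cycle is a vector U with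
    cross x U in I^3, boundaries are the vectors cross x w and p x, and the products in Koszul
    homology are cross a b and a . U.

    One of I1, I2, say J, has socle degree s; as Q/J is compressed, I is zero in degrees <= tau.  By
    exactness of the Koszul complex of Q, cycles modulo boundaries have order >= tau, so products lie
    in the top degree s = 2 tau of R and only components of degree tau matter.  A dimension
    count gives R_s^3 = x R_(s-1), so that products of 1-cycles vanish.  The products a . U
    lie in a line: this is clear if s1 < s, when R_s is a line, and if s1 = s then
    dim I_(tau+1) <= 3, and skew-symmetry of the pairing (u . cross u v = 0) gives it.
    Bases diagonalising the pairing then show that R is of class H(0,0) or G(r), according to
    whether the pairing is zero.

    If s1 >= N2 then I_(tau+1) = 0 and the pairing vanishes.  If s1 < N1, then the degree tau
    cycles are too many to be orthogonal for the perfect pairing that Q/J induces on (Q_tau)^3. *)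

(** * Dimensions of subquotients *)

(** Both bounds are quadratic inequalities solved for s1 = tau + 1 + n. By the compressed Hilbert
    function, I_(tau+1) = 0 exactly when C(tau+3,2) <= C(n+2,2) + C(tau+1,2), that is 4 tau + 4 <=
    n^2 + 3 n; this is N2 <= s1. If h1 and h2 are the dimensions of R in degrees tau + 1 and tau +
    2, orthogonality of all cycles is impossible as soon as 4 h1 < 3 C(tau+2,2) + h2, that is 3 n^2
    + 11 n + 2 < 4 tau; this is s1 < N1. Between the bounds neither count decides, so (c) keeps both
    classes.

    The delicate case is s1 = s: R_s is then a plane, and degrees alone do not force the products
    into a line. There s >= 6 bounds dim I_(tau+1) by 3, with equality only for s = 6, and a rank
    argument on syzygy matrices finishes. *)

Section LinearOn.
Context {k : fieldType}.
Implicit Types E : lmodType k.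

Definition subspace E (V : set E) :=
  V 0 /\ forall (a : k) u v, V u -> V v -> V (a *: u + v).

Definition linear_on E (E' : lmodType k) (V : set E) (f : E -> E') :=
  forall (a : k) u v, V u -> V v -> f (a *: u + v) = a *: f u + f v.

Lemma subspaceD E (V : set E) u v : subspace V -> V u -> V v -> V (u + v).
Proof. by case=> _ VL Vu Vv; rewrite -[u]scale1r; apply: VL. Qed.

Lemma subspaceZ E (V : set E) (a : k) u : subspace V -> V u -> V (a *: u).
Proof. by case=> V0 VL Vu; rewrite -[_ *: _]addr0; apply: VL. Qed.

Lemma subspaceB E (V : set E) u v : subspace V -> V u -> V v -> V (u - v).
Proof.
by move=> sV Vu Vv; rewrite -scaleN1r; apply: subspaceD => //; apply: subspaceZ.
Qed.

Lemma subspace_sum E (V : set E) (I : Type) (r : seq I) (P : pred I) (F : I -> E) :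
  subspace V -> (forall i, P i -> V (F i)) -> V (\sum_(i <- r | P i) F i).
Proof.
move=> sV VF; elim/big_ind: _ => //; first by case: sV.
by move=> *; apply: subspaceD.
Qed.

Lemma subspace0 E : subspace [set (0 : E)].
Proof. by split=> // a u v /= -> ->; rewrite scaler0 addr0. Qed.

Lemma subspaceI E (V W : set E) : subspace V -> subspace W -> subspace (V `&` W).
Proof.
move=> [V0 VL] [W0 WL]; split=> // a u v [Vu Wu] [Vv Wv].
by split; [apply: VL | apply: WL].
Qed.

Section Fun.
Variables (E E' : lmodType k) (V : set E) (f : E -> E').
Hypotheses (sV : subspace V) (lf : linear_on V f).

Lemma linear_on0 : f 0 = 0.
Proof.
have [V0 _] := sV; have := lf 1 V0 V0; rewrite !scale1r addr0 => /eqP.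
by rewrite -subr_eq0 opprD addrA subrr sub0r oppr_eq0 => /eqP.
Qed.

Lemma linear_onZ a u : V u -> f (a *: u) = a *: f u.
Proof.
by move=> Vu; rewrite -[_ *: u]addr0 lf ?linear_on0 ?addr0 //; case: sV.
Qed.

Lemma linear_onD u v : V u -> V v -> f (u + v) = f u + f v.
Proof. by move=> Vu Vv; rewrite -[u]scale1r lf // !scale1r. Qed.

Lemma linear_onB u v : V u -> V v -> f (u - v) = f u - f v.
Proof.
move=> Vu Vv; rewrite -!scaleN1r linear_onD //; last exact: subspaceZ.
by rewrite linear_onZ.
Qed.

Lemma linear_on_sum (I : Type) (r : seq I) (F : I -> E) :
  (forall i, V (F i)) -> f (\sum_(i <- r) F i) = \sum_(i <- r) f (F i).
Proof.
move=> VF; elim: r => [|i r IHr]; first by rewrite !big_nil linear_on0.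
by rewrite !big_cons linear_onD ?IHr //; apply: subspace_sum.
Qed.

Lemma linear_on_comb n (c : 'I_n -> k) (F : 'I_n -> E) :
  (forall i, V (F i)) ->
  f (\sum_i c i *: F i) = \sum_i c i *: f (F i).
Proof.
move=> VF; rewrite linear_on_sum; last by move=> i; apply: subspaceZ.
by apply: eq_bigr => i _; rewrite linear_onZ.
Qed.

Lemma subspace_preim (W : set E') : subspace W -> subspace (V `&` (f @^-1` W)).
Proof.
move=> sW; split; first by split; [case: sV | rewrite /= linear_on0; case: sW].
move=> a u v [Vu Wu] [Vv Wv]; split; first by case: sV => _; apply.
by rewrite /= lf //; case: sW => _; apply.
Qed.

End Fun.

(** V / W is presented by coordinates instead of a basis, so that maps and their kernels become
    matrices. Unlike [rank], whose value 0 may be a default, it asserts finite dimension. *)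
Definition dimq E (V W : set E) n := exists phi : E -> 'rV[k]_n,
  [/\ linear_on V phi, forall u, V u -> (W u <-> phi u = 0)
    & forall c, exists2 u, V u & phi u = c].

Lemma basis_mod_dimq E (V W : set E) n (v : 'I_n -> E) :
  subspace V -> subspace W -> basis_mod V W v -> dimq V W n.
Proof.
move=> sV sW [Vv spanv freev].
have /choice[phi0 phi0P] : forall u, exists c : 'I_n -> k,
    V u -> W (u - \sum_i c i *: v i).
  move=> u; have [Vu|nVu] := pselect (V u); last by exists (fun=> 0).
  by have [c cP] := spanv u Vu; exists c.
(* Coordinates are unique modulo W, which makes the map obtained by choice linear on V. *)
have uniq u (c : 'I_n -> k) : V u -> W (u - \sum_i c i *: v i) ->
    forall i, phi0 u i = c i.
  move=> Vu Wc i; apply/eqP; rewrite -subr_eq0; apply/eqP; move: i.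
  apply: freev; have := subspaceB sW Wc (phi0P u Vu).
  congr (W _); under [RHS]eq_bigr do rewrite scalerBl.
  by rewrite sumrB opprB addrC addrA subrK.
exists (fun u => \row_i phi0 u i); split.
- move=> a u u' Vu Vu'; apply/rowP => i; rewrite !mxE.
  have Vau : V (a *: u + u') by case: sV => _; apply.
  apply: (uniq _ (fun i => a * phi0 u i + phi0 u' i)) => //.
  under eq_bigr do rewrite scalerDl -scalerA.
  rewrite big_split /= -scaler_sumr opprD addrACA -scalerBr.
  by apply: sW.2; apply: phi0P.
- move=> u Vu; split=> [Wu|u0].
    apply/rowP => i; rewrite !mxE; apply: (uniq _ (fun=> 0)) => //.
    by rewrite big1 ?subr0 // => j _; rewrite scale0r.
  have := phi0P _ Vu; rewrite big1 ?subr0 // => i _.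
  by move/rowP: u0 => /(_ i); rewrite !mxE => ->; rewrite scale0r.
- move=> c; exists (\sum_i c 0 i *: v i).
    by apply: subspace_sum => // i _; apply: subspaceZ.
  apply/rowP => i; rewrite !mxE; apply: (uniq _ (fun i => c 0 i)).
    by apply: subspace_sum => // j _; apply: subspaceZ.
  by rewrite subrr; case: sW.
Qed.

Lemma dimq_lift E (V : set E) n (phi : E -> 'rV[k]_n) :
  (forall c, exists2 u, V u & phi u = c) ->
  exists v : 'I_n -> E, forall i, V (v i) /\ phi (v i) = delta_mx 0 i.
Proof.
move=> phi_surj; have /choice[v vP] : forall i : 'I_n, exists u,
    V u /\ phi u = delta_mx 0 i.
  by move=> i; have [u] := phi_surj (delta_mx 0 i); exists u.
by exists v.
Qed.

Lemma lift_comb E (V : set E) n (phi : E -> 'rV[k]_n) (v : 'I_n -> E) (c : 'rV_n) :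
  subspace V -> linear_on V phi ->
  (forall i, V (v i) /\ phi (v i) = delta_mx 0 i) ->
  phi (\sum_i c 0 i *: v i) = c.
Proof.
move=> sV lphi vP; rewrite (linear_on_comb sV lphi); last by move=> i; case: (vP i).
by rewrite [RHS]row_sum_delta; apply: eq_bigr => i _; case: (vP i) => _ ->.
Qed.

Lemma dimq_basis E (V W : set E) n : subspace V -> subspace W ->
  dimq V W n -> exists v : 'I_n -> E, basis_mod V W v.
Proof.
move=> sV sW [phi [lphi phi0 phi_surj]].
have [v vP] := dimq_lift phi_surj; exists v.
have Vc (c : 'I_n -> k) : V (\sum_i c i *: v i).
  by apply: subspace_sum => // i _; apply: subspaceZ => //; case: (vP i).
have phic (c : 'I_n -> k) : phi (\sum_i c i *: v i) = \row_i c i.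
  rewrite -[RHS](lift_comb _ sV lphi vP); congr phi.
  by apply: eq_bigr => i _; rewrite mxE.
split=> [i|u Vu|c Wc i]; first by case: (vP i).
- exists (fun i => phi u 0 i); apply/phi0; first exact: subspaceB.
  rewrite (linear_onB sV lphi) // phic; apply/eqP; rewrite subr_eq0.
  by apply/eqP/rowP => i; rewrite mxE.
- by have /rowP/(_ i) := (phi0 _ (Vc c)).1 Wc; rewrite phic !mxE.
Qed.

Section Compare.
Variables (E E' : lmodType k) (V W : set E) (V' W' : set E') (n n' : nat).
Variable f : E -> E'.
Hypotheses (sV : subspace V) (sV' : subspace V') (sW' : subspace W').
Hypotheses (lf : linear_on V f) (fV : forall u, V u -> V' (f u)).
Hypotheses (dV : dimq V W n) (dV' : dimq V' W' n').

(** As f is not assumed to send W into W', the matrix A represents f only on combinations of the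
    chosen lifts v. That is enough to test injectivity. *)
Lemma dimq_mat : exists (phi : E -> 'rV[k]_n) (phi' : E' -> 'rV[k]_n')
    (v : 'I_n -> E) (A : 'M[k]_(n, n')),
  [/\ [/\ linear_on V phi, forall u, V u -> (W u <-> phi u = 0)
      & forall c : 'rV_n, V (\sum_i c 0 i *: v i) /\ phi (\sum_i c 0 i *: v i) = c],
      [/\ linear_on V' phi', forall u, V' u -> (W' u <-> phi' u = 0)
      & forall c, exists2 u, V' u & phi' u = c]
    & forall c : 'rV_n, phi' (f (\sum_i c 0 i *: v i)) = c *m A].
Proof.
have [phi [lphi phi0 phi_surj]] := dV; have [phi' [lphi' phi0' phi_surj']] := dV'.
have [v vP] := dimq_lift phi_surj.
have Vv i : V (v i) by case: (vP i).
exists phi, phi', v, (\matrix_i phi' (f (v i))); split=> //.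
  split=> // c; split; last exact: lift_comb vP.
  by apply: subspace_sum => // i _; apply: subspaceZ.
move=> c; rewrite (linear_on_comb sV lf) //.
rewrite (linear_on_comb sV' lphi'); last by move=> i; apply: fV.
by rewrite mulmx_sum_row; apply: eq_bigr => i _; rewrite rowK.
Qed.

Lemma dimq_inj_le : (forall u, V u -> W' (f u) -> W u) -> (n <= n')%N.
Proof.
move=> injf; have [phi [phi' [v [A [[lphi phi0 vP] [lphi' phi0' _] fA]]]]] := dimq_mat.
suff /eqP <- : row_free A by apply: rank_leq_col.
apply: inj_row_free => c cA0.
have [Vc <-] := vP c; apply/phi0 => //; apply: injf => //.
by apply/phi0'; [exact: fV | rewrite fA].
Qed.

Lemma dimq_inj_surj : n = n' -> (forall u, V u -> W' (f u) -> W u) ->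
  forall u', V' u' -> exists2 u, V u & W' (u' - f u).
Proof.
move=> eqn injf u' Vu'.
have [phi [phi' [v [A [[lphi phi0 vP] [lphi' phi0' _] fA]]]]] := dimq_mat.
have freeA : row_free A.
  apply: inj_row_free => c cA0.
  have [Vc <-] := vP c; apply/phi0 => //; apply: injf => //.
  by apply/phi0'; [exact: fV | rewrite fA].
have fullA : row_full A by rewrite /row_full (eqP freeA); apply/eqP.
have /submxP[c cE] := submx_full (phi' u') fullA.
have [Vc _] := vP c; exists (\sum_i c 0 i *: v i) => //.
apply/phi0'; first by apply: subspaceB => //; apply: fV.
by rewrite (linear_onB sV' lphi') ?fA ?cE ?subrr //; apply: fV.
Qed.

End Compare.

Section Iso.
Variables (E E' : lmodType k) (V W : set E) (V' W' : set E') (n : nat).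
Variable f : E -> E'.
Hypotheses (sV : subspace V) (sV' : subspace V') (sW' : subspace W').
Hypotheses (lf : linear_on V f) (fV : forall u, V u -> V' (f u)).

Lemma dimq_iso : (forall u, V u -> (W' (f u) <-> W u)) ->
  (forall u', V' u' -> exists2 u, V u & W' (u' - f u)) ->
  dimq V W n -> dimq V' W' n.
Proof.
move=> fW surjf [phi [lphi phi0 surjphi]].
have /choice[g gP] : forall u', exists u, V' u' -> V u /\ W' (u' - f u).
  move=> u'; have [Vu'|] := pselect (V' u'); last by exists 0.
  by have [u] := surjf u' Vu'; exists u.
(* Two preimages of the same element modulo W' have equal coordinates, so [phi \o g] does not depend
   on the section g obtained by choice. *)
have eq_phi u1 u2 : V u1 -> V u2 -> W' (f u1 - f u2) -> phi u1 = phi u2.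
  move=> V1 V2; rewrite -(linear_onB sV lf) // => /fW Wu.
  have {Wu} := Wu (subspaceB sV V1 V2).
  move/phi0 => /(_ (subspaceB sV V1 V2)); rewrite (linear_onB sV lphi) //.
  by move/eqP; rewrite subr_eq0 => /eqP.
exists (phi \o g); split=> /=.
- move=> a u v Vu Vv; have [Vgu Wu] := gP u Vu; have [Vgv Wv] := gP v Vv.
  have [|Vguv Wuv] := gP (a *: u + v); first by case: sV' => _; apply.
  rewrite -lphi //; apply: eq_phi => //; first by case: sV => _; apply.
  rewrite lf //.
  have W1 : W' (a *: (u - f (g u)) + (v - f (g v))) by case: sW' => _; apply.
  have := subspaceB sW' W1 Wuv; congr (W' _).
  by rewrite scalerBr [X in X - _]addrACA opprB [LHS]addrC [LHS]addrA subrK -opprD.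
- move=> u Vu; have [Vg Wg] := gP u Vu; rewrite -phi0 // -fW //.
  split=> Wu; first by rewrite -[f _](subKr u); apply: subspaceB.
  by rewrite -[u](subrK (f (g u))); apply: subspaceD.
- move=> c; have [u Vu <-] := surjphi c; exists (f u); first exact: fV.
  have [Vg Wg] := gP _ (fV Vu); apply: eq_phi => //.
  by rewrite -opprB -sub0r; apply: subspaceB => //; case: sW'.
Qed.

End Iso.

Lemma dimq_uniq E (V W : set E) n n' : subspace V -> subspace W ->
  dimq V W n -> dimq V W n' -> n = n'.
Proof.
move=> sV sW dn dn'; apply/eqP; rewrite eqn_leq.
by rewrite (dimq_inj_le (f := id) _ _ _ _ dn dn') ?(dimq_inj_le (f := id) _ _ _ _ dn' dn).
Qed.

(** Take a matrix of maximal rank among those whose row space lies in S: adjoining a further row c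
    of S cannot raise the rank, so c was already in the row space. *)
Lemma subspace_rV n (S : set 'rV[k]_n) : subspace S ->
  exists2 G : 'M[k]_n, forall c, S c <-> (c <= G)%MS & True.
Proof.
move=> sS; pose P r := `[< exists2 G : 'M[k]_n,
  \rank G = r & forall c, (c <= G)%MS -> S c >].
have P0 : exists r, P r.
  exists 0%N; apply/asboolP; exists 0; first exact: mxrank0.
  by move=> c; rewrite submx0 => /eqP ->; case: sS.
have Pn r : P r -> (r <= n)%N by move=> /asboolP[G <- _]; apply: rank_leq_row.
case: (ex_maxnP P0 Pn) => r /asboolP[G rG GS] maxr.
exists G => // c; split=> [Sc|]; last exact: GS.
have PGc : P (\rank (G + <<c>>)%MS).
  apply/asboolP; exists (G + <<c>>)%MS => // c' /sub_addsmxP[[u v] /= ->].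
  apply: subspaceD => //; first by apply: GS; apply: submxMl.
  have : (v *m <<c>>%MS <= c)%MS by rewrite (submx_trans (submxMl _ _)) ?genmxE.
  by case/sub_rVP => a ->; apply: subspaceZ.
have := maxr _ PGc; rewrite -rG => le_r.
have : (G + <<c>> <= G)%MS.
  by have [_ <-] := mxrank_leqif_sup (addsmxSl G <<c>>%MS); rewrite eqn_leq le_r andbT mxrankS ?addsmxSl.
by rewrite addsmx_sub genmxE => /andP[].
Qed.

(** In the coordinates of V / W the image of U is the row space of a matrix G. A row base of G gives
    coordinates on U / W, and the cokernel of G gives coordinates on V / U. *)
Lemma dimq_sub E (V U W : set E) n : subspace V -> subspace U -> subspace W ->
  U `<=` V -> W `<=` U -> dimq V W n ->
  exists r, [/\ (r <= n)%N, dimq U W r & dimq V U (n - r)%N].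
Proof.
move=> sV sU sW UV WU [phi [lphi phi0 surjphi]].
have phiB u v : V u -> V v -> phi u = phi v -> W (u - v).
  move=> Vu Vv eqphi; apply/phi0; first exact: subspaceB.
  by rewrite (linear_onB sV lphi) // eqphi subrr.
have [|G GP _] := @subspace_rV n [set phi u | u in U].
  split; first by exists 0; [case: sU | rewrite (linear_on0 sV lphi)].
  move=> a _ _ [u Uu <-] [v Uv <-]; exists (a *: u + v); first by case: sU => _; apply.
  by rewrite lphi //; apply: UV.
have GU u : V u -> (phi u <= G)%MS <-> U u.
  move=> Vu; rewrite -GP; split=> [[u' Uu' eqphi]|Uu]; last by exists u.
  rewrite -[u](subrK u'); apply: subspaceD => //; apply: WU.
  by apply: phiB => //; apply: UV.
exists (\rank G); split; first exact: rank_leq_col.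
- exists (fun u => phi u *m pinvmx (row_base G)); split.
  + by move=> a u v Uu Uv; rewrite lphi ?mulmxDl ?scalemxAl //; apply: UV.
  + move=> u Uu; rewrite (phi0 _ (UV _ Uu)); split=> [->|u0]; first exact: mul0mx.
    have : (phi u <= row_base G)%MS by rewrite eq_row_base; apply/GU => //; apply: UV.
    by move/mulmxKpV <-; rewrite u0 mul0mx.
  + move=> c; have : (c *m row_base G <= G)%MS by rewrite -(eq_row_base G) submxMl.
    move/GP => [u Uu phiu]; exists u => //.
    by rewrite phiu mulmxKp // row_base_free.
- rewrite -mxrank_coker; exists (fun u => phi u *m col_base (cokermx G)); split.
  + by move=> a u v Vu Vv; rewrite lphi // mulmxDl scalemxAl.
  + move=> u Vu; rewrite -(GU u Vu) submxE -{1}(mulmx_base (cokermx G)) mulmxA.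
    split=> [/eqP H|->]; last by rewrite mul0mx.
    by apply: (row_free_inj (row_base_free (cokermx G))); rewrite mul0mx.
  + move=> c; have /submxP[d ->] := submx_full c (col_base_full (cokermx G)).
    by have [u Vu <-] := surjphi d; exists u.
Qed.

Lemma dimq_ker E (E' : lmodType k) (V W : set E) (V' W' : set E') n n' (f : E -> E') :
  subspace V -> subspace V' -> subspace W -> subspace W' ->
  linear_on V f -> (forall u, V u -> V' (f u)) ->
  W `<=` V -> (forall u, W u -> W' (f u)) ->
  dimq V W n -> dimq V' W' n' ->
  exists2 a, dimq (V `&` (f @^-1` W')) W a & (n <= a + n')%N.
Proof.
move=> sV sV' sW sW' lf fV WV fW dV dV'.
have sK := subspace_preim sV lf sW'.
have WK : W `<=` V `&` (f @^-1` W') by move=> u Wu; split; [exact: WV | exact: fW].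
have [r [le_rn dK dVK]] := dimq_sub sV sK sW (@subIsetl _ _ _) WK dV.
exists r => //; rewrite -leq_subLR.
by apply: (dimq_inj_le sV sV' lf fV dVK dV') => u Vu Wu; split.
Qed.

Lemma dimq_ker_surj E (E' : lmodType k) (V W : set E) (V' W' : set E') n n' (f : E -> E') :
  subspace V -> subspace V' -> subspace W -> subspace W' ->
  linear_on V f -> (forall u, V u -> V' (f u)) ->
  W `<=` V -> (forall u, W u -> W' (f u)) ->
  (forall u', V' u' -> exists2 u, V u & W' (u' - f u)) ->
  dimq V W n -> dimq V' W' n' ->
  exists2 a, dimq (V `&` (f @^-1` W')) W a & n = (a + n')%N.
Proof.
move=> sV sV' sW sW' lf fV WV fW surjf dV dV'.
have sK := subspace_preim sV lf sW'.
have WK : W `<=` V `&` (f @^-1` W') by move=> u Wu; split; [exact: WV | exact: fW].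
have [r [le_rn dK dVK]] := dimq_sub sV sK sW (@subIsetl _ _ _) WK dV.
exists r => //.
have -> : n' = (n - r)%N; last by rewrite subnKC.
apply: (dimq_uniq sV' sW' dV'); apply: (dimq_iso sV sV' sW' lf fV _ surjf dVK).
by move=> u Vu; split=> [Wu|[]].
Qed.

Lemma dimq0_sub E (V W : set E) : dimq V W 0 -> V `<=` W.
Proof. by move=> [phi [_ phi0 _]] u Vu; apply/phi0 => //; apply/rowP; case. Qed.

Lemma dimq_prod E (E' : lmodType k) (V W : set E) (V' W' : set E') n n' :
  dimq V W n -> dimq V' W' n' ->
  dimq [set u : E * E' | V u.1 /\ V' u.2] [set u | W u.1 /\ W' u.2] (n + n').
Proof.
move=> [phi [lphi phi0 surjphi]] [phi' [lphi' phi0' surjphi']].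
exists (fun u => row_mx (phi u.1) (phi' u.2)); split.
- move=> a [u u'] [v v'] [/= Vu Vu'] [/= Vv Vv'].
  by rewrite lphi // lphi' // scale_row_mx add_row_mx.
- move=> [u u'] [/= Vu Vu']; rewrite phi0 // phi0' //.
  split=> [[-> ->]|]; first by rewrite row_mx0.
  by rewrite -row_mx0 => /eq_row_mx.
- move=> c; have [u Vu uE] := surjphi (lsubmx c); have [u' Vu' uE'] := surjphi' (rsubmx c).
  by exists (u, u') => //=; rewrite uE uE' hsubmxK.
Qed.

(** Let F hold the coordinates of a basis of L, and A the pairings of a basis of D with a basis of
    V. Orthogonality reads F A = 0; F has rank l, and nondegeneracy gives A rank d. *)
Lemma dimq_perp E (V D L : set E) N d l (b : E -> E -> k^o) :
  subspace V -> subspace D -> subspace L -> D `<=` V -> L `<=` V ->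
  (forall w, V w -> linear_on V (b^~ w)) -> (forall u, V u -> linear_on V (b u)) ->
  (forall u, V u -> (forall w, V w -> b u w = 0) -> u = 0) ->
  (forall u w, D u -> L w -> b u w = 0) ->
  dimq V [set 0] N -> dimq D [set 0] d -> dimq L [set 0] l -> (d + l <= N)%N.
Proof.
move=> sV sD sL DV LV linl linr nondeg perp dV dD dL.
have [phi [lphi phi0 surj]] := dV; have [e eP] := dimq_lift surj.
have [phiD [lD D0 surjD]] := dD; have [x xP] := dimq_lift surjD.
have [phiL [lL L0 surjL]] := dL; have [y yP] := dimq_lift surjL.
have Ve i : V (e i) by case: (eP i).
have Dx i : D (x i) by case: (xP i).
have Ly i : L (y i) by case: (yP i).
have eK u : V u -> u = \sum_i phi u 0 i *: e i.
  move=> Vu; apply/eqP; rewrite -subr_eq0; apply/eqP.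
  have Vs : V (\sum_i phi u 0 i *: e i).
    by apply: subspace_sum => // i _; apply: subspaceZ.
  apply/(phi0 _ (subspaceB sV Vu Vs)).
  by rewrite (linear_onB sV lphi) // (lift_comb _ sV lphi eP) subrr.
pose A := \matrix_(m, i) b (x i) (e m) : 'M[k]_(N, d).
pose F := \matrix_j phi (y j) : 'M[k]_(l, N).
have FA0 : F *m A = 0.
  apply/matrixP => j i; rewrite [RHS]mxE [LHS]mxE; transitivity (b (x i) (y j)); last exact: perp.
  rewrite [in RHS](eK _ (LV _ (Ly j))) (linear_on_comb sV (linr _ (DV _ (Dx i)))) //.
  transitivity (\sum_m phi (y j) 0 m * b (x i) (e m)); last by [].
  by apply: eq_bigr => m _; rewrite !mxE.
have freeF : row_free F.
  apply: inj_row_free => c cF0.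
  have Lc : L (\sum_i c 0 i *: y i) by apply: subspace_sum => // i _; apply: subspaceZ.
  rewrite -(lift_comb c sL lL yP); apply/L0 => //; apply/phi0; first exact: LV.
  rewrite (linear_on_comb sV lphi); last by move=> i; apply: LV.
  rewrite -[RHS]cF0 mulmx_sum_row; apply: eq_bigr => i _; by rewrite rowK.
have freeA : row_free A^T.
  apply: inj_row_free => c cA0.
  have Dc : D (\sum_i c 0 i *: x i) by apply: subspace_sum => // i _; apply: subspaceZ.
  rewrite -(lift_comb c sD lD xP); apply/D0 => //; apply: nondeg; first exact: DV.
  move=> w Vw; rewrite (eK _ Vw) (linear_on_comb sV (linr _ (DV _ Dc))) //.
  rewrite big1 // => m _.
  rewrite (linear_on_comb sV (linl _ (Ve m))); last by move=> i; apply: DV.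
  have /rowP/(_ m) := cA0; rewrite !mxE => cm0.
  rewrite (_ : \sum_i _ = 0) ?scaler0 // -[RHS]cm0.
  transitivity (\sum_i c 0 i * b (x i) (e m)); first by [].
  by apply: eq_bigr => i _; rewrite !mxE.
have := mulmx0_rank_max FA0; move: freeF freeA.
by rewrite /row_free mxrank_tr addnC => /eqP -> /eqP ->.
Qed.

Lemma rank_dimq E (V W : set E) n : subspace V -> subspace W ->
  dimq V W n -> rank V W = n.
Proof.
move=> sV sW dn; have [v vP] := dimq_basis sV sW dn.
apply: xget_unique => /=; first by exists v.
by move=> m [w wP]; apply: (dimq_uniq sV sW) => //; apply: basis_mod_dimq wP.
Qed.

(** Only a positive rank certifies that a basis exists, since 0 is also the default value; hence the
    successor. *)
Lemma dimq_rank E (V W : set E) n : subspace V -> subspace W ->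
  rank V W = n.+1 -> dimq V W n.+1.
Proof.
move=> sV sW; rewrite /rank; case: xgetP => // m -> [v vP] <-.
exact: basis_mod_dimq vP.
Qed.

End LinearOn.

(** * Homogeneous components of power series *)

Section HomogeneousComponents.
Context {n : nat} {k : fieldType}.
Local Notation Q := (mseries n k).
Implicit Types f g : Q.

Lemma mscoefD f g m : (f + g) m = f m + g m. Proof. by []. Qed.
Lemma mscoefN f m : (- f) m = - f m. Proof. by []. Qed.
Lemma mscoefZ c f m : (c *: f) m = c * f m. Proof. by []. Qed.
Lemma mscoef0 m : (0 : Q) m = 0. Proof. by []. Qed.

Lemma mscoef_sum (I : Type) (r : seq I) (F : I -> Q) m :
  (\sum_(i <- r) F i) m = \sum_(i <- r) F i m.
Proof. by elim: r => [|i r IH]; rewrite ?big_nil // !big_cons mscoefD IH. Qed.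

Definition hcomp (d : nat) f : Q := MSeries (fun m => if mdeg m == d then f m else 0).

Definition ord_ge (d : nat) f := forall m, (mdeg m < d)%N -> f m = 0.

Lemma hcomp_is_linear d : linear (hcomp d).
Proof.
move=> c f g; apply: mseriesP => m; rewrite mscoefD mscoefZ /=.
by case: ifP => // _; rewrite mulr0 addr0.
Qed.
HB.instance Definition _ d :=
  GRing.isLinear.Build k Q Q *:%R (hcomp d) (hcomp_is_linear d).

Lemma hcomp_homog d f : ms_homog d (hcomp d f).
Proof. by move=> m /negbTE /= ->. Qed.

Lemma homog_hcomp d f : ms_homog d f -> hcomp d f = f.
Proof. by move=> hf; apply: mseriesP => m /=; case: ifPn => // /hf. Qed.

Lemma homog_hcomp_neq d e f : ms_homog d f -> e != d -> hcomp e f = 0.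
Proof.
move=> hf ne_ed; apply: mseriesP => m /=; case: eqP => // em.
by rewrite hf // em.
Qed.

Lemma subspace_homog d : subspace (@ms_homog n k d).
Proof.
by split=> [m //|a u v hu hv m md]; rewrite mscoefD mscoefZ hu ?hv // mulr0 addr0.
Qed.

Lemma homogD d f g : ms_homog d f -> ms_homog d g -> ms_homog d (f + g).
Proof. exact: subspaceD (subspace_homog d). Qed.

Lemma homogB d f g : ms_homog d f -> ms_homog d g -> ms_homog d (f - g).
Proof. exact: subspaceB (subspace_homog d). Qed.

Lemma homogN d f : ms_homog d f -> ms_homog d (- f).
Proof. by move=> hf m /hf; rewrite mscoefN => ->; rewrite oppr0. Qed.

Lemma homog_ord d f : ms_homog d f -> ord_ge d f.
Proof. by move=> hf m lt_md; rewrite hf // neq_ltn lt_md. Qed.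

Lemma ord_ge_sub d e f : (d <= e)%N -> ord_ge e f -> ord_ge d f.
Proof. by move=> le_de hf m lt_md; apply/hf/(leq_trans lt_md). Qed.

Lemma ord_geB_hcomp d f : ord_ge d f -> ord_ge d.+1 (f - hcomp d f).
Proof.
move=> hf m; rewrite ltnS leq_eqVlt mscoefD mscoefN /=.
case: ifP => [_ _|_ /= lt_md]; first by rewrite subrr.
by rewrite hf ?subr0.
Qed.

Lemma subspace_ord d : subspace (ord_ge d).
Proof.
by split=> [m //|a u v hu hv m md]; rewrite mscoefD mscoefZ hu ?hv // mulr0 addr0.
Qed.

Lemma hcompM d e f g : ms_homog d g ->
  hcomp e (g * f) = if (d <= e)%N then g * hcomp (e - d) f else 0.
Proof.
move=> hg; apply: mseriesP => m /=.
case: leqP => [le_de|lt_ed] /=.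
  case: ifP => [/eqP me|me].
    apply: eq_bigr => -[a b] /= /eqP em; have eab : e = (mdeg a + mdeg b)%N by rewrite -mdegD -em me.
    case: (eqVneq (mdeg a) d) => [ad|/hg -> ]; last by rewrite !mul0r.
    by rewrite eab ad addnC addnK eqxx.
  rewrite big1 // => -[a b] /= /eqP em; have := congr1 mdeg em; rewrite mdegD => eab.
  case: (eqVneq (mdeg a) d) => [ad|/hg -> ]; last by rewrite !mul0r.
  case: eqP => bd; last by rewrite mulr0.
  by move/eqP: me; case; rewrite eab ad bd subnKC.
case: ifP => [/eqP me|//].
rewrite big1 // => -[a b] /= /eqP em; have eab : e = (mdeg a + mdeg b)%N by rewrite -mdegD -em me.
rewrite hg ?mul0r //; apply/eqP => ad.
by move: lt_ed; rewrite eab ad ltnNge leq_addr.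
Qed.

Lemma homogM d e f g : ms_homog d f -> ms_homog e g -> ms_homog (d + e) (f * g).
Proof.
move=> hf hg; have := hcompM (d + e) g hf; rewrite leq_addr addKn.
by rewrite (homog_hcomp hg) => <-; apply: hcomp_homog.
Qed.

Lemma ord_geM d e f g : ord_ge d f -> ord_ge e g -> ord_ge (d + e) (f * g).
Proof.
move=> hf hg m lt_m /=; rewrite big1 // => -[a b] /= /eqP em.
have [lt_ad|le_da] := ltnP (mdeg a) d; first by rewrite hf ?mul0r.
rewrite hg ?mulr0 //; have eab : mdeg m = (mdeg a + mdeg b)%N by rewrite -mdegD -em.
by rewrite ltnNge; apply/negP => le_eb; move: lt_m; rewrite eab ltnNge leq_add.
Qed.

Lemma homog_var i : ms_homog 1 (ms_var i : Q).
Proof. by move=> m /=; case: (m =P _) => [->|//]; rewrite mdeg1. Qed.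

Lemma hcompXS i d f : hcomp d.+1 (ms_var i * f) = ms_var i * hcomp d f.
Proof. by rewrite (hcompM _ _ (homog_var i)) /= subn1. Qed.

Lemma homogX i d f : ms_homog d f -> ms_homog d.+1 (ms_var i * f).
Proof. by move=> hf; have := homogM (homog_var i) hf. Qed.

Lemma mscoefX i f m :
  (ms_var i * f) m = if m i == 0%N then 0 else f (m - U_(i))%MM.
Proof.
rewrite /=; case: eqP => [mi0|/eqP mi].
  rewrite big1 // => -[a b] /= /eqP em; case: eqP => [ai|_]; last by rewrite mul0r.
  have : m i = 1%N + b i; last by rewrite mi0.
  by rewrite {1}em ai mnmDE mnm1E eqxx.
have le_im : (U_(i) <= m)%MM.
  by apply/mnm_lepP => j; rewrite mnm1E; case: eqP => // <-; rewrite lt0n.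
have lt1 : (mdeg (U_(i))%MM < (mdeg m).+1)%N.
  by rewrite ltnS -(submK le_im) mdegD leq_addl.
have lt2 : (mdeg (m - U_(i))%MM < (mdeg m).+1)%N by rewrite ltnS mdegB.
rewrite (bigD1 (BMultinom lt1, BMultinom lt2)) /=; last by rewrite addmC submK.
rewrite eqxx mul1r big1 ?addr0 // => -[a b] /= /andP[/eqP em ne].
case: eqP => [ai|_]; last by rewrite mul0r.
case/eqP: ne; congr pair; apply: val_inj => //=.
by rewrite -ai -{1}[b : 'X_{1..n}](addmK a) addmC -em.
Qed.

Lemma mscoefXD i f m : (ms_var i * f) (m + U_(i))%MM = f m.
Proof. by rewrite mscoefX mnmDE mnm1E eqxx addn1 /= addmK. Qed.

Lemma mscoefX0 i f (m : 'X_{1..n}) : m i = 0%N -> (ms_var i * f) m = 0.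
Proof. by rewrite mscoefX => ->. Qed.

Lemma ms_varI i : injective (fun f => ms_var i * f).
Proof.
by move=> f g efg; apply: mseriesP => m; rewrite -(mscoefXD i f) efg mscoefXD.
Qed.

(** Division by the i-th variable; the terms free of that variable are discarded. *)
Definition ms_shift i f : Q := MSeries (fun m => f (m + U_(i))%MM).

Lemma ms_shiftK i f : (forall m : 'X_{1..n}, m i = 0%N -> f m = 0) ->
  ms_var i * ms_shift i f = f.
Proof.
move=> f0; apply: mseriesP => m; rewrite mscoefX; case: eqP => [/f0 //|/eqP mi].
rewrite /= submK //; apply/mnm_lepP => j; rewrite mnm1E.
by case: eqP => // <-; rewrite lt0n.
Qed.

(* Series with finitely many terms, as values of the ring embedding of the
   polynomials; it carries the absence of zero divisors to the homogeneous series. *)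
Definition ms_of_poly (p : {mpoly k[n]}) : Q := MSeries (fun m => p@_m).

Lemma ms_of_polyD : {morph ms_of_poly : p q / p + q}.
Proof. by move=> p q; apply: mseriesP => m /=; rewrite mcoeffD. Qed.
Lemma ms_of_polyM : {morph ms_of_poly : p q / p * q}.
Proof. by move=> p q; apply: mseriesP => m /=; rewrite mcoeffM. Qed.
Lemma ms_of_polyZ c p : ms_of_poly (c *: p) = c *: ms_of_poly p.
Proof. by apply: mseriesP => m /=; rewrite mcoeffZ. Qed.
Lemma ms_of_poly0 : ms_of_poly 0 = 0.
Proof. by apply: mseriesP => m /=; rewrite mcoeff0. Qed.
Lemma ms_of_polyX i : ms_of_poly 'X_i = ms_var i.
Proof. by apply: mseriesP => m /=; rewrite mcoeffX eq_sym. Qed.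
Lemma ms_of_poly_inj : injective ms_of_poly.
Proof.
by move=> p q epq; apply/mpolyP => m; have := congr1 (fun f => mscoef f m) epq.
Qed.

Lemma homog_ms_of_poly d f : ms_homog d f -> f = ms_of_poly (ms_trunc d f).
Proof.
move=> hf; apply: mseriesP => m /=; have [le_md|lt_dm] := leqP (mdeg m) d.
  by rewrite ms_truncE.
rewrite hf ?neq_ltn ?lt_dm ?orbT // /ms_trunc raddf_sum /= big1 // => i _.
rewrite mcoeffZ mcoeffX; case: eqP => [eim|]; last by rewrite mulr0.
by move: lt_dm; rewrite -eim ltnNge -ltnS bmdeg.
Qed.

Lemma homog_mul_eq0 d e f g : ms_homog d f -> ms_homog e g -> f * g = 0 ->
  f = 0 \/ g = 0.
Proof.
move=> /homog_ms_of_poly -> /homog_ms_of_poly ->; rewrite -ms_of_polyM -ms_of_poly0.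
move/ms_of_poly_inj/eqP; rewrite mulf_eq0 => /orP[] /eqP ->; by [left|right].
Qed.

End HomogeneousComponents.

(** * Dimensions of spaces of series *)

Section DimHomog.
Context {k : fieldType}.

Lemma dimq_homog d :
  dimq (@ms_homog 3 k d) [set 0] 'C(d + 2, 2).
Proof.
pose b := [seq s2m t | t : d.-tuple 'I_3 <- enum (basis 3 d)].
have sb : size b = 'C(d + 2, 2) by rewrite size_basis -bin_sub ?leq_addr // addKn.
exists (fun f : mseries 3 k => \row_(i < 'C(d + 2, 2)) f (nth 0%MM b i)); split.
- by move=> c f g _ _; apply/rowP => i; rewrite !mxE.
- move=> f hf; split=> [->|f0]; first by apply/rowP => i; rewrite !mxE.
  apply: mseriesP => m; have [md|/hf //] := boolP (mdeg m == d).
  have mb : m \in b by rewrite -basis_cover.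
  have lt : (index m b < 'C(d + 2, 2))%N by rewrite -sb index_mem.
  by have /rowP/(_ (Ordinal lt)) := f0; rewrite !mxE /= nth_index.
- move=> c; exists (MSeries (fun m => if mdeg m == d then
     if insub (index m b) is Some i then c 0 i else 0 else 0)).
    by move=> m /negbTE /= ->.
  apply/rowP => i; rewrite !mxE /=.
  have lt : (i < size b)%N by rewrite sb.
  by rewrite basis_cover mem_nth // index_uniq ?uniq_basis // valK.
Qed.

Lemma dimq_ord_ge d : exists N, dimq (@setT (mseries 3 k)) (ord_ge d) N.
Proof.
pose b : seq 'X_{1..3} := [seq val m | m <- enum {: 'X_{1..3 < d}}].
have memb m : (m \in b) = (mdeg m < d)%N.
  apply/mapP/idP => [[m' _ ->]|lt_m]; first exact: bmdeg.
  by exists (BMultinom lt_m); rewrite ?mem_enum.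
exists (size b), (fun f : mseries 3 k => \row_(i < size b) f (nth 0%MM b i)); split.
- by move=> c f g _ _; apply/rowP => i; rewrite !mxE.
- move=> f _; split=> [f0|f0 m]; first by apply/rowP => i; rewrite !mxE f0 // -memb mem_nth.
  rewrite -memb => mb; have lt : (index m b < size b)%N by rewrite index_mem.
  by have /rowP/(_ (Ordinal lt)) := f0; rewrite !mxE /= nth_index.
- move=> c; exists (MSeries (fun m =>
     if insub (index m b) is Some i then c 0 i else 0)) => //.
  apply/rowP => i; rewrite !mxE /= index_uniq ?valK //.
  by rewrite map_inj_uniq ?enum_uniq //; apply: val_inj.
Qed.

End DimHomog.

(** * The Koszul complex in vector notation *)

Definition j0 : 'I_3 := @Ordinal 3 0 isT.
Definition j1 : 'I_3 := @Ordinal 3 1 isT.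
Definition j2 : 'I_3 := @Ordinal 3 2 isT.

Lemma forall_ord3 (P : 'I_3 -> Prop) : P j0 -> P j1 -> P j2 -> forall j, P j.
Proof.
move=> P0 P1 P2 [[|[|[|//]]] lt3].
- by rewrite (_ : Ordinal _ = j0) //; apply: val_inj.
- by rewrite (_ : Ordinal _ = j1) //; apply: val_inj.
- by rewrite (_ : Ordinal _ = j2) //; apply: val_inj.
Qed.

Section VectorCalculus.
Context {R : comNzRingType}.
Local Notation vec := (R * R * R)%type.
Implicit Types (a b c : vec) (p q : R).

Definition dot a b : R := a.1.1 * b.1.1 + a.1.2 * b.1.2 + a.2 * b.2.
Definition cross a b : vec :=
  (a.1.2 * b.2 - a.2 * b.1.2, a.2 * b.1.1 - a.1.1 * b.2,
   a.1.1 * b.1.2 - a.1.2 * b.1.1).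
Definition smul p a : vec := (p * a.1.1, p * a.1.2, p * a.2).
Definition vall (P : set R) : set vec := [set a | [/\ P a.1.1, P a.1.2 & P a.2]].

Definition vnth a (j : 'I_3) : R :=
  if j == j0 then a.1.1 else if j == j1 then a.1.2 else a.2.

Lemma vall_vnth (P : set R) a : vall P a <-> forall j, P (vnth a j).
Proof.
split=> [[? ? ?]|Pc]; first exact: forall_ord3.
by split; [exact: (Pc j0)|exact: (Pc j1)|exact: (Pc j2)].
Qed.

Lemma vecP a b : a.1.1 = b.1.1 -> a.1.2 = b.1.2 -> a.2 = b.2 -> a = b.
Proof. by case: a b => [[? ?] ?] [[? ?] ?] /= -> -> ->. Qed.

Lemma dot_cross a b : dot a (cross a b) = 0.
Proof. by rewrite /dot /=; ring. Qed.

Lemma cross_smul a p : cross a (smul p a) = 0.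
Proof. by apply: vecP => /=; ring. Qed.

Lemma dotC a b : dot a b = dot b a. Proof. by rewrite /dot; ring. Qed.

Lemma dot_crossl a b c : dot (cross a b) c = - dot b (cross a c).
Proof. by rewrite /dot /=; ring. Qed.

Lemma dotDl a b c : dot (a + b) c = dot a c + dot b c.
Proof. by rewrite /dot /=; ring. Qed.
Lemma dotDr a b c : dot c (a + b) = dot c a + dot c b.
Proof. by rewrite /dot /=; ring. Qed.
Lemma dotBr a b c : dot c (a - b) = dot c a - dot c b.
Proof. by rewrite /dot /=; ring. Qed.
Lemma dot_smulr a b p : dot a (smul p b) = p * dot a b.
Proof. by rewrite /dot /=; ring. Qed.
Lemma crossDr a b c : cross c (a + b) = cross c a + cross c b.
Proof. by apply: vecP => /=; ring. Qed.
Lemma crossBr a b c : cross c (a - b) = cross c a - cross c b.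
Proof. by apply: vecP => /=; ring. Qed.

Lemma dot_vnth a b : dot a b = \sum_j vnth a j * vnth b j.
Proof. by rewrite big_ord_recl big_ord_recl big_ord1 /dot -addrA. Qed.

End VectorCalculus.

Section ScalarVectors.
Context {k : fieldType} {R : comAlgType k}.
Local Notation vec := (R * R * R)%type.
Implicit Types (u e : vec) (a : k).

Lemma vnth_lin a u e j : vnth (a *: u + e) j = a *: vnth u j + vnth e j.
Proof. by rewrite /vnth; case: ifP => // _; case: ifP. Qed.

Lemma dotZr a u e : dot u (a *: e) = a *: dot u e.
Proof. by rewrite /dot !scalerDr !scalerAr. Qed.

Lemma dotZl a u e : dot (a *: u) e = a *: dot u e.
Proof. by rewrite dotC dotZr dotC. Qed.

Lemma crossZr a u e : cross u (a *: e) = a *: cross u e.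
Proof. by apply: vecP; rewrite /= scalerBr !scalerAr. Qed.

Lemma dot_comb n (c : 'I_n -> k) (e : 'I_n -> vec) u :
  dot u (\sum_i c i *: e i) = \sum_i c i *: dot u (e i).
Proof.
elim/big_rec2: _ => [|i y x _ <-]; first by rewrite /dot /= !mulr0 !addr0.
by rewrite dotDr dotZr.
Qed.

End ScalarVectors.

Lemma subspace_vall (k : fieldType) (R : comAlgType k) (P : set R) :
  subspace P -> subspace (vall P).
Proof.
move=> [P0 PL]; split; first by split.
by move=> c a b [? ? ?] [? ? ?]; split; apply: PL.
Qed.

Lemma dimq_vall (k : fieldType) (R : comAlgType k) (P P' : set R) n :
  dimq P P' n -> dimq (vall P) (vall P') (3 * n).
Proof.
move=> dP; have := dimq_prod (dimq_prod dP dP) dP.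
have -> : (n + n + n = 3 * n)%N by lia.
have vallE (S : set R) :
    [set u : R * R * R | [set u : R * R | S u.1 /\ S u.2] u.1 /\ S u.2] = vall S.
  by apply/seteqP; split=> [u [[? ?] ?]|u [? ? ?]]; split.
by rewrite !vallE.
Qed.

(** * Exactness of the Koszul complex of Q *)

Section KoszulExact.
Context {k : fieldType}.
Local Notation Q := (mseries 3 k).
Local Notation vec := (Q * Q * Q)%type.

Definition X : vec := (ms_var j0, ms_var j1, ms_var j2).

Lemma mnmDU (m : 'X_{1..3}) i j : (m + U_(j))%MM i = (m i + (j == i))%N.
Proof. by rewrite mnmDE mnm1E. Qed.

(** The relation x_0 u_1 = x_1 u_0 shows that x_0 divides u_0. The quotient p then fits the other
    two coordinates, because x_0 can be cancelled. *)
Lemma koszul_exact2 (U : vec) : cross X U = 0 -> exists p, U = smul p X.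
Proof.
case: U => [[u0 u1] u2] eU.
have e1 : ms_var j2 * u0 = ms_var j0 * u2.
  by apply/eqP; rewrite -subr_eq0; apply/eqP; exact: (congr1 (fun u => u.1.2) eU).
have e2 : ms_var j0 * u1 = ms_var j1 * u0.
  by apply/eqP; rewrite -subr_eq0; apply/eqP; exact: (congr1 snd eU).
have u0E : ms_var j0 * ms_shift j0 u0 = u0.
  apply: ms_shiftK => m m0; rewrite -(mscoefXD j1) -e2.
  by rewrite mscoefX0 // mnmDU m0.
exists (ms_shift j0 u0); apply: vecP; rewrite /= mulrC ?u0E //.
  by apply: (@ms_varI _ _ j0); rewrite /= e2 -{1}u0E; ring.
by apply: (@ms_varI _ _ j0); rewrite /= -e1 -{1}u0E; ring.
Qed.

Lemma koszul_exact1 (a : vec) : dot X a = 0 -> exists w, a = cross X w.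
Proof.
case: a => [[a0 a1] a2]; rewrite /dot /X /= => ea.
(* The terms of a_2 free of x_0 turn out to be divisible by x_1, which is the regularity of x_2
   modulo (x_0, x_1). Hence a_2 = x_0 b + x_1 c, and absorbing x_2 b and x_2 c into a_0 and a_1
   leaves a relation between x_0 and x_1 alone. *)
pose a2' : Q := MSeries (fun m => if m j0 == 0%N then a2 m else 0).
pose b := ms_shift j0 (a2 - a2'); pose c := ms_shift j1 a2'.
have bE : ms_var j0 * b = a2 - a2'.
  by apply: ms_shiftK => m m0; rewrite mscoefD mscoefN /= m0 eqxx subrr.
have cE : ms_var j1 * c = a2'.
  apply: ms_shiftK => m m1 /=; case: eqP => // m0.
  rewrite -(mscoefXD j2) -[RHS](mscoef0 (m + U_(j2))%MM) -ea !mscoefD.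
  by rewrite (@mscoefX0 _ _ _ a0) ?(@mscoefX0 _ _ _ a1) ?mnmDU ?m0 ?m1 // !add0r.
have a2E : a2 = ms_var j0 * b + ms_var j1 * c by rewrite bE cE subrK.
pose A := a0 + ms_var j2 * b; pose B := a1 + ms_var j2 * c.
have AB : ms_var j0 * A = - (ms_var j1 * B).
  by apply/eqP; rewrite -addr_eq0 -ea a2E /A /B; apply/eqP; ring.
have AE : ms_var j1 * ms_shift j1 A = A.
  apply: ms_shiftK => m m1; rewrite -(mscoefXD j0) AB mscoefN.
  by rewrite mscoefX0 ?oppr0 // mnmDU m1.
have BE : B = - (ms_var j0 * ms_shift j1 A).
  apply: (@ms_varI _ _ j1); rewrite /= mulrN mulrCA AE AB opprK //.
exists (- c, b, ms_shift j1 A); apply: vecP => /=.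
- by rewrite AE /A; ring.
- by rewrite -BE /B; ring.
- by rewrite a2E; ring.
Qed.

End KoszulExact.

(** * Cycles over a graded ideal that vanishes up to degree tau *)

Section GradedIdeal.
Context {k : fieldType}.
Local Notation Q := (mseries 3 k).
Local Notation vec := (Q * Q * Q)%type.
Local Notation X := (@X k).
Variables (I : idealr Q) (s : nat).

Definition graded := forall d f, f \in I -> hcomp d f \in I.
Definition cofinite := forall f, ord_ge s.+1 f -> f \in I.
Definition deg_part d : set Q := [set f | ms_homog d f /\ f \in I].

Lemma subspace_ideal : subspace [set f | f \in I].
Proof.
split=> [|c u v /= Iu Iv]; first exact: idealr0.
by rewrite rpredD // -[u]mul1r scalerAl idealMr.
Qed.

Lemma subspace_deg_part d : subspace (deg_part d).
Proof. exact: subspaceI (subspace_homog d) subspace_ideal. Qed.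

Definition vmap (f : Q -> Q) (a : vec) : vec := (f a.1.1, f a.1.2, f a.2).

(** Truncation kept inside the ring of series, where it commutes with multiplication by a variable
    up to a shift of the bound. *)
Definition ms_low d (f : Q) : Q := MSeries (fun m => if (mdeg m < d)%N then f m else 0).

Lemma ms_lowE d f m : ms_low d f m = if (mdeg m < d)%N then f m else 0.
Proof. by []. Qed.

Lemma ms_lowX i d f : ms_low d.+1 (ms_var i * f) = ms_var i * ms_low d f.
Proof.
apply: mseriesP => m; rewrite ms_lowE !mscoefX ms_lowE.
case: eqP => [mi|/eqP mi]; first by case: ifP.
have mE : m = (m - U_(i) + U_(i))%MM.
  by rewrite submK //; apply/mnm_lepP => j; rewrite mnm1E; case: eqP => // <-; rewrite lt0n.
by rewrite {1}mE mdegD mdeg1 addn1 ltnS.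
Qed.

Lemma ms_lowD d f g : ms_low d (f + g) = ms_low d f + ms_low d g.
Proof. by apply: mseriesP => m; rewrite mscoefD !ms_lowE; case: ifP; rewrite ?addr0. Qed.
Lemma ms_lowN d f : ms_low d (- f) = - ms_low d f.
Proof. by apply: mseriesP => m; rewrite mscoefN !ms_lowE; case: ifP; rewrite ?oppr0. Qed.

Lemma ord_geB_low d f : ord_ge d (f - ms_low d f).
Proof. by move=> m lt_md; rewrite mscoefD mscoefN /= lt_md subrr. Qed.

Hypotheses (grI : graded) (finI : cofinite).
Variable tau : nat.
Hypothesis lowI : forall d f, (d <= tau)%N -> deg_part d f -> f = 0.

Lemma ms_low_ideal f : f \in I -> ms_low tau.+1 f = 0.
Proof.
move=> fI; apply: mseriesP => m /=; case: ifP => //; rewrite ltnS => le_m.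
have := lowI le_m (conj (@hcomp_homog _ _ (mdeg m) f) (grI _ fI)).
by move/(congr1 (fun f => mscoef f m)); rewrite /= eqxx.
Qed.

(** The part of [a] in degrees below tau is a cycle over Q itself, because I has no nonzero element
    of degree at most tau; exactness over Q makes it a boundary. *)
Lemma cycle1_ord (a : vec) : dot X a \in I ->
  exists w, vall (ord_ge tau) (a - cross X w).
Proof.
move=> aI; have [|w wE] := @koszul_exact1 _ (vmap (ms_low tau) a).
  by rewrite -(ms_low_ideal aI) /dot /= !ms_lowD !ms_lowX.
by exists w; rewrite -wE; split; apply: ord_geB_low.
Qed.

Lemma cycle2_ord (U : vec) : vall [set f | f \in I] (cross X U) ->
  exists p, vall (ord_ge tau) (U - smul p X).
Proof.
move=> [/= U0 U1 U2]; have [|p pE] := @koszul_exact2 _ (vmap (ms_low tau) U).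
  apply: vecP; rewrite /= -!ms_lowX -ms_lowN -ms_lowD; exact: ms_low_ideal.
by exists p; rewrite -pE; split; apply: ord_geB_low.
Qed.

Lemma hcomp_dotX d a : dot X (vmap (hcomp d) a) = hcomp d.+1 (dot X a).
Proof. by rewrite /dot !raddfD /= !hcompXS. Qed.

Lemma hcomp_crossX d U : cross X (vmap (hcomp d) U) = vmap (hcomp d.+1) (cross X U).
Proof. by apply: vecP; rewrite /= !raddfB /= !hcompXS. Qed.

Hypothesis s_tau : s = tau.*2.

Lemma mul_top f g : ord_ge tau f -> ord_ge tau g ->
  f * g - hcomp tau f * hcomp tau g \in I.
Proof.
move=> hf hg.
have -> : f * g - hcomp tau f * hcomp tau g =
    f * (g - hcomp tau g) + (f - hcomp tau f) * hcomp tau g by ring.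
apply: finI; rewrite s_tau -addnn; apply: (subspaceD (subspace_ord _)).
  by rewrite -addnS; apply: (ord_geM hf); apply: ord_geB_hcomp.
rewrite -addSn; apply: (ord_geM (ord_geB_hcomp hf)).
exact/homog_ord/hcomp_homog.
Qed.

Lemma dot_top (a b : vec) : vall (ord_ge tau) a -> vall (ord_ge tau) b ->
  dot a b - dot (vmap (hcomp tau) a) (vmap (hcomp tau) b) \in I.
Proof.
move=> [a0 a1 a2] [b0 b1 b2].
have addB (p q r p' q' r' : Q) : p - p' \in I -> q - q' \in I -> r - r' \in I ->
    p + q + r - (p' + q' + r') \in I.
  move=> pI qI rI.
  have -> : p + q + r - (p' + q' + r') = (p - p') + (q - q') + (r - r') by ring.
  by apply: rpredD => //; apply: rpredD.
by apply: addB; apply: mul_top.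
Qed.

Lemma cross_top (a b : vec) : vall (ord_ge tau) a -> vall (ord_ge tau) b ->
  vall [set f | f \in I]
    (cross a b - cross (vmap (hcomp tau) a) (vmap (hcomp tau) b)).
Proof.
move=> [a0 a1 a2] [b0 b1 b2].
have subB (p q p' q' : Q) : p - p' \in I -> q - q' \in I -> p - q - (p' - q') \in I.
  move=> pI qI; have -> : p - q - (p' - q') = p - p' - (q - q') by ring.
  exact: rpredB.
by split; apply: subB; apply: mul_top.
Qed.

Definition lin_cycle1 (e : vec) := vall (@ms_homog 3 k tau) e /\ dot X e \in I.
Definition lin_cycle2 (u : vec) :=
  vall (@ms_homog 3 k tau) u /\ vall [set f | f \in I] (cross X u).

Lemma dot_boundary1 w (U : vec) : vall [set f | f \in I] (cross X U) ->
  dot (cross X w) U \in I.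
Proof.
move=> [/= U0 U1 U2]; rewrite dot_crossl rpredN /dot.
by rewrite !rpredD // idealMr.
Qed.

Lemma vmap_homog d (a : vec) : vall (@ms_homog 3 k d) (vmap (hcomp d) a).
Proof. by split; apply: hcomp_homog. Qed.

(* Modulo boundaries, cycles have coefficients of order at least tau; as I contains all series of
   order 2 tau + 1, only the components of degree tau contribute to products. *)
Lemma dot_lin (a U : vec) : dot X a \in I -> vall [set f | f \in I] (cross X U) ->
  exists e u, [/\ lin_cycle1 e, lin_cycle2 u & dot a U - dot e u \in I].
Proof.
move=> aI UI; have [w aw] := cycle1_ord aI; have [p Up] := cycle2_ord UI.
set a' := a - cross X w in aw; set U' := U - smul p X in Up.
have a'I : dot X a' \in I by rewrite dotBr dot_cross subr0.
have U'I : cross X U' = cross X U by rewrite crossBr cross_smul subr0.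
exists (vmap (hcomp tau) a'), (vmap (hcomp tau) U'); split.
- by split; [exact: vmap_homog | rewrite hcomp_dotX; apply: grI].
- split; first exact: vmap_homog.
  by rewrite hcomp_crossX U'I; case: UI => ? ? ?; split; apply: grI.
- have -> : dot a U = dot a' U' + p * dot X a' + dot (cross X w) U.
    by rewrite [dot X a']dotC -dot_smulr -dotDr subrK -dotDl subrK.
  have := dot_top aw Up.
  set D := dot (vmap _ _) _ => DI.
  have -> : dot a' U' + p * dot X a' + dot (cross X w) U - D =
    dot a' U' - D + (p * dot X a' + dot (cross X w) U) by ring.
  by apply: rpredD => //; apply: rpredD; [exact: idealMr | exact: dot_boundary1].
Qed.

Lemma cross_lin (a b : vec) : dot X a \in I -> dot X b \in I ->
  exists e f q, [/\ lin_cycle1 e, lin_cycle1 f &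
    vall [set f | f \in I] (cross a b - smul q X - cross e f)].
Proof.
move=> aI bI; have [w aw] := cycle1_ord aI; have [z bz] := cycle1_ord bI.
set a' := a - cross X w in aw; set b' := b - cross X z in bz.
have a'I : dot X a' \in I by rewrite dotBr dot_cross subr0.
have b'I : dot X b' \in I by rewrite dotBr dot_cross subr0.
(* The multiple of X comes from expanding the triple products (X x w) x b and a' x (X x z). Their
   other terms have the coefficients dot X b and dot X a', which lie in I. *)
exists (vmap (hcomp tau) a'), (vmap (hcomp tau) b'), (dot a' z - dot w b); split.
- by split; [exact: vmap_homog | rewrite hcomp_dotX; apply: grI].
- by split; [exact: vmap_homog | rewrite hcomp_dotX; apply: grI].
- have -> : cross a b = cross a' b' + (smul (dot X b) w - smul (dot X a') z)
      + smul (dot a' z - dot w b) X.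
    by apply: vecP; rewrite /a' /b' /dot /=; ring.
  rewrite addrK addrAC; apply: (subspaceD (subspace_vall subspace_ideal)).
    exact: cross_top.
  by split; rewrite /= rpredB // mulrC idealMr.
Qed.

End GradedIdeal.

(** * Linear forms and matrices of small rank *)

Section LinearForms.
Context {k : fieldType}.

Lemma rank_le1_factor m n (A : 'M[k]_(m, n)) : (\rank A <= 1)%N ->
  exists (p : 'cV_m) (g : 'rV_n), A = p *m g.
Proof.
move=> rA; have [->|nzA] := eqVneq A 0.
  by exists 0, 0; rewrite mul0mx.
have [i Ai] : exists i, row i A != 0.
  apply/existsP; apply: contraNT nzA => /existsPn A0; apply/eqP/row_matrixP => i.
  by rewrite row0; apply/eqP; have := A0 i; rewrite negbK.
have /submxP[p ->] : (A <= row i A)%MS; last by exists p, (row i A).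
have [_ <-] := mxrank_leqif_sup (row_sub i A).
by rewrite eqn_leq mxrankS ?row_sub // rank_rV Ai.
Qed.

Lemma rank_factor m n r (A : 'M[k]_(m, n)) : \rank A = r ->
  exists (D : 'M_(m, r)) (B : 'M_(r, n)), [/\ A = D *m B, row_full D & row_free B].
Proof.
by move=> <-; exists (col_base A), (row_base A); rewrite mulmx_base col_base_full row_base_free.
Qed.

(** If a b' = a' b for linear forms with a and b independent, then (a', b') is a multiple of (a, b).
    Evaluation at points suffices even over a finite field: with a section L of D, the points y L +
    z for y = (1,0), (0,1), (1,1) and z in the kernel of D already determine E up to a scalar. *)
Lemma proportional_forms n (D E : 'M[k]_(n, 2)) : row_full D ->
  (forall xi : 'rV_n, (xi *m D) 0 0 * (xi *m E) 0 1 = (xi *m E) 0 0 * (xi *m D) 0 1) ->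
  exists c, E = c *: D.
Proof.
move=> fullD DE; have [L LD] : exists L, L *m D = 1%:M by exists (pinvmx D); rewrite mulVpmx.
pose G := L *m E; have addE (a b : 'rV[k]_2) j : (a + b) 0 j = a 0 j + b 0 j by rewrite mxE.
have key (y : 'rV_2) (z : 'rV_n) : z *m D = 0 ->
    y 0 0 * ((y *m G) 0 1 + (z *m E) 0 1) = ((y *m G) 0 0 + (z *m E) 0 0) * y 0 1.
  move=> zD; have := DE (y *m L + z).
  by rewrite !mulmxDl -!mulmxA LD mulmx1 zD addr0 -/G !addE.
pose y0 : 'rV[k]_2 := delta_mx 0 0; pose y1 : 'rV[k]_2 := delta_mx 0 1.
have G10 (z : 'rV_n) : z *m D = 0 -> (row 1 G) 0 0 + (z *m E) 0 0 = 0.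
  by move=> zD; have := key y1 z zD; rewrite -rowE !mxE /= mul0r mulr1 => <-.
have G01 (z : 'rV_n) : z *m D = 0 -> (row 0 G) 0 1 + (z *m E) 0 1 = 0.
  by move=> zD; have := key y0 z zD; rewrite -rowE !mxE /= mulr0 mul1r.
have r10 : (row 1 G) 0 0 = 0 by have := G10 0 (mul0mx _ _); rewrite mul0mx [X in _ + X]mxE addr0.
have r01 : (row 0 G) 0 1 = 0 by have := G01 0 (mul0mx _ _); rewrite mul0mx [X in _ + X]mxE addr0.
have r11 : (row 1 G) 0 1 = (row 0 G) 0 0.
  have := key (y0 + y1) 0 (mul0mx _ _).
  rewrite mul0mx mulmxDl -!rowE !addE r10 r01 !mxE /=.
  by rewrite !(addr0, add0r, mul1r, mulr1).
have zE (z : 'rV_n) : z *m D = 0 -> z *m E = 0.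
  move=> zD; apply/rowP => j; rewrite [RHS]mxE.
  have [-> | ->] : j = 0 \/ j = 1 by case: j => [[|[|]]] //= ?; [left|right]; apply: val_inj.
    by have := G10 z zD; rewrite r10 add0r.
  by have := G01 z zD; rewrite r01 add0r.
have rowG i j : row i G 0 j = G i j by rewrite [LHS]mxE.
rewrite !rowG in r10 r01 r11; exists (G 0 0).
have GE : G = (G 0 0)%:M.
  have ord2 (i : 'I_2) : i = 0 \/ i = 1.
    by case: i => [[|[|]]] //= ?; [left|right]; apply: val_inj.
  apply/matrixP => i j; rewrite [RHS]mxE.
  by have [-> | ->] := ord2 i; have [-> | ->] := ord2 j; rewrite ?r10 ?r01 ?r11.
apply/row_matrixP => i; rewrite !rowE.
have := zE (delta_mx 0 i - delta_mx 0 i *m D *m L).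
rewrite !mulmxBl -!mulmxA LD mulmx1 subrr => /(_ erefl)/eqP.
rewrite subr_eq0 => /eqP ->; rewrite -/G [in LHS]GE.
by rewrite mul_mx_scalar -scalemxAr.
Qed.

(** Passing through polynomials makes evaluation at points of k^n available. *)
Definition lin_form n (p : 'cV[k]_n) : mseries n k :=
  ms_of_poly (\sum_j p j 0 *: 'X_j).

Lemma lin_formE n (p : 'cV[k]_n) : lin_form p = \sum_j p j 0 *: ms_var j.
Proof.
have ms_sum (r : seq 'I_n) : ms_of_poly (\sum_(j <- r) p j 0 *: 'X_j) =
    \sum_(j <- r) p j 0 *: ms_var j.
  elim: r => [|j r IH]; first by rewrite !big_nil ms_of_poly0.
  by rewrite !big_cons ms_of_polyD IH ms_of_polyZ ms_of_polyX.
exact: ms_sum.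
Qed.

Lemma homog_lin_form n (p : 'cV[k]_n) : ms_homog 1 (lin_form p).
Proof.
rewrite lin_formE; apply: (subspace_sum _ (subspace_homog 1)) => j _.
exact/(subspaceZ _ (subspace_homog 1))/homog_var.
Qed.

Lemma lin_form_eq0 n (p : 'cV[k]_n) : lin_form p = 0 -> p = 0.
Proof.
rewrite lin_formE => p0; apply/colP => i; rewrite [RHS]mxE.
have := congr1 (fun f => mscoef f U_(i)%MM) p0.
rewrite mscoef_sum (bigD1 i) //= eqxx mulr1 big1 ?addr0 // => j ne.
case: eqP => [eU|]; last by rewrite mulr0.
have := congr1 (fun m : 'X_{1..n} => m i) eU; rewrite !mnm1E eqxx.
by rewrite (negbTE ne).
Qed.

Lemma meval_lin (n : nat) (xi : 'rV[k]_n) (p : 'cV[k]_n) :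
  (\sum_j p j 0 *: 'X_j).@[xi 0] = (xi *m p) 0 0.
Proof.
rewrite raddf_sum mxE; apply: eq_bigr => j _.
by rewrite /= mevalZ mevalXU mulrC.
Qed.

Lemma lin_form_mul n (D E : 'M[k]_(n, 2)) :
  lin_form (col 0 D) * lin_form (col 1 E) = lin_form (col 0 E) * lin_form (col 1 D) ->
  forall xi : 'rV_n, (xi *m D) 0 0 * (xi *m E) 0 1 = (xi *m E) 0 0 * (xi *m D) 0 1.
Proof.
rewrite /lin_form -!ms_of_polyM => /ms_of_poly_inj eDE xi.
have := congr1 (fun p => p.@[xi 0]) eDE.
rewrite /= !mevalM !meval_lin !colE !mulmxA -!colE.
by rewrite ![col _ _ 0 0]mxE.
Qed.

End LinearForms.

(** * Products of Koszul cycles over a graded ideal *)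

Section Divide.
Context {k : fieldType}.
Local Notation Q := (mseries 3 k).
Local Notation vec := (Q * Q * Q)%type.

(** Each monomial is divided by the first variable that occurs in it. *)
Lemma ord_ge_divide d (f : Q) : ord_ge d.+1 f ->
  exists2 e : vec, vall (ord_ge d) e & dot (@X k) e = f.
Proof.
move=> hf.
pose f0 : Q := MSeries (fun m => if m j0 == 0%N then 0 else f m).
pose f1 : Q := MSeries (fun m =>
  if (m j0 == 0%N) && (m j1 != 0%N) then f m else 0).
pose f2 : Q := MSeries (fun m =>
  if (m j0 == 0%N) && (m j1 == 0%N) then f m else 0).
have fE : f = f0 + f1 + f2.
  apply: mseriesP => m; rewrite !mscoefD /=.
  by case: (m j0 == 0%N); case: (m j1 == 0%N); rewrite /= ?(addr0, add0r).
have f0E : ms_var j0 * ms_shift j0 f0 = f0.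
  by apply: ms_shiftK => m m0 /=; rewrite m0.
have f1E : ms_var j1 * ms_shift j1 f1 = f1.
  by apply: ms_shiftK => m m0 /=; rewrite m0 andbF.
have f2E : ms_var j2 * ms_shift j2 f2 = f2.
  apply: ms_shiftK => m m2 /=; case: ifP => // /andP[/eqP m0 /eqP m1].
  apply: hf; suff -> : m = 0%MM by rewrite mdeg0.
  by apply/mnmP; apply: forall_ord3; rewrite mnm0E.
exists (ms_shift j0 f0, ms_shift j1 f1, ms_shift j2 f2).
  by split=> m lt_md /=; rewrite hf ?if_same // mdegD mdeg1 addn1.
by rewrite /dot /= f0E f1E f2E.
Qed.

Lemma homog_divide d (f : Q) : ms_homog d.+1 f ->
  exists2 e : vec, vall (@ms_homog 3 k d) e & dot (@X k) e = f.
Proof.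
move=> hf; have [e _ eE] := ord_ge_divide (homog_ord hf).
exists (vmap (hcomp d) e); first exact: vmap_homog.
by rewrite hcomp_dotX eE homog_hcomp.
Qed.

End Divide.

Section Products.
Context {k : fieldType}.
Local Notation Q := (mseries 3 k).
Local Notation vec := (Q * Q * Q)%type.
Local Notation X := (@X k).
Variables (I : idealr Q) (s tau : nat).
Hypotheses (grI : graded I) (finI : cofinite I s).
Hypothesis lowI : forall d f, (d <= tau)%N -> deg_part I d f -> f = 0.
Hypothesis s_tau : s = tau.*2.

Local Notation Iset := [set f | f \in I].

Lemma homog_dot (e u : vec) : vall (@ms_homog 3 k tau) e -> vall (@ms_homog 3 k tau) u ->
  ms_homog s (dot e u).
Proof.
move=> [e0 e1 e2] [u0 u1 u2]; rewrite s_tau -addnn.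
by apply: homogD; [apply: homogD|]; apply: homogM.
Qed.

(* p |-> p X is injective from degree s - 1 modulo the socle, hence onto in degree s by
   equality of dimensions. *)
Lemma smul_onto s' r d c : s = s'.+1 ->
  dimq (@ms_homog 3 k s) (deg_part I s) r ->
  dimq (@ms_homog 3 k s') (deg_part I s') d ->
  dimq [set f | ms_homog s' f /\ vall Iset (smul f X)] (deg_part I s') c ->
  d = (c + 3 * r)%N ->
  forall b : vec, vall (@ms_homog 3 k s) b -> exists q, vall Iset (b - smul q X).
Proof.
move=> ss' dr dd dc dE b hb.
have sI := subspace_ideal I; have sdeg := subspace_deg_part I.
have sS : subspace [set f : Q | ms_homog s' f /\ vall Iset (smul f X)].
  have sV : subspace [set f : Q | vall Iset (smul f X)].
    split; first by split; rewrite /= mul0r; case: sI.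
    move=> a f g [f0 f1 f2] [g0 g1 g2].
    by split; rewrite /= mulrDl -scalerAl; case: sI => _; apply.
  exact: subspaceI (subspace_homog s') sV.
have [||r0 [_ dc' dq]] := dimq_sub (subspace_homog s') sS (sdeg s') _ _ dd.
- by move=> f [].
- by move=> f [hf fI]; split => //; split; rewrite /= mulrC idealMr.
rewrite (dimq_uniq sS (sdeg s') dc' dc) dE addKn in dq.
have linf : linear_on (@ms_homog 3 k s') (fun f => smul f X).
  by move=> a f g _ _; apply: vecP; rewrite /= mulrDl -scalerAl.
have homf f : ms_homog s' f -> vall (@ms_homog 3 k s) (smul f X).
  by move=> hf; rewrite ss'; split; rewrite /= mulrC; apply: homogX.
have [] := dimq_inj_surj (subspace_homog s') (subspace_vall (subspace_homog s))
  linf homf dq (dimq_vall dr) erefl _ hb.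
  by move=> f hf [[_ f0] [_ f1] [_ f2]]; split.
by move=> q _ [[_ q0] [_ q1] [_ q2]]; exists q; split.
Qed.

Lemma cross_boundary : 
  (forall b : vec, vall (@ms_homog 3 k s) b -> exists q, vall Iset (b - smul q X)) ->
  forall a b : vec, dot X a \in I -> dot X b \in I ->
  exists q, vall Iset (cross a b - smul q X).
Proof.
move=> onto a b aI bI.
have [e [f [q [[he _] [hf _] efI]]]] := cross_lin grI finI lowI s_tau aI bI.
have [|q' q'I] := onto (cross e f).
  case: he => e0 e1 e2; case: hf => f0 f1 f2; rewrite s_tau -addnn.
  by split; apply: homogB; apply: homogM.
exists (q + q'); have := subspaceD (subspace_vall (subspace_ideal I)) efI q'I.
by congr (vall _ _); apply: vecP; rewrite /=; ring.
Qed.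

Definition products_in_line := exists w : Q, forall a U : vec,
  dot X a \in I -> vall Iset (cross X U) -> exists c : k, dot a U - c *: w \in I.

Lemma line_of_lin (w : Q) :
  (forall e u, lin_cycle1 I tau e -> lin_cycle2 I tau u ->
     exists c : k, dot e u - c *: w \in I) ->
  products_in_line.
Proof.
move=> linew; exists w => a U aI UI.
have [e [u [he hu eu]]] := dot_lin grI finI lowI s_tau aI UI.
have [c cI] := linew e u he hu; exists c.
by rewrite -[dot a U](subrK (dot e u)) -addrA rpredD.
Qed.

Lemma line_socle1 : dimq (@ms_homog 3 k s) (deg_part I s) 1 -> products_in_line.
Proof.
move=> d1; have sI := subspace_deg_part I s.
have [w [hw spanw _]] := dimq_basis (subspace_homog s) sI d1.
apply: (@line_of_lin (w ord0)) => e u [he _] [hu _].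
have [c [_ cI]] := spanw _ (homog_dot he hu); exists (c ord0).
by rewrite big_ord1 in cI.
Qed.

(** A 1-cycle of degree tau has its value under dot X in I_(tau+1) = 0. It is thus a cycle over Q,
    hence a boundary, and boundaries multiply 2-cycles into I. *)
Lemma products_zero : (forall f, deg_part I tau.+1 f -> f = 0) ->
  forall a U : vec, dot X a \in I -> vall Iset (cross X U) -> dot a U \in I.
Proof.
move=> I0 a U aI UI.
have [e [u [[he eI] hu eu]]] := dot_lin grI finI lowI s_tau aI UI.
rewrite -[dot a U](subrK (dot e u)) rpredD //.
have [|w ->] := @koszul_exact1 _ e; last by apply: dot_boundary1; case: hu.
apply: I0; split=> //; case: he => e0 e1 e2.
by apply: homogD; [apply: homogD|]; apply: homogX.
Qed.

End Products.

(** * The pairing of cycles of degree tau when R_s is a plane *)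

Section Socle2.
Context {k : fieldType}.
Local Notation Q := (mseries 3 k).
Local Notation vec := (Q * Q * Q)%type.
Local Notation X := (@X k).
Variables (I : idealr Q) (s tau : nat).
Hypotheses (grI : graded I) (finI : cofinite I s).
Hypothesis lowI : forall d f, (d <= tau)%N -> deg_part I d f -> f = 0.
Hypothesis s_tau : s = tau.*2.

Local Notation Iset := [set f | f \in I].
Local Notation V := (deg_part I tau.+1).

Lemma dotX_vnth (c : vec) : dot X c = \sum_j ms_var j * vnth c j.
Proof.
by rewrite dot_vnth; apply: eq_bigr; apply: forall_ord3.
Qed.

Variable d : nat.
Hypotheses (le_d3 : (d <= 3)%N) (dV : dimq V [set 0] d).
Hypothesis dS : dimq (@ms_homog 3 k s) (deg_part I s) 2.

Lemma lin_cycle2_lin (a : k) (u u' : vec) : lin_cycle2 I tau u -> lin_cycle2 I tau u' ->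
  lin_cycle2 I tau (a *: u + u').
Proof.
move=> [hu uI] [hu' uI']; split.
  exact: (subspace_vall (subspace_homog tau)).2.
have := (subspace_vall (subspace_ideal I)).2 a _ _ uI uI'.
by rewrite crossDr crossZr.
Qed.

Section Coordinates.
Variables (psi : Q -> 'rV[k]_d) (phi : Q -> 'rV[k]_2) (v : 'I_d -> Q) (e : 'I_d -> vec).
Hypotheses (lpsi : linear_on V psi) (psi0 : forall f, V f -> (f = 0 <-> psi f = 0)).
Hypothesis vP : forall i, V (v i) /\ psi (v i) = delta_mx 0 i.
Hypothesis eP : forall i, vall (@ms_homog 3 k tau) (e i) /\ dot X (e i) = v i.
Hypotheses (lphi : linear_on (@ms_homog 3 k s) phi)
  (phi0 : forall f, ms_homog s f -> (deg_part I s f <-> phi f = 0)).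

Let sV := subspace_deg_part I tau.+1.
Let sS := subspace_homog (n := 3) (k := k) s.

(** The product of u with a 1-cycle f depends, modulo I, only on dot X f in I_(tau+1) ([phi_dot]),
    so it is recorded on lifts e_i of a basis of that space. *)
Definition pairing_mx u : 'M[k]_(d, 2) := \matrix_i phi (dot u (e i)).
Definition syzygy_mx u : 'M[k]_(3, d) := \matrix_j psi (vnth (cross X u) j).

Lemma psiK f : V f -> f = \sum_i psi f 0 i *: v i.
Proof.
move=> Vf; have Vs : V (\sum_i psi f 0 i *: v i).
  by apply: subspace_sum => // i _; apply: subspaceZ => //; case: (vP i).
apply/eqP; rewrite -subr_eq0; apply/eqP/psi0; first exact: subspaceB.
by rewrite (linear_onB sV lpsi) // (lift_comb _ sV lpsi vP) subrr.
Qed.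

(** Two 1-cycles with the same value under dot X differ by a boundary cross X w, whose product with
    the 2-cycle u lies in I. *)
Lemma phi_dot (f u : vec) : lin_cycle1 I tau f -> lin_cycle2 I tau u ->
  phi (dot u f) = psi (dot X f) *m pairing_mx u.
Proof.
move=> [hf fI] [hu uI]; pose g := \sum_i psi (dot X f) 0 i *: e i.
have sT := subspace_vall (subspace_homog (n := 3) (k := k) tau).
have hg : vall (@ms_homog 3 k tau) g.
  by apply: subspace_sum => // i _; apply: subspaceZ => //; case: (eP i).
have VXf : V (dot X f).
  split=> //; case: hf => f0 f1 f2.
  by apply: homogD; [apply: homogD|]; apply: homogX.
have Xg : dot X (f - g) = 0.
  rewrite dotBr dot_comb {1}(psiK VXf) -sumrB big1 // => i _.
  by case: (eP i) => _ ->; rewrite subrr.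
have [w wE] := koszul_exact1 Xg.
transitivity (phi (dot u g)).
  apply/eqP; rewrite -subr_eq0 -(linear_onB sS lphi); try exact: (homog_dot s_tau).
  apply/eqP/phi0; first by apply: homogB; apply: (homog_dot s_tau).
  split; first by apply: homogB; apply: (homog_dot s_tau).
  by rewrite -dotBr wE dotC dot_boundary1.
rewrite dot_comb (linear_on_comb sS lphi); last first.
  by move=> i; apply: (homog_dot s_tau) => //; case: (eP i).
by rewrite mulmx_sum_row; apply: eq_bigr => i _; rewrite rowK.
Qed.

Lemma syzygy_ideal u j : lin_cycle2 I tau u -> V (vnth (cross X u) j).
Proof.
move=> [[u0 u1 u2] uI]; split; last exact: ((vall_vnth _ _).1 uI j).
by move: j; apply: forall_ord3; rewrite /vnth /=; apply: homogB; apply: homogX.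
Qed.

(* The j-th component of cross X u is dot X (cross u (basis vector j)), and cross u _ is
   orthogonal to u. *)
Lemma syzygy_pairing u : lin_cycle2 I tau u -> syzygy_mx u *m pairing_mx u = 0.
Proof.
move=> hu; have h0 : ms_homog tau (0 : Q) by [].
apply/row_matrixP => j; rewrite row_mul rowK row0.
have [f [hf Xf uf]] : exists f, [/\ vall (@ms_homog 3 k tau) f,
    dot X f = vnth (cross X u) j & dot u f = 0].
  case: hu => [[u0 u1 u2] _]; move: j; apply: forall_ord3; rewrite /vnth /=.
  - exists (0, u.2, - u.1.2); split; [split=> //; exact: homogN | |]; rewrite /dot /=; ring.
  - exists (- u.2, 0, u.1.1); split; [split=> //; exact: homogN | |]; rewrite /dot /=; ring.
  - exists (u.1.2, - u.1.1, 0); split; [split=> //; exact: homogN | |]; rewrite /dot /=; ring.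
rewrite -Xf -phi_dot // ?uf ?(linear_on0 sS lphi) //.
by split=> //; rewrite Xf; case: (syzygy_ideal j hu).
Qed.

Lemma pairing_mx_lin (a : k) u u' : lin_cycle2 I tau u -> lin_cycle2 I tau u' ->
  pairing_mx (a *: u + u') = a *: pairing_mx u + pairing_mx u'.
Proof.
move=> [hu _] [hu' _]; apply/row_matrixP => i; rewrite linearP /= !rowK.
have [he _] := eP i.
rewrite -lphi; try exact: (homog_dot s_tau).
by rewrite dotDl dotZl.
Qed.

Lemma syzygy_mx_lin (a : k) u u' : lin_cycle2 I tau u -> lin_cycle2 I tau u' ->
  syzygy_mx (a *: u + u') = a *: syzygy_mx u + syzygy_mx u'.
Proof.
move=> hu hu'; apply/row_matrixP => j; rewrite linearP /= !rowK.
rewrite -lpsi; try exact: syzygy_ideal; congr psi.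
by rewrite -vnth_lin crossDr crossZr.
Qed.

(** This is the identity dot X (cross X u) = 0 regrouped along the factorisation: columns of D
    become linear forms, rows of B become elements of I_(tau+1). *)
Lemma syzygy_relation u r (D : 'M_(3, r)) (B : 'M_(r, d)) : lin_cycle2 I tau u ->
  syzygy_mx u = D *m B ->
  \sum_l lin_form (col l D) * (\sum_i B l i *: v i) = 0.
Proof.
move=> hu uDB; transitivity (dot X (cross X u)); last exact: dot_cross.
rewrite dotX_vnth.
under eq_bigr do rewrite lin_formE mulr_suml.
rewrite exchange_big /=; apply: eq_bigr => j _.
rewrite (psiK (syzygy_ideal j hu)) mulr_sumr.
under eq_bigr do rewrite mulr_sumr.
rewrite exchange_big /=; apply: eq_bigr => i _.
have -> : psi (vnth (cross X u) j) 0 i = \sum_l D j l * B l i.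
  by have := congr1 (fun A : 'M_(3, d) => A j i) uDB; rewrite !mxE.
rewrite scaler_suml mulr_sumr; apply: eq_bigr => l _.
by rewrite mxE -scalerAl -!scalerAr scalerA.
Qed.

Lemma comb_homog (c : 'I_d -> k) : ms_homog tau.+1 (\sum_i c i *: v i).
Proof.
apply: (subspace_sum _ (subspace_homog tau.+1)) => i _.
by apply: (subspaceZ _ (subspace_homog tau.+1)); case: (vP i) => -[].
Qed.

Lemma comb_eq0 (c : 'rV_d) : \sum_i c 0 i *: v i = 0 -> c = 0.
Proof. by move=> c0; rewrite -(lift_comb c sV lpsi vP) c0 (linear_on0 sV lpsi). Qed.

(** In rank at most one the syzygy is a product of a linear form and an element of I_(tau+1) that
    vanishes, so one factor is zero and cross X u = 0. Then u = q X is a boundary, and u . e_i = q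
    v_i lies in I. *)
Lemma syzygy_rank u : lin_cycle2 I tau u -> (\rank (syzygy_mx u) <= 1)%N ->
  pairing_mx u = 0.
Proof.
move=> hu /rank_le1_factor[p [g uE]].
have u0 : syzygy_mx u = 0.
  have := syzygy_relation hu uE; rewrite big_ord1.
  case/(homog_mul_eq0 (homog_lin_form _) (comb_homog _)) => [/lin_form_eq0 p0|/comb_eq0 g0].
    rewrite uE (_ : p = 0) ?mul0mx //; apply/matrixP => i j; rewrite ord1.
    by have /colP/(_ i) := p0; rewrite !mxE.
  by rewrite uE g0 mulmx0.
have /koszul_exact2[q uq] : cross X u = 0.
  have vn j : vnth (cross X u) j = 0.
    apply/psi0; first exact: syzygy_ideal.
    by rewrite -[LHS](rowK (fun j => psi (vnth (cross X u) j))) -/(syzygy_mx u) u0 row0.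
  by apply: vecP; [exact: (vn j0)|exact: (vn j1)|exact: (vn j2)].
apply/row_matrixP => i; rewrite rowK row0; have [he Xe] := eP i.
have hh : ms_homog s (dot u (e i)) by apply: (homog_dot s_tau) => //; case: hu.
apply/phi0 => //; split=> //.
by rewrite uq dotC dot_smulr dotC Xe idealMr //; case: (vP i) => -[].
Qed.

(** The syzygy matrix has rank at least 2 and the pairing matrix at least 1. Their product is zero,
    so the ranks add up to at most d <= 3, and equality holds throughout. *)
Lemma pairing_rank u : lin_cycle2 I tau u -> pairing_mx u != 0 ->
  [/\ \rank (syzygy_mx u) = 2, (\rank (pairing_mx u) <= 1)%N & d = 3].
Proof.
move=> hu nz; have := mulmx0_rank_max (syzygy_pairing hu).
have : (1 < \rank (syzygy_mx u))%N.
  by rewrite ltnNge; apply: contra_neqN nz; apply: syzygy_rank.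
have : (0 < \rank (pairing_mx u))%N by rewrite lt0n mxrank_eq0.
by move: le_d3 => ? ? ? ?; split; lia.
Qed.

(* C = D B and C' = D' B for a common 2 x d matrix B, i.e. both syzygies involve the same two
   forms f, g: from a f + b g = 0 = a' f + b' g one gets a b' = a' b for linear forms. *)
Lemma syzygy_proportional u u' (z : 'cV[k]_d) :
  lin_cycle2 I tau u -> lin_cycle2 I tau u' ->
  \rank (syzygy_mx u) = 2 -> (d <= 3)%N -> z != 0 ->
  syzygy_mx u *m z = 0 -> syzygy_mx u' *m z = 0 ->
  exists c, syzygy_mx u' = c *: syzygy_mx u.
Proof.
move=> hu hu' ru le_d nz uz u'z.
have /submxP[E0 u'E0] : (syzygy_mx u' <= syzygy_mx u)%MS.
  have su : (syzygy_mx u <= kermx z)%MS by apply/sub_kermxP.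
  have /submx_trans : (syzygy_mx u' <= kermx z)%MS by apply/sub_kermxP.
  apply.
  have [_ <-] := mxrank_leqif_sup su.
  have rz : (0 < \rank z)%N by rewrite lt0n mxrank_eq0.
  by rewrite eqn_leq (mxrankS su) mxrank_ker ru; lia.
have [D [B [uE fullD freeB]]] := rank_factor ru.
have u'E : syzygy_mx u' = (E0 *m D) *m B by rewrite u'E0 uE mulmxA.
have := syzygy_relation hu uE; have := syzygy_relation hu' u'E.
rewrite !big_ord_recl !big_ord0 !addr0.
have -> : lift ord0 ord0 = 1 :> 'I_2 by apply: val_inj.
have -> : ord0 = 0 :> 'I_2 by [].
set a' := lin_form _; set b' := lin_form _; set a := lin_form _; set b := lin_form _.
set f := \sum_i _; set g := \sum_i _ => e' e1.
have f0 : f <> 0.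
  move=> f0; have : row 0 B = 0.
    by apply: comb_eq0; rewrite -[RHS]f0; apply: eq_bigr => i _; rewrite mxE.
  rewrite rowE -(mul0mx _ B) => /(row_free_inj freeB)/rowP/(_ 0).
  by rewrite !mxE /= => /eqP; rewrite oner_eq0.
have hd : ms_homog 2 (a * b' - a' * b).
  by apply: homogB; apply: (@homogM _ _ 1 1); apply: homog_lin_form.
have df : (a * b' - a' * b) * f = 0.
  have -> : (a * b' - a' * b) * f = b' * (a * f + b * g) - b * (a' * f + b' * g) by ring.
  by rewrite e1 e' !mulr0 subr0.
have [dl|//] := homog_mul_eq0 hd (comb_homog _) df.
have [|c cE] := @proportional_forms _ _ D (E0 *m D) fullD.
  by apply: lin_form_mul; apply/eqP; rewrite -subr_eq0 -/a -/b -/a' -/b' dl.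
by exists c; rewrite u'E cE uE scalemxAl.
Qed.

(* The syzygy matrix C of u (3 x d, d <= 3) kills its pairing matrix M (d x 2).  If M <> 0 then
   C has rank 2 and M rank 1, say M = p r.  If a second u' gave M' = p' r' with r, r' independent,
   the sum u + u' would force p' to be proportional to p; then C and C' have the same kernel, so
   they are proportional, and so are M and M'. *)
Lemma pairing_line : exists r : 'rV[k]_2,
  forall u, lin_cycle2 I tau u -> (pairing_mx u <= r)%MS.
Proof.
have [[u [hu nz]]|all0] := pselect (exists u, lin_cycle2 I tau u /\ pairing_mx u != 0);
  last first.
  exists 0 => u hu; have [->|nz] := eqVneq (pairing_mx u) 0; first exact: sub0mx.
  by case: all0; exists u.
have [ru rm d3] := pairing_rank hu nz.
have [p [r uE]] := rank_le1_factor rm; exists r => u' hu'.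
have [->|nz'] := eqVneq (pairing_mx u') 0; first exact: sub0mx.
have [ru' rm' _] := pairing_rank hu' nz'.
have [p' [r' u'E]] := rank_le1_factor rm'.
case: (boolP (r' <= r)%MS) => [r'r|nr'r].
  by rewrite u'E (submx_trans (submxMl _ _)).
have nzr : r != 0 by apply: contraNneq nz => r0; rewrite uE r0 mulmx0.
have nzp : p != 0 by apply: contraNneq nz => p0; rewrite uE p0 mul0mx.
have freeR : row_free (col_mx r r').
  apply: inj_row_free => c; rewrite -[c]hsubmxK mul_row_col.
  rewrite [lsubmx c]mx11_scalar [rsubmx c]mx11_scalar !mul_scalar_mx.
  set x := lsubmx c 0 0; set y := rsubmx c 0 0 => xy0.
  have y0 : y = 0.
    apply: contraNeq nr'r => y0; rewrite -[r'](scalerK y0).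
    have -> : y *: r' = - x *: r by apply/eqP; rewrite scaleNr -addr_eq0 addrC xy0.
    by rewrite !scalemx_sub.
  have x0 : x = 0.
    move: xy0; rewrite y0 scale0r addr0 => /eqP.
    by rewrite scaler_eq0 (negbTE nzr) orbF => /eqP.
  by rewrite x0 y0 raddf0 row_mx0.
(* The columns of this right inverse are dual to r and r'; multiplication by them isolates p and p'
   in the rank one equation p r + p' r' = q t. *)
pose R := pinvmx (col_mx r r').
have RE : col_mx r r' *m R = 1%:M by apply: mulmxVp.
have := RE; rewrite -[R]hsubmxK mul_col_row scalar_mx_block.
set y := lsubmx R; set y' := rsubmx R => /eq_block_mx[ry ry' r'y r'y'].
have hs : lin_cycle2 I tau (1 *: u + u') by apply: lin_cycle2_lin.
have [|q [t qt]] := @rank_le1_factor _ _ _ (pairing_mx (1 *: u + u')).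
  have [->|nzs] := eqVneq (pairing_mx (1 *: u + u')) 0; first by rewrite mxrank0.
  by have [] := pairing_rank hs nzs.
rewrite pairing_mx_lin // scale1r uE u'E in qt.
have pE : p = (t *m y) 0 0 *: q.
  have := congr1 (mulmx^~ y) qt; rewrite mulmxDl -!mulmxA ry r'y mulmx1 mulmx0 addr0.
  by rewrite {1}[t *m y]mx11_scalar mul_mx_scalar.
have p'E : p' = (t *m y') 0 0 *: q.
  have := congr1 (mulmx^~ y') qt; rewrite mulmxDl -!mulmxA ry' r'y' mulmx1 mulmx0 add0r.
  by rewrite {1}[t *m y']mx11_scalar mul_mx_scalar.
have nzq : q != 0 by apply: contraNneq nzp => q0; rewrite pE q0 scaler0.
have uq : syzygy_mx u *m q = 0.
  have := congr1 (mulmx^~ y) (syzygy_pairing hu).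
  rewrite uE -!mulmxA ry mulmx1 mul0mx pE -scalemxAr => /eqP.
  rewrite scaler_eq0 => /orP[/eqP c0|/eqP //].
  by move: nzp; rewrite pE c0 scale0r eqxx.
have u'q : syzygy_mx u' *m q = 0.
  have := congr1 (mulmx^~ y') (syzygy_pairing hu').
  rewrite u'E -!mulmxA r'y' mulmx1 mul0mx p'E -scalemxAr => /eqP.
  rewrite scaler_eq0 => /orP[/eqP c0|/eqP //].
  by move: nz'; rewrite u'E p'E c0 scale0r mul0mx eqxx.
have [c cE] := syzygy_proportional hu hu' ru le_d3 nzq uq u'q.
have := @syzygy_rank ((- c) *: u + u'); rewrite syzygy_mx_lin // pairing_mx_lin //.
have -> : - c *: syzygy_mx u + syzygy_mx u' = 0 by rewrite cE scaleNr addNr.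
rewrite mxrank0 => /(_ (lin_cycle2_lin _ hu hu') isT)/eqP.
rewrite scaleNr addrC subr_eq0 => /eqP ->.
by rewrite uE scalemx_sub // submxMl.
Qed.

End Coordinates.

Lemma line_socle2 : products_in_line I.
Proof.
have sV := subspace_deg_part I tau.+1; have sS := subspace_homog (n := 3) (k := k) s.
have [psi [lpsi psi0 surjpsi]] := dV; have [v vP] := dimq_lift surjpsi.
have [phi [lphi phi0 surjphi]] := dS.
have /choice[e eP] : forall i, exists e : vec,
    vall (@ms_homog 3 k tau) e /\ dot X e = v i.
  by move=> i; have [[hv _] _] := vP i; have [e he eE] := homog_divide hv; exists e.
have [r rP] := pairing_line lpsi psi0 vP eP lphi phi0.
have [w hw wr] := surjphi r.
apply: (line_of_lin grI finI lowI s_tau (w := w)) => f u hf hu.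
have hfu : ms_homog s (dot f u) by apply: (homog_dot s_tau); [case: hf | case: hu].
have : (phi (dot f u) <= r)%MS.
  rewrite dotC (phi_dot lpsi psi0 vP eP lphi phi0 hf hu).
  exact: submx_trans (submxMl _ _) (rP u hu).
case/sub_rVP => c cE; exists c.
have hcw : ms_homog s (c *: w) by apply: (subspaceZ _ sS).
suff [] : deg_part I s (dot f u - c *: w) by [].
apply/phi0; first exact: homogB.
by rewrite (linear_onB sS lphi) // (linear_onZ sS lphi) // wr cE subrr.
Qed.

End Socle2.

(** * Nonzero products from Gorenstein duality *)

Section Duality.
Context {k : fieldType}.
Local Notation Q := (mseries 3 k).
Local Notation vec := (Q * Q * Q)%type.
Local Notation X := (@X k).
Variables (I J : idealr Q) (s tau : nat).
Hypothesis s_tau : s = tau.*2.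
Hypothesis IJ : forall f, f \in I -> f \in J.
Hypothesis lowJ : forall d f, (d <= tau)%N -> deg_part J d f -> f = 0.
Hypothesis socJ : forall d f, (d < s)%N -> ms_homog d f ->
  (forall j, ms_var j * f \in J) -> f \in J.
Hypothesis dJ : dimq (@ms_homog 3 k s) (deg_part J s) 1.

(** If f multiplies all forms of degree e + 1 into J, then each x_j f does so for degree e and lies
    in J by induction. So f represents a socle element of degree below s, which is zero. *)
Lemma homog_pairing e : forall d (f : Q), (d + e)%N = s -> ms_homog d f ->
  (forall g, ms_homog e g -> f * g \in J) -> f \in J.
Proof.
elim: e => [|e IHe] d f des hf fJ.
  rewrite -[f]mulr1; apply: fJ => m; rewrite /= mdeg_eq0.
  by case: eqP.
apply: (socJ _ hf) => [|j]; first by rewrite -des -addSnnS leq_addr.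
apply: (IHe d.+1) => [||g hg]; [by rewrite addSnnS | exact: homogX |].
by rewrite -mulrA mulrCA fJ //; apply: homogX.
Qed.

(* Composing dot with a functional on Q_s / J_s gives a nondegenerate form on (Q_tau)^3.  If all products
   vanish, the 1-cycles and the 2-cycles of degree tau are orthogonal, so the sum of their dimensions is
   at most that of (Q_tau)^3; rank-nullity bounds it from below. *)
Lemma products_nonzero h1 h2 :
  dimq (@ms_homog 3 k tau.+1) (deg_part I tau.+1) h1 ->
  dimq (@ms_homog 3 k tau.+2) (deg_part I tau.+2) h2 ->
  (4 * h1 < 3 * 'C(tau + 2, 2) + h2)%N ->
  exists a U : vec, [/\ dot X a \in I, vall [set f | f \in I] (cross X U) & dot a U \notin I].
Proof.
move=> d1 d2 lt_h; have [//|no] := pselect (exists a U : vec,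
  [/\ dot X a \in I, vall [set f | f \in I] (cross X U) & dot a U \notin I]).
have prodI (a U : vec) : dot X a \in I -> vall [set f | f \in I] (cross X U) ->
    dot a U \in I.
  by move=> aI UI; apply: contra_notT no => nI; exists a, U.
pose H d : set Q := @ms_homog 3 k d.
have sH d : subspace (H d) := subspace_homog d.
have sD d : subspace (deg_part I d) := subspace_deg_part I d.
have dotXlin d : linear_on (vall (H d)) (dot X) by move=> a u v _ _; rewrite dotDr dotZr.
have crossXlin d : linear_on (vall (H d)) (cross X).
  by move=> a u v _ _; rewrite crossDr crossZr.
have homdotX d u : vall (H d) u -> H d.+1 (dot X u).
  by move=> [u0 u1 u2]; apply: homogD; [apply: homogD|]; apply: homogX.
have homcrossX d u : vall (H d) u -> vall (H d.+1) (cross X u).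
  by move=> [u0 u1 u2]; split; apply: homogB; apply: homogX.
have vall0 : vall [set (0 : Q)] = [set 0].
  apply/seteqP; split=> [[[u0 u1] u2] [/= -> -> ->] //|_ -> //].
have dN : dimq (vall (H tau)) [set 0] (3 * 'C(tau + 2, 2)).
  by have := dimq_vall (@dimq_homog k tau); rewrite vall0.
have dotX0 : dot X 0 = 0 by rewrite /dot /= !mulr0 !addr0.
have crossX0 : cross X 0 = 0 by apply: vecP; rewrite /= !mulr0 subrr.
have sub0 d : [set (0 : vec)] `<=` vall (H d).
  by move=> _ ->; case: (subspace_vall (sH d)).
have [l1 dL1 le1] : exists2 l1, dimq (vall (H tau) `&` (dot X @^-1` deg_part I tau.+1))
    [set 0] l1 & (3 * 'C(tau + 2, 2) <= l1 + h1)%N.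
  apply: (dimq_ker (subspace_vall (sH tau)) (sH tau.+1) (@subspace0 _ _) (sD _)) => //.
  - exact: homdotX.
  - by move=> _ ->; rewrite dotX0; case: (sD tau.+1).
(* Since cross X u is annihilated by dot X, the right target for cross X is the kernel of dot X from
   R_(tau+1)^3 onto R_(tau+2). Its dimension a = 3 h1 - h2 improves on 3 h1, and this is how h2
   enters the bound. *)
have [a da h1E] : exists2 a, dimq (vall (H tau.+1) `&` (dot X @^-1` deg_part I tau.+2))
    (vall (deg_part I tau.+1)) a & (3 * h1 = a + h2)%N.
  apply: (dimq_ker_surj (subspace_vall (sH tau.+1)) (sH tau.+2)
    (subspace_vall (sD tau.+1)) (sD tau.+2)) (dimq_vall d1) d2 => //.
  - exact: homdotX.
  - by move=> u [[? ?] [? ?] [? ?]].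
  - move=> u uD; split.
      by apply: homdotX; case: uD => [[? ?] [? ?] [? ?]].
    by case: uD => [[_ ?] [_ ?] [_ ?]]; rewrite /dot !rpredD // idealMr.
  - move=> f hf; have [e he eE] := homog_divide hf; exists e => //.
    by rewrite eE subrr; case: (sD tau.+2).
have sT := subspace_preim (subspace_vall (sH tau.+1)) (@dotXlin tau.+1) (sD tau.+2).
have [l2 dL2 le2] : exists2 l2, dimq (vall (H tau) `&` (cross X @^-1` vall (deg_part I tau.+1)))
    [set 0] l2 & (3 * 'C(tau + 2, 2) <= l2 + a)%N.
  apply: (dimq_ker (subspace_vall (sH tau)) sT (@subspace0 _ _)
    (subspace_vall (sD tau.+1))) => //.
  - move=> u hu; split; first exact: homcrossX.
    by rewrite /= dot_cross; case: (sD tau.+2).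
  - by move=> _ ->; rewrite crossX0; case: (subspace_vall (sD tau.+1)).
have [phi [lphi phi0 _]] := dJ.
have hdot e u : vall (H tau) e -> vall (H tau) u -> ms_homog s (dot e u).
  by move=> he hu; apply: (homog_dot s_tau).
(* Rank-nullity gives l1 + l2 >= 6 C(tau+2,2) - 4 h1 + h2, which exceeds 3 C(tau+2,2) by
   hypothesis. *)
have : (l1 + l2 <= 3 * 'C(tau + 2, 2))%N; last by move: lt_h le1 le2 h1E; lia.
apply: (dimq_perp (b := fun e u => phi (dot e u) 0 0 : k^o)) dN dL1 dL2.
- exact: subspace_vall.
- exact: (subspace_preim (subspace_vall (sH tau)) (@dotXlin tau) (sD _)).
- exact: (subspace_preim (subspace_vall (sH tau)) (@crossXlin tau) (subspace_vall (sD _))).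
- by move=> u [].
- by move=> u [].
- move=> w hw a' u v hu hv; rewrite dotDl dotZl lphi ?mxE //; exact: hdot.
- move=> w hw a' u v hu hv; rewrite dotDr dotZr lphi ?mxE //; exact: hdot.
- move=> u hu u0.
  have uJ w : vall (H tau) w -> dot u w \in J.
    move=> hw; have [] // : deg_part J s (dot u w).
    by apply/phi0; [exact: hdot | apply/rowP => i; rewrite ord1 u0 // mxE].
  have H0 : H tau 0 by case: (sH tau).
  have tt_s : (tau + tau)%N = s by rewrite addnn s_tau.
  case: u hu u0 uJ => [[u0 u1] u2] [/= h0 h1' h2'] _ uJ.
  apply: vecP; apply: (lowJ (leqnn tau)); split=> //; apply: (homog_pairing tt_s) => // g hg.
  + by have := uJ (g, 0, 0) (And3 hg H0 H0); rewrite /dot /= !mulr0 !addr0.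
  + by have := uJ (0, g, 0) (And3 H0 hg H0); rewrite /dot /= !mulr0 addr0 add0r.
  + by have := uJ (0, 0, g) (And3 H0 H0 hg); rewrite /dot /= !mulr0 !add0r.
- move=> e u [he [_ eI]] [hu uD].
  have eu : deg_part J s (dot e u).
    split; first exact: hdot.
    by apply/IJ/prodI => //; case: uD => [[_ ?] [_ ?] [_ ?]].
  by have /(phi0 _ (hdot _ _ he hu)) -> := eu; rewrite mxE.
Qed.

End Duality.

(** * Invariants of the quotient in terms of homogeneous series *)

Section QuotientInvariants.
Context {k : fieldType}.
Local Notation Q := (mseries 3 k).
Local Notation vec := (Q * Q * Q)%type.
Local Notation X := (@X k).
Variable I : idealr Q.
Local Notation R := {ideal_quot I}.
Local Notation pi := (\pi_{ideal_quot I} : Q -> R).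

Lemma ideal_span_sub (A : comNzRingType) (G K : set A) : is_ideal K -> G `<=` K ->
  ideal_span G `<=` K.
Proof.
move=> [K0 KD KM] GK _ [n [c [g [gG ->]]]].
by elim/big_rec: _ => [//|i x _ Kx]; apply: KD => //; apply/KM/GK.
Qed.

Lemma mem_ideal_span (A : comNzRingType) (G : set A) g : G g -> ideal_span G g.
Proof.
by move=> Gg; exists 1%N, (fun=> 1), (fun=> g); split=> //; rewrite big_ord1 mul1r.
Qed.

Lemma pi_eq f g : pi f = pi g <-> f - g \in I.
Proof. by rewrite Quotient.idealrBE; split=> [->|/eqP]. Qed.

Lemma pi_eq0 f : pi f = 0 <-> f \in I.
Proof. by rewrite -{2}[f]subr0 -pi_eq rmorph0. Qed.

Lemma piZ c f : pi (c *: f) = c *: pi f.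
Proof. by rewrite -[f in LHS]mul1r scalerAl rmorphM. Qed.

Lemma pi_linear_on (V : set Q) : linear_on V pi.
Proof. by move=> c f g _ _; rewrite rmorphD /= piZ. Qed.

Lemma subspace_pi (V : set Q) : subspace V -> subspace [set pi f | f in V].
Proof.
move=> [V0 VL]; split; first by exists 0; rewrite ?rmorph0.
move=> c _ _ [f Vf <-] [g Vg <-]; exists (c *: f + g); first exact: VL.
by rewrite (@pi_linear_on setT).
Qed.

Lemma is_ideal_ord d : is_ideal (@ord_ge 3 k d).
Proof.
split=> [|a b|a b hb]; first by [].
  exact: subspaceD (subspace_ord d).
by rewrite -[d]add0n; apply: ord_geM.
Qed.

Lemma q_idealE : q_ideal = @ord_ge 3 k 1.
Proof.
apply/seteqP; split=> f.
  apply: (ideal_span_sub (is_ideal_ord 1)) => _ [i _ <-].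
  exact/homog_ord/homog_var.
move=> /ord_ge_divide[e _ <-]; exists 3, (vnth e), ms_var.
split=> [i|]; first by exists i.
by rewrite dotX_vnth; apply: eq_bigr => i _; rewrite mulrC.
Qed.

Lemma quot_maxE : quot_max I = [set pi f | f in @ord_ge 3 k 1].
Proof. by rewrite /quot_max q_idealE. Qed.

Lemma idealX_quot i : idealX (quot_max I) i = [set pi f | f in @ord_ge 3 k i].
Proof.
elim: i => [|i IHi] /=.
  apply/seteqP; split=> // x _; exists (repr x); first by [].
  by rewrite reprK.
rewrite {}IHi quot_maxE; apply/seteqP; split.
  apply: ideal_span_sub.
    split; first by exists 0; [case: (subspace_ord (n := 3) (k := k) i.+1) | rewrite rmorph0].
      by move=> a b; apply: (subspaceD (subspace_pi (subspace_ord _))).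
    move=> a _ [f hf <-]; exists (repr a * f); last by rewrite rmorphM /= reprK.
    by case: (is_ideal_ord i.+1) => _ _; apply.
  move=> _ [_ [f hf <-] [_ [g hg <-] <-]]; exists (f * g); last by rewrite rmorphM.
  exact: (@ord_geM _ _ 1 i).
move=> _ [f /ord_ge_divide[e he <-] <-].
exists 3, (fun=> 1), (fun j => pi (ms_var j) * pi (vnth e j)); split=> [j|].
  exists (pi (ms_var j)); first by exists (ms_var j); [exact/homog_ord/homog_var|].
  by exists (pi (vnth e j)) => //; exists (vnth e j) => //; apply: (vall_vnth _ _).1.
by rewrite dotX_vnth rmorph_sum; apply: eq_bigr => j _; rewrite mul1r rmorphM.
Qed.

Lemma homogeneous_graded : homogeneous_ideal I -> graded I.
Proof.
move=> [G [homG IG]] d f /IG [n [c [g [gG ->]]]].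
rewrite raddf_sum rpred_sum // => i _.
have [e ge] := homG _ (gG i).
rewrite /= [c i * g i]mulrC (hcompM _ _ ge); case: ifP => _; last exact: idealr0.
by rewrite mulrC idealMr //; apply/IG/mem_ideal_span.
Qed.

Hypothesis grI : graded I.

Lemma socle_degree_cofinite s : socle_degree (quot_max I) s ->
  cofinite I s /\ exists2 f, ms_homog s f & f \notin I.
Proof.
rewrite /socle_degree !idealX_quot => -[ne0 eq0].
have fin : cofinite I s.
  move=> f hf; apply/pi_eq0; have : [set pi f | f in @ord_ge 3 k s.+1] (pi f) by exists f.
  by rewrite eq0.
split=> //; apply: contra_notP ne0 => no; apply/seteqP; split=> x; last first.
  by move=> ->; exists 0; [case: (subspace_ord (n := 3) (k := k) s) | rewrite rmorph0].
move=> [f hf <-]; apply/pi_eq0; rewrite -[f](subrK (hcomp s f)) rpredD //.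
  exact/fin/ord_geB_hcomp.
by apply: contra_notT no => nI; exists (hcomp s f) => //; apply: hcomp_homog.
Qed.

Lemma homog_mod_ord i f : ms_homog i f ->
  [set pi g | g in @ord_ge 3 k i.+1] (pi f) <-> deg_part I i f.
Proof.
move=> hf; split=> [[g hg /pi_eq gf]|[_ fI]]; last first.
  exists 0; first by case: (subspace_ord (n := 3) (k := k) i.+1).
  by rewrite rmorph0; apply/esym/pi_eq0.
split=> //; have := grI i gf; rewrite raddfB /= (homog_hcomp hf).
suff -> : hcomp i g = 0 by rewrite sub0r rpredN.
by apply: mseriesP => m /=; case: eqP => // md; rewrite hg ?md.
Qed.

Lemma dimq_deg_part i : exists n, dimq (@ms_homog 3 k i) (deg_part I i) n.
Proof.
have [f []||n [_ _ dn]] := dimq_sub (subspace_homog i) (subspace_deg_part I i)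
  (@subspace0 _ _) _ _ (dimq_homog i) => //; last by exists ('C(i + 2, 2) - n)%N.
by move=> _ ->; case: (subspace_deg_part I i).
Qed.

Lemma dimq_deg_ideal i n : dimq (@ms_homog 3 k i) (deg_part I i) n ->
  (n <= 'C(i + 2, 2))%N /\ dimq (deg_part I i) [set 0] ('C(i + 2, 2) - n).
Proof.
move=> dn; have [f []||r [le_r dr dr']] := dimq_sub (subspace_homog i) (subspace_deg_part I i)
  (@subspace0 _ _) _ _ (dimq_homog i) => //.
  by move=> _ ->; case: (subspace_deg_part I i).
rewrite (dimq_uniq (subspace_homog i) (subspace_deg_part I i) dn dr').
by split; [exact: leq_subr | rewrite subKn].
Qed.

Lemma dimq_quot i n : dimq (@ms_homog 3 k i) (deg_part I i) n ->
  dimq [set pi f | f in @ord_ge 3 k i] [set pi f | f in @ord_ge 3 k i.+1] n.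
Proof.
move=> dn; have sW d := subspace_pi (@subspace_ord 3 k d).
apply: (dimq_iso (subspace_homog i) (sW i) (sW i.+1) (@pi_linear_on _) _ _ _ dn).
- by move=> f hf; exists f => //; apply: homog_ord.
- by move=> f hf; apply: homog_mod_ord.
- move=> _ [f hf <-]; exists (hcomp i f); first exact: hcomp_homog.
  by exists (f - hcomp i f); [exact: ord_geB_hcomp | rewrite rmorphB].
Qed.

Lemma hilbert_dimq i :
  dimq (@ms_homog 3 k i) (deg_part I i) (hilbert (quot_max I) i).
Proof.
have [n dn] := dimq_deg_part i.
suff -> : hilbert (quot_max I) i = n by [].
rewrite /hilbert !idealX_quot; have sW d := subspace_pi (@subspace_ord 3 k d).
by apply: rank_dimq; [exact: sW | exact: sW | exact: dimq_quot].
Qed.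

(** The degree i part of the colon ideal (I : q); it suffices to test the three variables, which
    generate q. *)
Definition soc_part i : set Q :=
  [set f | ms_homog i f /\ vall [set g | g \in I] (smul f X)].

Lemma socle_quot f : socle (quot_max I) (pi f) <-> vall [set g | g \in I] (smul f X).
Proof.
rewrite quot_maxE; split=> [fs|fI].
  have fX j : f * ms_var j \in I.
    apply/pi_eq0; rewrite rmorphM; apply: fs; exists (ms_var j) => //.
    exact/homog_ord/homog_var.
  by split; apply: fX.
move=> _ [g /ord_ge_divide[e _ <-] <-]; rewrite -rmorphM; apply/pi_eq0.
rewrite dotX_vnth mulr_sumr rpred_sum // => j _; rewrite mulrA mulrC idealMr //.
by case: fI => f0 f1 f2; move: j; apply: forall_ord3.
Qed.

Lemma subspace_soc : subspace [set f : Q | vall [set g | g \in I] (smul f X)].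
Proof.
have sI := subspace_ideal I; split; first by split; rewrite /= mul0r idealr0.
move=> a f g [f0 f1 f2] [g0 g1 g2].
by split; rewrite /= mulrDl -scalerAl; apply: sI.2.
Qed.

Lemma subspace_socle : subspace (socle (quot_max I)).
Proof.
split=> [b _|a x y hx hy b mb]; first by rewrite mul0r.
by rewrite mulrDl -scalerAl hx // hy // scaler0 addr0.
Qed.

(** As I is graded, the degree i component of a socle element is again in the socle. The i-th layer
    of the socle filtration is therefore the degree i part of the socle. *)
Lemma soc_rank i n :
  rank (idealX (quot_max I) i `&` socle (quot_max I))
    (idealX (quot_max I) i.+1 `&` socle (quot_max I)) = n ->
  dimq (soc_part i) (deg_part I i) n.
Proof.
have sS : subspace (soc_part i) := subspaceI (subspace_homog i) subspace_soc.
have DS : deg_part I i `<=` soc_part i.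
  by move=> f [hf fI]; split=> //; split; rewrite /= mulrC idealMr.
have [d dd] := dimq_deg_part i.
have [|n' [_ dn' _]] := dimq_sub (subspace_homog i) sS (subspace_deg_part I i) _ DS dd.
  by move=> f [].
move=> <-; suff -> : rank (idealX (quot_max I) i `&` socle (quot_max I))
  (idealX (quot_max I) i.+1 `&` socle (quot_max I)) = n' by [].
rewrite !idealX_quot.
have sW d' := subspaceI (subspace_pi (@subspace_ord 3 k d')) subspace_socle.
apply: rank_dimq; [exact: sW | exact: sW |].
apply: (dimq_iso sS (sW i) (sW i.+1) (@pi_linear_on _) _ _ _ dn').
- move=> f [hf fI]; split; last exact/socle_quot.
  by exists f => //; apply: homog_ord.
- move=> f [hf fI]; rewrite -(homog_mod_ord hf); split=> [[]//|fo].
  by split=> //; apply/socle_quot.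
- move=> _ [[f hf <-] /socle_quot fI]; exists (hcomp i f).
    split; first exact: hcomp_homog.
    case: fI => f0 f1 f2.
    by split; rewrite /= mulrC -hcompXS grI // mulrC.
  have hI : vall [set g | g \in I] (smul (hcomp i f) X).
    case: fI => f0 f1 f2.
    by split; rewrite /= mulrC -hcompXS grI // mulrC.
  rewrite -rmorphB; split; last by apply/socle_quot; apply: (subspaceB subspace_soc).
  by exists (f - hcomp i f) => //; apply: ord_geB_hcomp.
Qed.

End QuotientInvariants.

(** * The classes H(0,0) and G(r) *)

Section KoszulCoordinates.
Context {k : fieldType} {R : comAlgType k} (t : 'I_3 -> R).
Local Notation vec := (R * R * R)%type.
Local Notation K := (koszul (n := 3) (R := R)).
Implicit Types (u v w : K) (a : vec).

Definition tvec : vec := (t j0, t j1, t j2).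

(* The signs turn the Koszul differentials and the exterior product into the cross and dot products
   of vector calculus. *)
Definition coord1 u : vec := (u [set j0]%SET, u [set j1]%SET, u [set j2]%SET).
Definition coord2 u : vec := (u (~: [set j0])%SET, - u (~: [set j1])%SET, u (~: [set j2])%SET).
Definition coord3 u : R := u [set: 'I_3]%SET.

Definition of_coord1 a : K := [ffun S : {set 'I_3} => \sum_j (S == [set j])%SET%:R * vnth a j].
Definition of_coord2 a : K :=
  [ffun S : {set 'I_3} => \sum_j (S == ~: [set j])%SET%:R * ((-1) ^+ j * vnth a j)].
Definition of_coord3 (r : R) : K := [ffun S : {set 'I_3} => (S == [set: 'I_3])%SET%:R * r].

Lemma card_ord3_1 (S : {set 'I_3}) : #|S| = 1%N -> exists j, S = [set j]%SET.
Proof. by move/eqP/cards1P. Qed.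

Lemma card_ord3_2 (S : {set 'I_3}) : #|S| = 2 -> exists j, S = (~: [set j])%SET.
Proof.
move=> S2; have /card_ord3_1[j Sj] : #|~: S| = 1%N.
  by have := cardsC S; rewrite S2 card_ord; lia.
by exists j; rewrite -Sj finset.setCK.
Qed.

Lemma card_ord3_3 (S : {set 'I_3}) : #|S| = 3 -> S = [set: 'I_3]%SET.
Proof. by move=> S3; apply/eqP; rewrite eqEcard finset.subsetT cardsT card_ord S3. Qed.

Lemma cardsC1_3 (j : 'I_3) : #|~: [set j]%SET| = 2.
Proof. by have := cardsC [set j]%SET; rewrite cards1 card_ord; lia. Qed.

Lemma coord1_inj u v : koszul_deg 1 u -> koszul_deg 1 v -> coord1 u = coord1 v -> u = v.
Proof.
move=> du dv [e0 e1 e2]; apply/ffunP => S; case: (eqVneq #|S| 1%N) => [|S1]; last by rewrite du ?dv.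
by move/card_ord3_1 => [j ->]; move: j; apply: forall_ord3.
Qed.

Lemma coord2_inj u v : koszul_deg 2 u -> koszul_deg 2 v -> coord2 u = coord2 v -> u = v.
Proof.
move=> du dv [e0 /oppr_inj e1 e2]; apply/ffunP => S.
case: (eqVneq #|S| 2) => [|S1]; last by rewrite du ?dv.
by move/card_ord3_2 => [j ->]; move: j; apply: forall_ord3.
Qed.

Lemma coord3_inj u v : koszul_deg 3 u -> koszul_deg 3 v -> coord3 u = coord3 v -> u = v.
Proof.
move=> du dv e; apply/ffunP => S; case: (eqVneq #|S| 3) => [|S1]; last by rewrite du ?dv.
by move/card_ord3_3 => ->.
Qed.

Lemma deg_of_coord1 a : koszul_deg 1 (of_coord1 a).
Proof.
move=> S S1; rewrite ffunE big1 // => j _; case: eqP => [SE|_]; last by rewrite mul0r.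
by move: S1; rewrite SE cards1.
Qed.

Lemma deg_of_coord2 a : koszul_deg 2 (of_coord2 a).
Proof.
move=> S S1; rewrite ffunE big1 // => j _; case: eqP => [SE|_]; last by rewrite mul0r.
by move: S1; rewrite SE cardsC1_3.
Qed.

Lemma deg_of_coord3 r : koszul_deg 3 (of_coord3 r).
Proof.
move=> S S1; rewrite ffunE; case: eqP => [SE|_]; last by rewrite mul0r.
by move: S1; rewrite SE cardsT card_ord.
Qed.

Lemma of_coord1K a : coord1 (of_coord1 a) = a.
Proof.
have E j : of_coord1 a [set j]%SET = vnth a j.
  rewrite ffunE (bigD1 j) //= eqxx mul1r big1 ?addr0 // => i ij.
  by rewrite (inj_eq finset.set1_inj) eq_sym (negbTE ij) mul0r.
by apply: vecP; rewrite /= E.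
Qed.

Lemma of_coord2K a : coord2 (of_coord2 a) = a.
Proof.
have E j : of_coord2 a (~: [set j])%SET = (-1) ^+ j * vnth a j.
  rewrite ffunE (bigD1 j) //= eqxx mul1r big1 ?addr0 // => i ij.
  by rewrite (inj_eq (can_inj (@finset.setCK _))) (inj_eq finset.set1_inj) eq_sym (negbTE ij) mul0r.
by apply: vecP; rewrite /= E /vnth /=; ring.
Qed.

Lemma of_coord3K r : coord3 (of_coord3 r) = r.
Proof. by rewrite /coord3 ffunE eqxx mul1r. Qed.

Lemma of_coord1_lin c a b : of_coord1 (c *: a + b) = c *: of_coord1 a + of_coord1 b.
Proof.
apply/ffunP => S; rewrite !ffunE scaler_sumr -big_split; apply: eq_bigr => j _.
by rewrite vnth_lin mulrDr scalerAr.
Qed.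

Lemma of_coord2_lin c a b : of_coord2 (c *: a + b) = c *: of_coord2 a + of_coord2 b.
Proof.
apply/ffunP => S; rewrite !ffunE scaler_sumr -big_split; apply: eq_bigr => j _.
by rewrite vnth_lin !mulrDr !scalerAr.
Qed.

Lemma of_coord3_lin (c : k) r r' : of_coord3 (c *: r + r') = c *: of_coord3 r + of_coord3 r'.
Proof. by apply/ffunP => S; rewrite !ffunE mulrDr scalerAr. Qed.

Lemma inversionsE (S T : {set 'I_3}) :
  inversions S T = (\sum_i \sum_j [&& i \in S, j \in T & j < i])%N.
Proof.
rewrite /inversions -sum1_card pair_big /= big_mkcond /=.
by apply: eq_bigr => -[i j] _; rewrite inE /=; case: ifP.
Qed.

Lemma sum_ord3 (V : nmodType) (F : 'I_3 -> V) : \sum_i F i = F j0 + F j1 + F j2.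
Proof.
rewrite !big_ord_recl big_ord0 addr0 addrA.
by congr (F _ + F _ + F _); apply: val_inj.
Qed.

Lemma sumn_ord3 (F : 'I_3 -> nat) : (\sum_i F i = F j0 + F j1 + F j2)%N.
Proof. exact: (@sum_ord3 nat). Qed.

Lemma inversions_set0 (S : {set 'I_3}) : inversions S finset.set0 = 0%N.
Proof. by rewrite inversionsE big1 // => i _; rewrite big1 // => j _; rewrite !inE andbF. Qed.

Lemma inversions11 (i j : 'I_3) : inversions [set i]%SET [set j]%SET = (j < i)%N.
Proof.
by move: i j; apply: forall_ord3; apply: forall_ord3; rewrite inversionsE !sumn_ord3 !inE.
Qed.

Lemma inversions1C (j : 'I_3) : inversions [set j]%SET (~: [set j])%SET = j.
Proof. by move: j; apply: forall_ord3; rewrite inversionsE !sumn_ord3 !inE. Qed.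

Lemma inversionsC1 (j : 'I_3) : inversions (~: [set j])%SET [set j]%SET = (2 - j)%N.
Proof. by move: j; apply: forall_ord3; rewrite inversionsE !sumn_ord3 !inE. Qed.

Lemma koszul_diff1 u : koszul_diff t u finset.set0 = dot tvec (coord1 u).
Proof.
rewrite ffunE big_mkcond sum_ord3 !inE /=.
by rewrite /dot /= !finset.setU0 !inversions_set0 !expr0 !mul1r.
Qed.

Lemma setU2_ord3 : [/\ (j1 |: [set j0])%SET = (~: [set j2])%SET,
  (j2 |: [set j0])%SET = (~: [set j1])%SET, (j0 |: [set j1])%SET = (~: [set j2])%SET,
  (j2 |: [set j1])%SET = (~: [set j0])%SET & (j0 |: [set j2])%SET = (~: [set j1])%SET /\
  (j1 |: [set j2])%SET = (~: [set j0])%SET].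
Proof. by repeat split; apply/setP; apply: forall_ord3; rewrite !inE. Qed.

Lemma koszul_diff2 u : coord1 (koszul_diff t u) = - cross tvec (coord2 u).
Proof.
have [e10 e20 e01 e21 [e02 e12]] := setU2_ord3.
apply: vecP; rewrite /= ffunE big_mkcond sum_ord3 !inE /= !inversions11 /=.
- by rewrite e10 e20; ring.
- by rewrite e01 e21; ring.
- by rewrite e02 e12; ring.
Qed.

Lemma koszul_diff3 u : coord2 (koszul_diff t u) = smul (coord3 u) tvec.
Proof.
have eT (j : 'I_3) : (j |: ~: [set j])%SET = [set: 'I_3]%SET by rewrite finset.setUCr.
by apply: vecP; rewrite /= ffunE big_mkcond sum_ord3 !inE /= inversions1C eT /coord3 /=; ring.
Qed.

Lemma koszul_diff_deg p u : koszul_deg p.+1 u -> koszul_deg p (koszul_diff t u).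
Proof.
move=> du S Sp; rewrite ffunE big1 // => i iS; rewrite du ?mulr0 //.
by rewrite cardsU1 iS add1n eqSS.
Qed.

Lemma wedge_deg p q u v : koszul_deg p u -> koszul_deg q v -> koszul_deg (p + q) (wedge u v).
Proof.
move=> du dv S Sp; rewrite ffunE big1 // => T; rewrite inE => TS.
have [Tp|Tp] := eqVneq #|T| p; last by rewrite du // mulr0 mul0r.
rewrite dv ?mulr0 //; apply: contra Sp => /eqP Sq.
have := cardsID T S; rewrite (finset.setIidPr TS) Tp => <-; rewrite Sq //.
Qed.

Lemma wedge_deg1 u v (S : {set 'I_3}) : koszul_deg 1 u ->
  wedge u v S = \sum_(i in S) (-1) ^+ inversions [set i]%SET (S :\ i)%SET * u [set i]%SET
    * v (S :\ i)%SET.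
Proof.
move=> du; rewrite ffunE (bigID (fun T : {set 'I_3} => #|T| == 1%N)) /= [X in _ + X]big1 ?addr0;
  last by move=> T /andP[_ T1]; rewrite du // mulr0 mul0r.
rewrite (eq_bigl (mem (@finset.set1 'I_3 @: S)%SET)); last first.
  move=> T; rewrite !inE; apply/andP/imsetP => [[TS /cards1P[i Ti]]|[i iS ->]].
    by exists i => //; move: TS; rewrite Ti finset.sub1set.
  by rewrite finset.sub1set cards1.
by rewrite big_imset //= => i j _ _; apply: finset.set1_inj.
Qed.

Lemma setCD1_ord3 : [/\ (~: [set j0] :\ j1)%SET = [set j2]%SET,
  (~: [set j0] :\ j2)%SET = [set j1]%SET, (~: [set j1] :\ j0)%SET = [set j2]%SET,
  (~: [set j1] :\ j2)%SET = [set j0]%SET & (~: [set j2] :\ j0)%SET = [set j1]%SET /\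
  (~: [set j2] :\ j1)%SET = [set j0]%SET].
Proof. by repeat split; apply/setP; apply: forall_ord3; rewrite !inE. Qed.

Lemma wedge11 u v : koszul_deg 1 u -> coord2 (wedge u v) = cross (coord1 u) (coord1 v).
Proof.
move=> du; have [e01 e02 e10 e12 [e20 e21]] := setCD1_ord3.
apply: vecP; rewrite /= wedge_deg1 // big_mkcond sum_ord3 !inE /=.
- by rewrite e01 e02 !inversions11 /=; ring.
- by rewrite e10 e12 !inversions11 /=; ring.
- by rewrite e20 e21 !inversions11 /=; ring.
Qed.

Lemma wedge12 u v : koszul_deg 1 u -> coord3 (wedge u v) = dot (coord1 u) (coord2 v).
Proof.
move=> du; have eT (j : 'I_3) : ([set: 'I_3] :\ j)%SET = (~: [set j])%SET by rewrite finset.setTD.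
rewrite /coord3 wedge_deg1 // big_mkcond sum_ord3 !inE /= !eT !inversions1C /dot /=; ring.
Qed.

(** No sign appears compared with [wedge12], since elements of degree 2 commute with those of degree
    1. *)
Lemma wedge21 u v : koszul_deg 1 v -> coord3 (wedge u v) = dot (coord1 v) (coord2 u).
Proof.
move=> dv; rewrite /coord3 ffunE.
rewrite (bigID (fun T : {set 'I_3} => #|~: T| == 1%N)) /= [X in _ + X]big1 ?addr0; last first.
  by move=> T /andP[_ T1]; rewrite finset.setTD dv // mulr0.
rewrite (eq_bigl (mem ((fun j => ~: [set j]) @: [set: 'I_3])%SET)); last first.
  move=> T; rewrite !inE finset.subsetT /=; apply/cards1P/imsetP => [[i Ti]|[i _ ->]].
    by exists i; [rewrite inE | rewrite -Ti finset.setCK].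
  by exists i; rewrite finset.setCK.
rewrite big_imset /=; last by move=> i j _ _ /(can_inj (@finset.setCK _))/finset.set1_inj.
rewrite big_mkcond sum_ord3 !inE /= !finset.setTD !finset.setCK !inversionsC1 /dot /=; ring.
Qed.

End KoszulCoordinates.

Section BasisChange.
Context {k : fieldType}.

Lemma basis_mod_iso (E E' : lmodType k) (V W : set E) (V' W' : set E') n
    (f : E -> E') (v : 'I_n -> E) :
  subspace V -> subspace W' -> linear_on V f ->
  (forall u, V u -> V' (f u)) -> (forall u, V u -> (W' (f u) <-> W u)) ->
  (forall u', V' u' -> exists2 u, V u & W' (u' - f u)) ->
  basis_mod V W v -> basis_mod V' W' (f \o v).
Proof.
move=> sV sW' lf fV fW surjf [Vv spanv freev].
have Vc (c : 'I_n -> k) : V (\sum_i c i *: v i).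
  by apply: subspace_sum => // i _; apply: subspaceZ.
have fc (c : 'I_n -> k) : \sum_i c i *: f (v i) = f (\sum_i c i *: v i).
  by rewrite (linear_on_comb sV lf).
split=> [i|u' Vu'|c] /=; first exact: fV.
  have [u Vu Wu] := surjf u' Vu'; have [c cP] := spanv u Vu; exists c.
  rewrite fc; have := subspaceD sW' Wu ((fW _ (subspaceB sV Vu (Vc c))).2 cP).
  by rewrite (linear_onB sV lf) // addrA subrK.
by rewrite fc fW //; apply: freev.
Qed.

Lemma basis_mod_unitmx (E : lmodType k) (V W : set E) n (v : 'I_n -> E) (A : 'M[k]_n) :
  subspace V -> A \in unitmx -> basis_mod V W v ->
  basis_mod V W (fun i => \sum_j A i j *: v j).
Proof.
move=> sV uA [Vv spanv freev].
have comb (c : 'I_n -> k) : \sum_i c i *: (\sum_j A i j *: v j) =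
    \sum_j ((\row_i c i) *m A) 0 j *: v j.
  under eq_bigr do rewrite scaler_sumr.
  rewrite exchange_big; apply: eq_bigr => j _; rewrite mxE scaler_suml.
  by apply: eq_bigr => i _; rewrite scalerA mxE.
split=> [i|u Vu|c].
- by apply: subspace_sum => // j _; apply: subspaceZ.
- have [c cP] := spanv u Vu; exists (fun i => ((\row_i c i) *m invmx A) 0 i).
  rewrite comb (_ : \row_i _ = (\row_i c i) *m invmx A); last first.
    by apply/rowP => i; rewrite mxE.
  by rewrite mulmxKV //; congr (W (u - _)): cP; apply: eq_bigr => i _; rewrite mxE.
- rewrite comb => /freev cA0 i.
  have : (\row_i c i) *m A = 0 by apply/rowP => j; rewrite cA0 mxE.
  move/(congr1 (mulmx^~ (invmx A))); rewrite mulmxK // mul0mx => /rowP/(_ i).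
  by rewrite !mxE.
Qed.

End BasisChange.

(** * Koszul cycles and boundaries as vectors *)

Section KoszulHomology.
Context {k : fieldType} {R : comAlgType k} (t : 'I_3 -> R).
Local Notation vec := (R * R * R)%type.
Local Notation K := (koszul (n := 3) (R := R)).
Local Notation T := (tvec t).

Definition vcycles1 : set vec := [set a | dot T a = 0].
Definition vboundaries1 : set vec := [set cross T w | w in setT].
Definition vcycles2 : set vec := [set U | cross T U = 0].
Definition vboundaries2 : set vec := [set smul p T | p in setT].
Definition vcycles3 : set R := [set r | smul r T = 0].

Lemma cycles1P (u : K) : cycles t 1 u <-> koszul_deg 1 u /\ vcycles1 (coord1 u).
Proof.
split=> -[du uZ]; split=> //.
  by rewrite /vcycles1 /= -koszul_diff1 uZ ffunE.
apply/ffunP => S; rewrite [RHS]ffunE; have [S0|S0] := eqVneq #|S| 0%N.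
  by rewrite (cards0_eq S0) koszul_diff1.
exact: koszul_diff_deg S0.
Qed.

Lemma deg0 p : koszul_deg p (0 : K).
Proof. by move=> S _; rewrite ffunE. Qed.

Lemma coordK0 : (coord1 (0 : K) = 0) * (coord2 (0 : K) = 0) * (coord3 (0 : K) = 0).
Proof. by split; [split; apply: vecP|]; rewrite /= ?/coord3 ffunE ?oppr0. Qed.

Lemma cycles2P (u : K) : cycles t 2 u <-> koszul_deg 2 u /\ vcycles2 (coord2 u).
Proof.
split=> -[du uZ]; split=> //.
  apply/eqP; rewrite -oppr_eq0 -koszul_diff2 uZ; apply/eqP; exact: coordK0.1.1.
apply: coord1_inj; [exact: koszul_diff_deg | exact: deg0 |].
by rewrite koszul_diff2 uZ oppr0 coordK0.
Qed.

Lemma cycles3P (u : K) : cycles t 3 u <-> koszul_deg 3 u /\ vcycles3 (coord3 u).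
Proof.
split=> -[du uZ]; split=> //.
  by rewrite /vcycles3 /= -koszul_diff3 uZ coordK0.
apply: coord2_inj; [exact: koszul_diff_deg | exact: deg0 |].
by rewrite koszul_diff3 uZ coordK0.
Qed.

Lemma boundaries1P (u : K) : boundaries t 1 u <-> koszul_deg 1 u /\ vboundaries1 (coord1 u).
Proof.
split=> [[w dw <-]|[du [w _ wE]]].
  split; first exact: koszul_diff_deg.
  exists (- coord2 w) => //; rewrite koszul_diff2.
  by apply: vecP; rewrite /=; ring.
exists (of_coord2 (- w)); first exact: deg_of_coord2.
apply: coord1_inj => //; first exact/koszul_diff_deg/deg_of_coord2.
by rewrite koszul_diff2 of_coord2K -wE; apply: vecP; rewrite /=; ring.
Qed.

Lemma boundaries2P (u : K) : boundaries t 2 u <-> koszul_deg 2 u /\ vboundaries2 (coord2 u).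
Proof.
split=> [[w dw <-]|[du [p _ pE]]].
  split; first exact: koszul_diff_deg.
  by exists (coord3 w) => //; rewrite koszul_diff3.
exists (of_coord3 p); first exact: deg_of_coord3.
apply: coord2_inj => //; first exact/koszul_diff_deg/deg_of_coord3.
by rewrite koszul_diff3 of_coord3K.
Qed.

Lemma deg_gt3 p (u : K) : (3 < p)%N -> koszul_deg p u -> u = 0.
Proof.
move=> p3 du; apply/ffunP => S; rewrite ffunE du // neq_ltn.
by rewrite (leq_ltn_trans _ p3) // (leq_trans (max_card _)) // card_ord.
Qed.

Lemma koszul_diff0 : koszul_diff t 0 = 0.
Proof. by apply/ffunP => S; rewrite !ffunE big1 // => i _; rewrite ffunE mulr0. Qed.

Lemma boundaries3P (u : K) : boundaries t 3 u <-> u = 0.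
Proof.
split=> [[w /deg_gt3 -> // <-]|->]; first exact: koszul_diff0.
by exists 0; [exact: deg0 | exact: koszul_diff0].
Qed.

Lemma boundaries_gt3 p : (3 < p)%N -> boundaries t p 0.
Proof. by move=> p3; exists 0; [exact: deg0 | exact: koszul_diff0]. Qed.

Lemma vcycles1_sub : subspace vcycles1.
Proof.
split; first by rewrite /vcycles1 /= /dot /= !mulr0 !addr0.
by move=> c a b /= ha hb; rewrite /vcycles1 /= dotDr dotZr ha hb scaler0 addr0.
Qed.

Lemma vcycles2_sub : subspace vcycles2.
Proof.
split; first by apply: vecP; rewrite /= !mulr0 subrr.
by move=> c a b /= ha hb; rewrite /vcycles2 /= crossDr crossZr ha hb scaler0 addr0.
Qed.

Lemma smul_lin (c : k) (p q : R) : smul (c *: p + q) T = c *: smul p T + smul q T.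
Proof. by apply: vecP; rewrite /= mulrDl scalerAl. Qed.

Lemma vcycles3_sub : subspace vcycles3.
Proof.
split; first by apply: vecP; rewrite /= mul0r.
by move=> c a b /= ha hb; rewrite /vcycles3 /= smul_lin ha hb scaler0 addr0.
Qed.

Lemma vboundaries1_sub : subspace vboundaries1.
Proof.
split; first by exists 0 => //; apply: vecP; rewrite /= !mulr0 subrr.
by move=> c _ _ [a _ <-] [b _ <-]; exists (c *: a + b) => //; rewrite crossDr crossZr.
Qed.

Lemma vboundaries2_sub : subspace vboundaries2.
Proof.
split; first by exists 0 => //; apply: vecP; rewrite /= !mul0r.
by move=> c _ _ [a _ <-] [b _ <-]; exists (c *: a + b) => //; rewrite smul_lin.
Qed.

Lemma vboundaries1_cycles : vboundaries1 `<=` vcycles1.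
Proof. by move=> _ [w _ <-]; apply: dot_cross. Qed.

Lemma vboundaries2_cycles : vboundaries2 `<=` vcycles2.
Proof. by move=> _ [w _ <-]; apply: cross_smul. Qed.

Lemma dot_boundary1v a U : vboundaries1 a -> vcycles2 U -> dot a U = 0.
Proof.
move=> [w _ <-] UZ; rewrite dot_crossl UZ /dot /= !mulr0 !addr0 oppr0 //.
Qed.

Lemma dot_boundary2v a U : vcycles1 a -> vboundaries2 U -> dot a U = 0.
Proof. by move=> aZ [p _ <-]; rewrite dot_smulr dotC aZ mulr0. Qed.

(** As cross T U = 0 means t_i U_j = t_j U_i, multiplication by t_i gives t_i (a . U) = (t . a) U_i
    = 0. *)
Lemma dot_cycle3 a U : vcycles1 a -> vcycles2 U -> vcycles3 (dot a U).
Proof.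
case: U => [[U0 U1] U2] aZ UZ.
have e0 : t j1 * U2 = t j2 * U1 by apply/eqP; rewrite -subr_eq0; apply/eqP;
  exact: (congr1 (fun u => u.1.1) UZ).
have e1 : t j2 * U0 = t j0 * U2 by apply/eqP; rewrite -subr_eq0; apply/eqP;
  exact: (congr1 (fun u => u.1.2) UZ).
have e2 : t j0 * U1 = t j1 * U0 by apply/eqP; rewrite -subr_eq0; apply/eqP; exact: (congr1 snd UZ).
have {}aZ : t j0 * a.1.1 + t j1 * a.1.2 + t j2 * a.2 = 0 := aZ.
apply: vecP; rewrite /dot /=.
- transitivity ((t j0 * a.1.1 + t j1 * a.1.2 + t j2 * a.2) * U0); last by rewrite aZ mul0r.
  transitivity (a.1.1 * (t j0 * U0) + a.1.2 * (t j0 * U1) + a.2 * (t j0 * U2)); first ring.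
  by rewrite e2 -e1; ring.
- transitivity ((t j0 * a.1.1 + t j1 * a.1.2 + t j2 * a.2) * U1); last by rewrite aZ mul0r.
  transitivity (a.1.1 * (t j1 * U0) + a.1.2 * (t j1 * U1) + a.2 * (t j1 * U2)); first ring.
  by rewrite e0 -e2; ring.
- transitivity ((t j0 * a.1.1 + t j1 * a.1.2 + t j2 * a.2) * U2); last by rewrite aZ mul0r.
  transitivity (a.1.1 * (t j2 * U0) + a.1.2 * (t j2 * U1) + a.2 * (t j2 * U2)); first ring.
  by rewrite e1 -e0; ring.
Qed.

End KoszulHomology.

(** * Classes read off from the products of cycles *)

Section ClassFromProducts.
Context {k : fieldType} {R : comAlgType k} (t : 'I_3 -> R).
Local Notation vec := (R * R * R)%type.
Local Notation K := (koszul (n := 3) (R := R)).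
Local Notation T := (tvec t).

Lemma subspace_setT (E : lmodType k) : subspace (@setT E).
Proof. by []. Qed.

(* The Euler characteristic of the Koszul complex vanishes. *)
Lemma koszul_euler D :
  dimq (@setT R) [set 0] D -> dimq (@setT R) [set dot T a | a in setT] 1 ->
  dimq (vcycles3 t) [set 0] 2 ->
  exists m, dimq (vcycles1 t) (vboundaries1 t) m /\
            dimq (vcycles2 t) (vboundaries2 t) m.+1.
Proof.
move=> dD d1 dsoc.
pose B0 : set R := [set dot T a | a in setT].
have sB0 : subspace B0.
  split; first by exists 0 => //; rewrite /dot /= !mulr0 !addr0.
  by move=> c _ _ [a _ <-] [b _ <-]; exists (c *: a + b) => //; rewrite dotDr dotZr.
have dvec : dimq (@setT vec) [set 0] (3 * D).
  have -> : (@setT vec) = vall setT by apply/seteqP; split.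
  have -> : [set (0 : vec)] = vall [set 0]; last exact: dimq_vall.
  by apply/seteqP; split=> [_ -> //|[[u0 u1] u2] [/= -> -> ->]].
have s0 := @subspace0 k.
have sub0 (E : lmodType k) (V : set E) : subspace V -> [set 0] `<=` V.
  by move=> [V0 _] _ ->.
have ker_im (E E' : lmodType k) (f : E -> E') (Z : set E) (B : set E') n :
    linear_on setT f -> subspace B -> B = [set f u | u in setT] -> Z = f @^-1` [set 0] ->
    dimq (@setT E) [set 0] n -> (exists n', dimq (@setT E') [set 0] n') ->
    exists z b, [/\ dimq Z [set 0] z, dimq B [set 0] b & n = (z + b)%N].
  move=> lf sB BE ZE dn [n' dn'].
  have [b [_ db _]] := dimq_sub (subspace_setT E') sB (s0 _) (@subsetT _ _) (sub0 _ _ sB) dn'.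
  have [||||z dz nE] := dimq_ker_surj (f := f) (subspace_setT E) sB (s0 _) (s0 _) lf _ _ _ _ dn db.
  - by move=> u _; rewrite BE; exists u.
  - by [].
  - by move=> _ ->; rewrite /= (linear_on0 (subspace_setT E) lf).
  - by move=> u'; rewrite BE => -[u _ <-]; exists u; rewrite /= ?subrr.
  by exists z, b; split=> //; rewrite ZE; rewrite setTI in dz.
have lin1 : linear_on setT (dot T) by move=> c a b _ _; rewrite dotDr dotZr.
have lin2 : linear_on setT (cross T) by move=> c a b _ _; rewrite crossDr crossZr.
have lin3 : linear_on setT (fun p => smul p T) by move=> c a b _ _; rewrite smul_lin.
have [z1 [b0 [dz1 db0 e1]]] :=
  ker_im _ _ (dot T) (vcycles1 t) B0 _ lin1 sB0 erefl erefl dvec (ex_intro _ D dD).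
have [z2 [b1 [dz2 db1 e2]]] := ker_im _ _ (cross T) (vcycles2 t) (vboundaries1 t) _ lin2
  (vboundaries1_sub t) erefl erefl dvec (ex_intro _ _ dvec).
have [z3 [b2 [dz3 db2 e3]]] := ker_im _ _ (fun p => smul p T) (vcycles3 t) (vboundaries2 t) _ lin3
  (vboundaries2_sub t) erefl erefl dD (ex_intro _ _ dvec).
have z3E := dimq_uniq (vcycles3_sub t) (s0 _) dz3 dsoc.
have [r0 [le0 dr0 dR0]] := dimq_sub (subspace_setT R) sB0 (s0 _) (@subsetT _ _) (sub0 _ _ sB0) dD.
have r0E := dimq_uniq sB0 (s0 _) dr0 db0.
have D1 := dimq_uniq (subspace_setT R) sB0 dR0 d1.
have [r1 [le1 dr1 dA1]] := dimq_sub (vcycles1_sub t) (vboundaries1_sub t) (s0 _)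
  (@vboundaries1_cycles _ _ t) (sub0 _ _ (vboundaries1_sub t)) dz1.
have r1E := dimq_uniq (vboundaries1_sub t) (s0 _) dr1 db1.
have [r2 [le2 dr2 dA2]] := dimq_sub (vcycles2_sub t) (vboundaries2_sub t) (s0 _)
  (@vboundaries2_cycles _ _ t) (sub0 _ _ (vboundaries2_sub t)) dz2.
have r2E := dimq_uniq (vboundaries2_sub t) (s0 _) dr2 db2.
exists (z1 - r1)%N; split=> //.
(* Here z1 = 2 D + 1, z2 = 3 D - b1 and b2 = D - 2; since r1 = b1 and r2 = b2, the two dimensions
   are 2 D + 1 - b1 and 2 D + 2 - b1. *)
by have -> : (z1 - r1).+1 = (z2 - r2)%N by lia.
Qed.

Lemma boundaries_sub p : subspace (boundaries t p).
Proof.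
split; first by exists 0; [exact: deg0 | exact: koszul_diff0].
move=> c _ _ [u du <-] [v dv <-]; exists (c *: u + v).
  by move=> S Sp; rewrite !ffunE du // dv // scaler0 addr0.
apply/ffunP => S; rewrite !ffunE scaler_sumr -big_split; apply: eq_bigr => i _.
by rewrite !ffunE mulrDr scalerAr.
Qed.

Lemma koszul_basis1 m (e : 'I_m -> vec) : basis_mod (vcycles1 t) (vboundaries1 t) e ->
  basis_mod (cycles t 1) (boundaries t 1) (of_coord1 \o e).
Proof.
apply: basis_mod_iso (vcycles1_sub t) (boundaries_sub _) _ _ _ _.
- by move=> c a b _ _; rewrite of_coord1_lin.
- by move=> a aZ; apply/cycles1P; rewrite of_coord1K; split=> //; apply: deg_of_coord1.
- move=> a aZ; rewrite boundaries1P of_coord1K.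
  by split=> [[]//|aB]; split=> //; apply: deg_of_coord1.
- move=> u /cycles1P[du uZ]; exists (coord1 u) => //.
  rewrite (_ : of_coord1 _ = u) ?subrr; first by case: (boundaries_sub 1).
  by apply: coord1_inj => //; [exact: deg_of_coord1 | rewrite of_coord1K].
Qed.

Lemma koszul_basis2 m (e : 'I_m -> vec) : basis_mod (vcycles2 t) (vboundaries2 t) e ->
  basis_mod (cycles t 2) (boundaries t 2) (of_coord2 \o e).
Proof.
apply: basis_mod_iso (vcycles2_sub t) (boundaries_sub _) _ _ _ _.
- by move=> c a b _ _; rewrite of_coord2_lin.
- by move=> a aZ; apply/cycles2P; rewrite of_coord2K; split=> //; apply: deg_of_coord2.
- move=> a aZ; rewrite boundaries2P of_coord2K.
  by split=> [[]//|aB]; split=> //; apply: deg_of_coord2.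
- move=> u /cycles2P[du uZ]; exists (coord2 u) => //.
  rewrite (_ : of_coord2 _ = u) ?subrr; first by case: (boundaries_sub 2).
  by apply: coord2_inj => //; [exact: deg_of_coord2 | rewrite of_coord2K].
Qed.

Lemma koszul_basis3 m (e : 'I_m -> R) : basis_mod (vcycles3 t) [set 0] e ->
  basis_mod (cycles t 3) (boundaries t 3) (of_coord3 \o e).
Proof.
apply: basis_mod_iso (vcycles3_sub t) (boundaries_sub _) _ _ _ _.
- by move=> c a b _ _; rewrite of_coord3_lin.
- by move=> a aZ; apply/cycles3P; rewrite of_coord3K; split=> //; apply: deg_of_coord3.
- move=> a aZ; rewrite boundaries3P; split=> [a0|->].
    by rewrite -[a]of_coord3K a0 /= coordK0.
  by apply: coord3_inj; [exact: deg_of_coord3 | exact: deg0 | rewrite of_coord3K coordK0].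
- move=> u /cycles3P[du uZ]; exists (coord3 u) => //.
  rewrite (_ : of_coord3 _ = u) ?subrr; first by case: (boundaries_sub 3).
  by apply: coord3_inj => //; [exact: deg_of_coord3 | rewrite of_coord3K].
Qed.

Hypothesis prod11 : forall a b, vcycles1 t a -> vcycles1 t b -> vboundaries2 t (cross a b).

Lemma wedge11_boundary (u v : K) : cycles t 1 u -> cycles t 1 v -> boundaries t 2 (wedge u v).
Proof.
move=> /cycles1P[du uZ] /cycles1P[dv vZ]; apply/boundaries2P; rewrite wedge11 //.
by split; [exact: (@wedge_deg _ _ 1 1) | exact: prod11].
Qed.

Lemma class_H00_products :
  (forall a U, vcycles1 t a -> vcycles2 t U -> dot a U = 0) -> class_H00 t.
Proof.
move=> dot0 p q u v p0 q0 uZ vZ.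
have duv : koszul_deg (p + q) (wedge u v) by apply: wedge_deg; [case: uZ | case: vZ].
have [lt3|] := ltnP 3 (p + q); first by rewrite (deg_gt3 lt3 duv); apply: boundaries_gt3.
case: p p0 uZ duv => [//|[|[|p]]] _ uZ duv; case: q q0 vZ duv => [//|[|[|q]]] _ vZ duv le3;
  try by exfalso; move: le3; lia.
- exact: wedge11_boundary.
- apply/boundaries3P/coord3_inj; [exact: duv | exact: deg0 |].
  case/cycles1P: uZ => du uZ; case/cycles2P: vZ => dv vZ.
  by rewrite wedge12 // dot0 // coordK0.
- apply/boundaries3P/coord3_inj; [exact: duv | exact: deg0 |].
  case/cycles2P: uZ => du uZ; case/cycles1P: vZ => dv vZ.
  by rewrite wedge21 // dot0 // coordK0.
Qed.

(** The coordinate row C of w has rank one, so Gaussian elimination writes it as a scalar times the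
    first row of the invertible matrix [row_ebase C]. The rows of that matrix give the new basis. *)
Lemma basis_with_first n (V : set R) (g : 'I_n.+1 -> R) w : subspace V ->
  basis_mod V [set 0] g -> V w -> w != 0 ->
  exists (c : k) (g' : 'I_n.+1 -> R), [/\ basis_mod V [set 0] g' & w = c *: g' ord0].
Proof.
move=> sV gB Vw nzw; have [Vg spang freeg] := gB.
have [c /= /eqP] := spang w Vw; rewrite subr_eq0 => /eqP wE.
pose C : 'rV[k]_n.+1 := \row_i c i.
exists (col_ebase C 0 0), (fun i => \sum_j row_ebase C i j *: g j); split.
  exact: basis_mod_unitmx (row_ebase_unit C) gB.
have nzC : C != 0.
  apply: contraNneq nzw => C0; rewrite wE big1 // => i _.
  by have /rowP/(_ i) := C0; rewrite !mxE => ->; rewrite scale0r.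
have rC : \rank C = 1%N by rewrite rank_rV nzC.
rewrite wE scaler_sumr; apply: eq_bigr => j _; rewrite scalerA; congr (_ *: _).
have /rowP/(_ j) := mulmx_ebase C; rewrite [RHS]mxE => <-; rewrite rC.
rewrite -mulmxA {1}[col_ebase C]mx11_scalar mul_scalar_mx mxE; congr (_ * _).
rewrite mxE (bigD1 ord0) //= mxE /= mul1r big1 ?addr0 // => i.
by rewrite mxE => /negbTE; rewrite -val_eqE /= eq_sym => ->; rewrite mul0r.
Qed.

Lemma class_G_products D w :
  dimq (@setT R) [set 0] D -> dimq (@setT R) [set dot T a | a in setT] 1 ->
  dimq (vcycles3 t) [set 0] 2 ->
  (forall a U, vcycles1 t a -> vcycles2 t U -> exists c : k, dot a U = c *: w) ->
  (exists a U, [/\ vcycles1 t a, vcycles2 t U & dot a U != 0]) ->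
  exists2 r, (1 <= r)%N & class_G t r.
Proof.
move=> dD d1 dsoc line [a0 [U0 [a0Z U0Z nz0]]].
have [m [dm1 dm2]] := koszul_euler dD d1 dsoc.
have [e eB] := dimq_basis (vcycles1_sub t) (vboundaries1_sub t) dm1.
have [f fB] := dimq_basis (vcycles2_sub t) (vboundaries2_sub t) dm2.
have [g0 g0B] := dimq_basis (vcycles3_sub t) (@subspace0 _ _) dsoc.
(* The first basis vector of A_3 is chosen on the line that contains all products. *)
have [c [g [gB dotE]]] := basis_with_first (vcycles3_sub t) g0B (dot_cycle3 a0Z U0Z) nz0.
have nzg : g ord0 != 0 by apply: contraNneq nz0 => g00; rewrite dotE g00 scaler0.
have {line}line a U : vcycles1 t a -> vcycles2 t U -> exists c : k, dot a U = c *: g ord0.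
  have [d dE] := line a0 U0 a0Z U0Z.
  have nzd : d != 0 by apply: contraNneq nz0 => d0; rewrite dE d0 scale0r.
  move=> aZ UZ; have [d' ->] := line a U aZ UZ; exists (d' * d^-1 * c).
  by rewrite -scalerA -dotE dE scalerA -mulrA mulVf // mulr1.
have [eZ spane _] := eB; have [fZ spanf _] := fB.
have /choice[M0 M0P] : forall i, exists Mi : 'I_m.+1 -> k, forall j,
    dot (e i) (f j) = Mi j *: g ord0.
  move=> i; have /choice[Mi MiP] : forall j, exists d, dot (e i) (f j) = d *: g ord0.
    by move=> j; apply: line.
  by exists Mi.
pose M : 'M[k]_(m, m.+1) := \matrix_(i, j) M0 i j.
have dotc (x : 'I_m -> k) (y : 'I_m.+1 -> k) :
    dot (\sum_i x i *: e i) (\sum_j y j *: f j) =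
    (((\row_i x i) *m M *m (\col_j y j)) 0 0) *: g ord0.
  rewrite dot_comb mxE scaler_suml; apply: eq_bigr => j _.
  rewrite dotC dot_comb scaler_sumr !mxE mulr_suml scaler_suml.
  by apply: eq_bigr => i _; rewrite dotC M0P !scalerA !mxE -mulrA mulrC.
have nzM : M != 0.
  apply: contraNneq nz0 => Mz; have [x xB] := spane a0 a0Z; have [y yB] := spanf U0 U0Z.
  have fyZ : vcycles2 t (\sum_j y j *: f j).
    by apply: subspace_sum (vcycles2_sub t) _ => j _; apply: subspaceZ (vcycles2_sub t) _.
  rewrite -[a0](subrK (\sum_i x i *: e i)) dotDl (dot_boundary1v xB U0Z) add0r.
  have exZ : vcycles1 t (\sum_j x j *: e j).
    by apply: subspace_sum (vcycles1_sub t) _ => j _; apply: subspaceZ (vcycles1_sub t) _.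
  rewrite -[U0](subrK (\sum_j y j *: f j)) dotDr (dot_boundary2v exZ yB) add0r.
  by rewrite dotc Mz mulmx0 mul0mx mxE scale0r.
(* Gaussian elimination writes M as [col_ebase M] times a partial identity times [row_ebase M].
   Changing the two bases by the inverses leaves the partial identity, whose rank becomes r. *)
pose e' i := \sum_j invmx (col_ebase M) i j *: e j.
pose f' i := \sum_j (invmx (row_ebase M))^T i j *: f j.
have e'B : basis_mod (vcycles1 t) (vboundaries1 t) e'.
  by apply: basis_mod_unitmx eB; [exact: vcycles1_sub | rewrite unitmx_inv col_ebase_unit].
have f'B : basis_mod (vcycles2 t) (vboundaries2 t) f'.
  by apply: basis_mod_unitmx fB; [exact: vcycles2_sub | rewrite unitmx_tr unitmx_inv row_ebase_unit].
have rM : (0 < \rank M)%N by rewrite lt0n mxrank_eq0.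
have dot' i j : dot (e' i) (f' j) = ((i == j :> nat) && (i < \rank M)%N)%:R *: g ord0.
  rewrite dotc; congr (_ *: _).
  have -> : \row_l invmx (col_ebase M) i l = row i (invmx (col_ebase M)).
    by apply/rowP => l; rewrite !mxE.
  have -> : \col_l (invmx (row_ebase M))^T j l = col j (invmx (row_ebase M)).
    by apply/colP => l; rewrite !mxE.
  rewrite -row_mul colE mulmxA -row_mul -colE -{2}[M]mulmx_ebase.
  rewrite !mulmxA mulVmx ?col_ebase_unit // mul1mx mulmxK ?row_ebase_unit //.
  by rewrite !mxE.
exists (\rank M) => //; exists m, (of_coord1 \o e'), (of_coord2 \o f'), (of_coord3 \o g).
split.
- by rewrite rM rank_leq_row.
- by split; [exact: koszul_basis1 | exact: koszul_basis2 | exact: koszul_basis3].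
- by move=> i j; apply: wedge11_boundary; have [+ _ _] := koszul_basis1 e'B; apply.
- move=> i j; apply/boundaries3P/eqP; rewrite subr_eq0; apply/eqP.
  apply: coord3_inj.
  + by apply: (@wedge_deg _ _ 1 2); [exact: deg_of_coord1 | exact: deg_of_coord2].
  + by case: ifP => _; [exact: deg_of_coord3 | exact: deg0].
  rewrite wedge12; last exact: deg_of_coord1.
  rewrite of_coord1K of_coord2K dot'; case: ifP => _; first by rewrite scale1r of_coord3K.
  by rewrite scale0r coordK0.
Qed.

End ClassFromProducts.

(** * Socles of graded quotients *)

Section SocleData.
Context {k : fieldType}.
Local Notation Q := (mseries 3 k).
Local Notation vec := (Q * Q * Q)%type.
Local Notation X := (@X k).
Implicit Types I J : idealr Q.

Lemma soc_part_top I s : cofinite I s -> soc_part I s = @ms_homog 3 k s.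
Proof.
move=> fin; apply/seteqP; split=> f; first by case.
move=> hf; split=> //.
have fX j : f * ms_var j \in I by apply: fin; rewrite mulrC; apply/homog_ord/homogX.
by split; apply: fX.
Qed.

Lemma socle_degree_le I J s sigma : (forall f, f \in I -> f \in J) ->
  cofinite I s -> socle_degree (quot_max J) sigma -> (sigma <= s)%N.
Proof.
move=> IJ fin sdJ; have [_ [f hf nJ]] := socle_degree_cofinite sdJ.
rewrite leqNgt; apply: contra nJ => lt_s; apply/IJ/fin.
by apply: (ord_ge_sub lt_s); apply: homog_ord.
Qed.

(** Let s' be the socle degree. The coefficient at s is positive, so s <= s'. In degree s' the socle
    is all of R_(s'), which is nonzero, so s' is an exponent of the polynomial, s1 or s; with s1 <=
    s this gives s' = s. *)
Lemma socle_polynomial_dims I s1 s : graded I -> (s1 <= s)%N ->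
  socle_polynomial (quot_max I) ('X^s1 + 'X^s) ->
  socle_degree (quot_max I) s /\ forall i, (i <= s)%N ->
    dimq (soc_part I i) (deg_part I i) ((i == s1) + (i == s)).
Proof.
move=> grI le_s [s' [sd pE]].
have coefE i : ((i == s1) + (i == s))%N = if (i < s'.+1)%N then
    rank (idealX (quot_max I) i `&` socle (quot_max I))
      (idealX (quot_max I) i.+1 `&` socle (quot_max I)) else 0%N.
  have := congr1 (fun p : {poly nat} => p`_i) pE.
  by rewrite coef_poly coefD !coefXn /= !natn.
have dims i : (i <= s')%N -> dimq (soc_part I i) (deg_part I i) ((i == s1) + (i == s)).
  by move=> le_i; apply: soc_rank => //; rewrite coefE ltnS le_i.
have le_ss' : (s <= s')%N.
  by have := coefE s; rewrite eqxx addn1 ltnS; case: leqP.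
suff eq_s : s' = s by rewrite eq_s in sd dims.
have [fin [f hf nI]] := socle_degree_cofinite sd.
have := dims s' (leqnn _); rewrite soc_part_top //.
case: (eqVneq s' s) => // ne; case: (eqVneq s' s1) => [e|_]; last first.
  by move/dimq0_sub => /(_ f hf)[_ fI]; rewrite fI in nI.
by move=> _; apply/eqP; rewrite eqn_leq le_ss' andbT e.
Qed.

(** The socle is a line and contains the class of a form h of degree s outside J. A socle element of
    lower degree d is congruent to some a h modulo J; taking components of degree d puts it in J. *)
Lemma gorenstein_socle J s : graded J -> cm_type (quot_max J) = 1%N ->
  socle_degree (quot_max J) s ->
  dimq (@ms_homog 3 k s) (deg_part J s) 1 /\
  forall d f, (d < s)%N -> ms_homog d f -> (forall j, ms_var j * f \in J) -> f \in J.
Proof.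
move=> grJ type1 sd; have [fin [h hh nJ]] := socle_degree_cofinite sd.
have sS := subspace_socle J.
have [g [Sg spang _]] := dimq_basis sS (@subspace0 _ _) (dimq_rank sS (@subspace0 _ _) type1).
pose pi : Q -> {ideal_quot J} := \pi_{ideal_quot J}.
have line f : vall [set g | g \in J] (smul f X) -> exists a : k, pi f = a *: g ord0.
  move=> fX; have [c cE] := spang (pi f) ((socle_quot _ _).2 fX).
  by exists (c ord0); rewrite big_ord1 in cE; apply/eqP; rewrite -subr_eq0; apply/eqP.
have top f : ms_homog s f -> vall [set g | g \in J] (smul f X).
  by rewrite -(soc_part_top fin) => -[].
have [b bE] := line h (top h hh).
have nzb : b != 0.
  by apply: contraNneq nJ => b0; apply/pi_eq0; rewrite -/pi bE b0 scale0r.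
have lineh f : vall [set g | g \in J] (smul f X) -> exists a : k, f - a *: h \in J.
  move=> /line[a aE]; exists (a / b); apply/pi_eq; rewrite -/pi.
  by rewrite /pi piZ -/pi aE bE scalerA divfK.
split.
  apply: (@basis_mod_dimq _ _ _ _ _ (fun _ => h)); [exact: subspace_homog | exact: subspace_deg_part |].
  split=> // [u hu|c].
    have [a aJ] := lineh u (top u hu); exists (fun=> a); rewrite big_ord1; split=> //.
    by apply: homogB => //; apply: (subspaceZ _ (subspace_homog s)).
  rewrite big_ord1 => -[_ chJ] i; rewrite ord1; apply/eqP; apply: contraNT nJ => nzc.
  by rewrite -[h](scalerK nzc); apply: (subspaceZ _ (subspace_ideal J)).
move=> d f lt_d hf fX.
have [|a aJ] := lineh f; first by split; rewrite /= mulrC.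
have := grJ d _ aJ; rewrite raddfB /= (homog_hcomp hf) linearZ /=.
by rewrite (homog_hcomp_neq hh) ?scaler0 ?subr0 // neq_ltn lt_d.
Qed.

Lemma hQB (c i : nat) : hQ (c%:Z - i%:Z) = if (i <= c)%N then 'C(c - i + 2, 2) else 0%N.
Proof.
case: leqP => [le_ic|lt_ci]; first by rewrite subzn.
by rewrite -[_ - _]opprB subzn ?(ltnW lt_ci) // -[(i - c)%N]prednK ?subn_gt0.
Qed.

End SocleData.

(** * From congruences modulo I to Koszul homology of R *)

Section Transfer.
Context {k : fieldType}.
Local Notation Q := (mseries 3 k).
Local Notation vec := (Q * Q * Q)%type.
Local Notation X := (@X k).
Variables (I : idealr Q) (s : nat).
Local Notation R := {ideal_quot I}.
Local Notation pi := (\pi_{ideal_quot I} : Q -> R).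
Local Notation Iset := [set f | f \in I].
Local Notation T := (tvec (quot_var I)).

Definition vpi (a : vec) : R * R * R := (pi a.1.1, pi a.1.2, pi a.2).

Lemma vpi_lift (a : R * R * R) : exists b, a = vpi b.
Proof.
by exists (repr a.1.1, repr a.1.2, repr a.2); apply: vecP; rewrite /= reprK.
Qed.

Lemma vpi_eq0 a : vpi a = 0 <-> vall Iset a.
Proof.
split=> [[a0 a1 a2]|[a0 a1 a2]]; first by split; apply/pi_eq0.
by apply: vecP; apply/pi_eq0.
Qed.

Lemma dot_vpi a b : dot (vpi a) (vpi b) = pi (dot a b).
Proof. by rewrite /dot !rmorphD !rmorphM. Qed.

Lemma cross_vpi a b : cross (vpi a) (vpi b) = vpi (cross a b).
Proof. by apply: vecP; rewrite /= rmorphB !rmorphM. Qed.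

Lemma smul_vpi p a : smul (pi p) (vpi a) = vpi (smul p a).
Proof. by apply: vecP; rewrite /= rmorphM. Qed.

Lemma tvec_quot : T = vpi X. Proof. by []. Qed.

Lemma vcycles1_quot a : vcycles1 (quot_var I) (vpi a) <-> dot X a \in I.
Proof. by rewrite /vcycles1 /= tvec_quot dot_vpi pi_eq0. Qed.

Lemma vcycles2_quot U : vcycles2 (quot_var I) (vpi U) <-> vall Iset (cross X U).
Proof. by rewrite /vcycles2 /= tvec_quot cross_vpi vpi_eq0. Qed.

Lemma vcycles3_quot : vcycles3 (quot_var I) = socle (quot_max I).
Proof.
apply/seteqP; split=> x; rewrite -[x]reprK.
  by rewrite socle_quot /vcycles3 /= tvec_quot smul_vpi vpi_eq0.
by rewrite socle_quot /vcycles3 /= tvec_quot smul_vpi vpi_eq0.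
Qed.

Hypotheses (grI : graded I) (finI : cofinite I s).
Hypothesis low0 : forall f, deg_part I 0 f -> f = 0.
Hypothesis type2 : cm_type (quot_max I) = 2%N.
Hypothesis prod11 : forall a b : vec, dot X a \in I -> dot X b \in I ->
  exists q, vall Iset (cross a b - smul q X).
Hypothesis line : products_in_line I.

Lemma quot_prod11 a b : vcycles1 (quot_var I) a -> vcycles1 (quot_var I) b ->
  vboundaries2 (quot_var I) (cross a b).
Proof.
have [a' ->] := vpi_lift a; have [b' ->] := vpi_lift b.
move=> /vcycles1_quot aI /vcycles1_quot bI; have [q [q0 q1 q2]] := prod11 aI bI.
exists (pi q) => //; rewrite cross_vpi tvec_quot smul_vpi.
by apply: vecP; apply/esym/pi_eq.
Qed.

Lemma quot_class_H00 :
  (forall a U : vec, dot X a \in I -> vall Iset (cross X U) -> dot a U \in I) ->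
  class_H00 (quot_var I).
Proof.
move=> dotI; apply: class_H00_products => [|a U]; first exact: quot_prod11.
have [a' ->] := vpi_lift a; have [U' ->] := vpi_lift U.
by move=> /vcycles1_quot aI /vcycles2_quot UI; rewrite dot_vpi; apply/pi_eq0/dotI.
Qed.

Lemma quot_class_G :
  (exists a U : vec, [/\ dot X a \in I, vall Iset (cross X U) & dot a U \notin I]) ->
  exists2 r, (1 <= r)%N & class_G (quot_var I) r.
Proof.
move=> [a [U [aI UI nI]]].
(* R has finite dimension because I contains all series of order above s. *)
have [D dD] : exists D, dimq (@setT R) [set 0] D.
  have [N dN] := @dimq_ord_ge k s.+1.
  have [|r [_ _ dr]] := dimq_sub (@subspace_setT k Q) (subspace_ideal I)
    (subspace_ord s.+1) (@subsetT _ _) _ dN; first exact: finI.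
  exists (N - r)%N; apply: (dimq_iso (@subspace_setT k Q) (@subspace_setT k R)
    (@subspace0 k R) (@pi_linear_on k I setT) _ _ _ dr) => //.
    by move=> f _; apply: pi_eq0.
  by move=> x _; exists (repr x) => //; rewrite /= reprK subrr.
have [w lineP] := line.
apply: (class_G_products quot_prod11 dD (w := pi w)).
(* A_0 is a line: [low0] makes I proper, and the image of dot T is the maximal ideal of R. *)
- have d0 : dimq (@ms_homog 3 k 0) (deg_part I 0) 1.
    have -> : deg_part I 0 = [set 0]; last exact: dimq_homog.
    apply/seteqP; split=> f; first by move/low0.
    by move=> ->; case: (subspace_deg_part I 0).
  have := dimq_quot grI d0; congr (dimq _ _ _).
    by apply/seteqP; split=> // x _; exists (repr x); rewrite ?reprK.
  apply/seteqP; split=> x.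
    by move=> [f /ord_ge_divide[e _ <-] <-]; exists (vpi e) => //; rewrite tvec_quot dot_vpi.
  move=> [b _ <-]; have [b' ->] := vpi_lift b; exists (dot X b').
    have oX j (f : Q) : ord_ge 1 (ms_var j * f).
      by apply: (@ord_geM _ _ 1 0 _ _ (homog_ord (homog_var j))).
    exact: subspaceD (subspace_ord 1) (subspaceD (subspace_ord 1) (oX _ _) (oX _ _)) (oX _ _).
  by rewrite tvec_quot dot_vpi.
- rewrite vcycles3_quot; apply: dimq_rank type2; [exact: subspace_socle | exact: subspace0].
- move=> b V; have [b' ->] := vpi_lift b; have [V' ->] := vpi_lift V.
  move=> /vcycles1_quot bI /vcycles2_quot VI; have [c cI] := lineP b' V' bI VI.
  by exists c; rewrite dot_vpi -piZ; apply/pi_eq.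
- exists (vpi a), (vpi U); split; [exact/vcycles1_quot | exact/vcycles2_quot |].
  by rewrite dot_vpi; apply: contra nI => /eqP/pi_eq0.
Qed.

End Transfer.

(** * Compressed rings of type 2 *)

Section CompressedType2.
Context {k : fieldType}.
Local Notation Q := (mseries 3 k).
Local Notation vec := (Q * Q * Q)%type.
Local Notation X := (@X k).

(** A form of degree s outside I lies outside I1 or outside I2. The corresponding Gorenstein
    quotient then has socle degree at least s, and at most s since its ideal contains I. *)
Lemma compressed_socle_degree (I I1 I2 : idealr Q) s :
  (forall f, (f \in I) = (f \in I1) && (f \in I2)) ->
  homogeneous_ideal I1 -> compressed_gorenstein I1 ->
  homogeneous_ideal I2 -> compressed_gorenstein I2 ->
  socle_degree (quot_max I) s ->
  exists J : idealr Q, [/\ graded J, forall f, f \in I -> f \in J,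
    cm_type (quot_max J) = 1%N, socle_degree (quot_max J) s &
    forall i, hilbert (quot_max J) i = minn (hQ i%:Z) (hQ (s%:Z - i%:Z))].
Proof.
move=> defI hom1 [_ [_ t1] [s1 sd1 h1]] hom2 [_ [_ t2] [s2 sd2 h2]] sd.
have gr1 := homogeneous_graded hom1; have gr2 := homogeneous_graded hom2.
have I1' f : f \in I -> f \in I1 by rewrite defI => /andP[].
have I2' f : f \in I -> f \in I2 by rewrite defI => /andP[].
have [fin [f hf nI]] := socle_degree_cofinite sd.
have le1 := socle_degree_le I1' fin sd1; have le2 := socle_degree_le I2' fin sd2.
have ge (J : idealr Q) sigma : socle_degree (quot_max J) sigma -> f \notin J -> (s <= sigma)%N.
  move=> sdJ nJ; have [finJ _] := socle_degree_cofinite sdJ.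
  rewrite leqNgt; apply: contra nJ => lt_s; apply: finJ.
  by apply: (ord_ge_sub lt_s); apply: homog_ord.
case: (boolP (f \in I1)) => [f1|n1].
  have n2 : f \notin I2 by move: nI; rewrite defI f1.
  have es : s2 = s by apply/eqP; rewrite eqn_leq le2 (ge _ _ sd2).
  by rewrite es in sd2 h2; exists I2.
have es : s1 = s by apply/eqP; rewrite eqn_leq le1 (ge _ _ sd1).
by rewrite es in sd1 h1; exists I1.
Qed.

(** The exponents hidden in [compressed_type2] have to be identified with s1 and s: the larger one
    by uniqueness of the socle degree, the smaller one c by comparing two values of the socle
    dimension in degree c. *)
Lemma compressed_hilbert (I : idealr Q) s1 s : homogeneous_ideal I -> compressed_type2 I ->
  (s1 <= s)%N -> socle_polynomial (quot_max I) ('X^s1 + 'X^s) ->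
  forall i, hilbert (quot_max I) i = minn (hQ i%:Z) (hQ (s1%:Z - i%:Z) + hQ (s%:Z - i%:Z)).
Proof.
move=> hom [_ _ _ [c [s' [le_c sp hI]]]] le_s1 sp1.
have grI := homogeneous_graded hom.
have [sd dims] := socle_polynomial_dims grI le_s1 sp1.
have [sd' dims'] := socle_polynomial_dims grI le_c sp.
have es : s' = s.
  have [fin _] := socle_degree_cofinite sd; have [fin' _] := socle_degree_cofinite sd'.
  apply/eqP; rewrite eqn_leq.
  by rewrite (socle_degree_le (fun f => id) fin sd') (socle_degree_le (fun f => id) fin' sd).
rewrite es in dims' hI le_c.
suff ec : c = s1 by rewrite ec in hI.
have sS i : subspace (soc_part I i) := subspaceI (subspace_homog i) (subspace_soc I).
have := dimq_uniq (sS c) (subspace_deg_part I c) (dims c le_c) (dims' c le_c).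
by rewrite eqxx; case: eqP => //; case: (c == s).
Qed.

Variables (I J : idealr Q) (s1 s tau : nat).
Hypothesis s_tau : s = tau.*2.
Hypothesis tau3 : (3 <= tau)%N.
Hypothesis le_s1s : (s1 <= s)%N.
Hypothesis grI : graded I.
Hypothesis hI : forall i, hilbert (quot_max I) i =
  minn (hQ i%:Z) (hQ (s1%:Z - i%:Z) + hQ (s%:Z - i%:Z)).
Hypothesis sdI : socle_degree (quot_max I) s.
Hypothesis socI : forall i, (i <= s)%N ->
  dimq (soc_part I i) (deg_part I i) ((i == s1) + (i == s)).
Hypothesis grJ : graded J.
Hypothesis IJ : forall f, f \in I -> f \in J.
Hypothesis sdJ : socle_degree (quot_max J) s.
Hypothesis hJ : forall i, hilbert (quot_max J) i = minn (hQ i%:Z) (hQ (s%:Z - i%:Z)).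

Lemma bin2_mono m n : (m <= n)%N -> ('C(m, 2) <= 'C(n, 2))%N.
Proof. by move=> le_mn; rewrite !bin2 half_leq // leq_mul // -!subn1 leq_sub2r. Qed.

(** The doubled form avoids halving, so that arithmetic tactics can treat the binomials as
    variables. *)
Lemma bin2E m : ('C(m.+1, 2) + 'C(m.+1, 2) = m.+1 * m)%N.
Proof.
by rewrite addnn bin2 /= -[RHS]odd_double_half oddM /= andNb.
Qed.

Lemma deg_part_eq0 (L : idealr Q) d f : graded L ->
  hilbert (quot_max L) d = 'C(d + 2, 2) -> deg_part L d f -> f = 0.
Proof.
move=> grL hL Lf; have := hilbert_dimq grL d; rewrite hL.
case/dimq_deg_ideal => _; rewrite subnn => /dimq0_sub; exact.
Qed.

Lemma lowJ d f : (d <= tau)%N -> deg_part J d f -> f = 0.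
Proof.
move=> le_d; apply: deg_part_eq0 => //; rewrite hJ hQB.
have -> : (d <= s)%N by lia.
by apply/minn_idPl/bin2_mono; lia.
Qed.

Lemma lowI d f : (d <= tau)%N -> deg_part I d f -> f = 0.
Proof. by move=> le_d [hf fI]; apply: lowJ le_d _; split=> //; apply: IJ. Qed.

Let finI : cofinite I s. Proof. by case: (socle_degree_cofinite sdI). Qed.

Lemma dimq_top : dimq (@ms_homog 3 k s) (deg_part I s) (s == s1).+1.
Proof. by have := socI (leqnn s); rewrite soc_part_top // eqxx addn1. Qed.

Lemma compressed_cross_boundary (a b : vec) : dot X a \in I -> dot X b \in I ->
  exists q, vall [set f | f \in I] (cross a b - smul q X).
Proof.
apply: (cross_boundary grI finI lowI s_tau).
have s_pos : s = s.-1.+1 by lia.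
have le_s : (s.-1 <= s)%N by lia.
apply: (smul_onto s_pos dimq_top (hilbert_dimq grI s.-1) (socI le_s)).
rewrite hI !hQB le_s.
(* As s >= 6, h_Q(s-1) is at least C(7,2) = 21 and the minimum is the other term: 6 if s1 = s, 4 if
   s1 = s - 1, and 3 otherwise. In each case this is the socle dimension in degree s - 1 plus 3 dim
   R_s. *)
have big : (21 <= 'C(s.-1 + 2, 2))%N by apply: (@bin2_mono 7); lia.
have -> : (s - s.-1 + 2 = 3)%N by lia.
have -> : (s.-1 == s) = false by lia.
rewrite /hQ addn0; case: (leqP s.-1 s1) => le1.
  have [e|e] : s1 = s \/ s1 = s.-1 by lia.
    have -> : (s1 - s.-1 + 2 = 3)%N by lia.
    have -> : (s.-1 == s1) = false by lia.
    have -> : (s == s1) = true by lia.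
    by apply/minn_idPr; rewrite (leq_trans _ big).
  have -> : (s1 - s.-1 + 2 = 2)%N by lia.
  have -> : (s.-1 == s1) = true by lia.
  have -> : (s == s1) = false by lia.
  by apply/minn_idPr; rewrite (leq_trans _ big).
have -> : (s.-1 == s1) = false by lia.
have -> : (s == s1) = false by lia.
by apply/minn_idPr; rewrite (leq_trans _ big).
Qed.

Lemma dim_deg_tau1 : dimq (deg_part I tau.+1) [set 0]
  ('C(tau + 3, 2) - hilbert (quot_max I) tau.+1).
Proof. by have [_] := dimq_deg_ideal (hilbert_dimq grI tau.+1); rewrite addSnnS. Qed.

Lemma compressed_products_in_line : products_in_line I.
Proof.
have := dimq_top; case: (eqVneq s s1) => [es|_] top; last first.
  exact: line_socle1 grI finI lowI s_tau top.
apply: (line_socle2 grI finI lowI s_tau _ dim_deg_tau1 top).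
(* After doubling, C(tau+3,2) - 2 C(tau+1,2) <= 3 becomes 3 tau <= tau^2; this is where tau >= 3 is
   used. *)
rewrite hI !hQB -es.
have -> : (tau < s)%N by lia.
have -> : (s - tau.+1 + 2 = tau.+1)%N by lia.
rewrite /hQ.
have -> : (tau.+1 + 2 = (tau + 2).+1)%N by lia.
have -> : (tau + 3 = (tau + 2).+1)%N by lia.
have := bin2E (tau + 2); have := bin2E tau; have := leq_mul tau3 (leqnn tau).
move: 'C(_, 2) 'C(_, 2) => A B; nia.
Qed.

Hypothesis typeJ : cm_type (quot_max J) = 1%N.

(** A socle form of degree s1 <= tau < s lies in J, whose quotient has its socle in degree s, and J
    vanishes in degrees up to tau. The socle of R in degree s1 would be zero, although its dimension
    there is 1. *)
Lemma socle_degree_lower : (tau < s1)%N.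
Proof.
rewrite ltnNge; apply/negP => le_s1.
have lt_s1s : (s1 < s)%N by lia.
have [_ socJ] := gorenstein_socle grJ typeJ sdJ.
have := socI (ltnW lt_s1s); rewrite eqxx (ltn_eqF lt_s1s).
have sS : subspace (soc_part I s1) := subspaceI (subspace_homog s1) (subspace_soc I).
move=> /(dimq_uniq sS (subspace_deg_part I s1)) uniq0.
suff /uniq0 : dimq (soc_part I s1) (deg_part I s1) 0 by [].
exists (fun _ => 0); split=> [a u v _ _|u [hu uX]|c].
- by rewrite scaler0 addr0.
- split=> // _; split=> //.
  have uJ : u \in J.
    apply: (socJ _ _ lt_s1s hu) => j; apply: IJ; rewrite mulrC.
    by case: uX => u0 u1 u2; move: j; apply: forall_ord3.
  by rewrite (lowJ le_s1 (conj hu uJ)) idealr0.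
- by exists 0; [case: sS | apply/rowP; case].
Qed.

(** The hypothesis says that the minimum defining the Hilbert function in degree tau + 1 is
    h_Q(tau+1), so I_(tau+1) = 0. *)
Lemma class_H00_large_socle_degree :
  ('C(tau + 3, 2) <= 'C(s1 - tau.+1 + 2, 2) + 'C(tau.+1, 2))%N -> class_H00 (quot_var I).
Proof.
move=> le_bin; apply: (quot_class_H00 compressed_cross_boundary).
apply: (products_zero grI finI lowI s_tau).
have := dim_deg_tau1; rewrite hI !hQB.
have -> : (tau < s)%N by lia.
rewrite socle_degree_lower.
have -> : (s - tau.+1 + 2 = tau.+1)%N by lia.
rewrite /hQ.
have -> : (tau.+1 + 2 = tau + 3)%N by lia.
by rewrite (minn_idPl le_bin) subnn => /dimq0_sub Z f /Z.
Qed.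

Let low0 f : deg_part I 0 f -> f = 0. Proof. exact: lowI. Qed.

Hypothesis type2 : cm_type (quot_max I) = 2%N.

Lemma class_H00_or_G :
  class_H00 (quot_var I) \/ exists2 r, (1 <= r)%N & class_G (quot_var I) r.
Proof.
have [G|nG] := pselect (exists a U : vec, [/\ dot X a \in I,
  vall [set f | f \in I] (cross X U) & dot a U \notin I]).
  by right; apply: (quot_class_G grI finI low0 type2 compressed_cross_boundary
  compressed_products_in_line).
left; apply: (quot_class_H00 compressed_cross_boundary) => a U aI UI.
by apply: contra_notT nG => nI; exists a, U.
Qed.

(** The hypothesis is the doubled condition of [products_nonzero] for h1 = C(n+2,2) + C(tau+1,2) and
    h2 = C(n+1,2) + C(tau,2). *)
Lemma class_G_small_socle_degree :
  let n := (s1 - tau.+1)%N in (3 * (n * n) + 11 * n + 2 < 4 * tau)%N ->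
  exists2 r, (1 <= r)%N & class_G (quot_var I) r.
Proof.
move=> n lt_n; apply: (quot_class_G grI finI low0 type2 compressed_cross_boundary
  compressed_products_in_line).
have [dJ socJ] := gorenstein_socle grJ typeJ sdJ.
apply: (products_nonzero s_tau IJ lowJ socJ dJ (hilbert_dimq grI _) (hilbert_dimq grI _)).
have s1E : s1 = (tau.+1 + n)%N by rewrite /n subnKC // socle_degree_lower.
(* If n = 0, the argument s1 - (tau + 2) is -1, where h_Q is 0 by convention; this agrees with
   C(1,2) = 0. *)
have hn : (if tau.+2 <= s1 then 'C(s1 - tau.+2 + 2, 2) else 0)%N = 'C(n.+1, 2).
  case: ifP => le1; first by have -> : (s1 - tau.+2 + 2 = n.+1)%N by lia.
  by have -> : n = 0%N by lia.
rewrite !hI !hQB hn socle_degree_lower.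
have -> : (tau < s)%N by lia.
have -> : (tau.+1 < s)%N by lia.
have -> : (s - tau.+1 + 2 = tau.+1)%N by lia.
have -> : (s - tau.+2 + 2 = tau)%N by lia.
have -> : (s1 - tau.+1 + 2 = n.+2)%N by lia.
rewrite /hQ.
have -> : (tau.+2 + 2 = tau.+4)%N by lia.
have -> : (tau + 2 = tau.+2)%N by lia.
have -> : (tau.+1 + 2 = tau.+3)%N by lia.
have b1 : ('C(n.+2, 2) + 'C(n.+2, 2) = n * n + 3 * n + 2)%N by rewrite bin2E; lia.
have b2 : ('C(n.+1, 2) + 'C(n.+1, 2) = n * n + n)%N by rewrite bin2E; lia.
have b3 : ('C(tau.+1, 2) + 'C(tau.+1, 2) = tau * tau + tau)%N by rewrite bin2E; lia.
have b4 : ('C(tau.+2, 2) + 'C(tau.+2, 2) = tau * tau + 3 * tau + 2)%N by rewrite bin2E; lia.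
have b5 : ('C(tau.+3, 2) + 'C(tau.+3, 2) = tau * tau + 5 * tau + 6)%N by rewrite bin2E; lia.
have b6 : ('C(tau.+4, 2) + 'C(tau.+4, 2) = tau * tau + 7 * tau + 12)%N by rewrite bin2E; lia.
have b7 : ('C(tau, 2) + 'C(tau, 2) + tau = tau * tau)%N.
  by case: (tau) => // m; rewrite bin2E mulSn mulnS mulnC; lia.
move: lt_n b1 b2 b3 b4 b5 b6 b7; clear.
move: 'C(n.+2, 2) 'C(n.+1, 2) 'C(tau.+1, 2) 'C(tau.+2, 2) 'C(tau.+3, 2) 'C(tau.+4, 2) 'C(tau, 2).
move: (n * n)%N (tau * tau)%N => nn tt; lia.
Qed.

End CompressedType2.

(** * The bounds N1 and N2 as integer inequalities *)

Section Bounds.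
Variable F : rcfType.

Lemma N1_lt_N2 s : N1 s < N2 s :> F.
Proof.
rewrite /N1 /N2; set x : F := s%:R; have x0 : 0 <= x by apply: ler0n.
set a := Num.sqrt (24 * x + 97); set b := Num.sqrt (8 * x + 25).
have a0 : 0 <= a := sqrtr_ge0 _; have b0 : 0 <= b := sqrtr_ge0 _.
have a2 : a ^+ 2 = 24 * x + 97 by rewrite sqr_sqrtr //; lra.
have b2 : b ^+ 2 = 8 * x + 25 by rewrite sqr_sqrtr //; lra.
(* Over the common denominator 6, N1 < N2 is this comparison of square roots. *)
have : a < 2 + 3 * b.
  rewrite -(@ltr_pXn2r _ 2) ?nnegrE //; last by lra.
  rewrite a2 (_ : (2 + 3 * b) ^+ 2 = 4 + 12 * b + 9 * b ^+ 2); last by ring.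
  by rewrite b2; lra.
lra.
Qed.

Lemma lt_N1 tau n : (tau.+1 + n)%:R < N1 tau.*2 :> F ->
  (3 * (n * n) + 11 * n + 2 < 4 * tau)%N.
Proof.
rewrite /N1 -addnn natrD -addn1 !natrD => lt_N.
have t0 : 0 <= tau%:R :> F by apply: ler0n.
have n0 : 0 <= n%:R :> F by apply: ler0n.
set a := Num.sqrt _ in lt_N.
have a2 : a ^+ 2 = 24 * (tau%:R + tau%:R) + 97 by rewrite sqr_sqrtr //; lra.
have lt_a : 6 * n%:R + 11 < a by move: lt_N; lra.
have : (6 * n%:R + 11) ^+ 2 < a ^+ 2.
  by rewrite ltr_pXn2r // ?nnegrE; [lra | apply: sqrtr_ge0].
rewrite a2 (_ : (6 * n%:R + 11) ^+ 2 = 36 * (n%:R * n%:R) + 132 * n%:R + 121); last by ring.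
move=> H; rewrite -(ltr_nat F) !natrD !natrM; move: H.
set nn := n%:R * n%:R; lra.
Qed.

Lemma N2_le tau n : N2 tau.*2 <= (tau.+1 + n)%:R :> F ->
  (4 * tau + 4 <= n * n + 3 * n)%N.
Proof.
rewrite /N2 -addnn natrD -addn1 !natrD => le_N.
have t0 : 0 <= tau%:R :> F by apply: ler0n.
have n0 : 0 <= n%:R :> F by apply: ler0n.
set a := Num.sqrt _ in le_N.
have a2 : a ^+ 2 = 8 * (tau%:R + tau%:R) + 25 by rewrite sqr_sqrtr //; lra.
have le_a : a <= 2 * n%:R + 3 by move: le_N; lra.
have : a ^+ 2 <= (2 * n%:R + 3) ^+ 2.
  by rewrite ler_pXn2r // ?nnegrE; [apply: sqrtr_ge0 | lra].
rewrite a2 (_ : (2 * n%:R + 3) ^+ 2 = 4 * (n%:R * n%:R) + 12 * n%:R + 9); last by ring.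
move=> H; rewrite -(ler_nat F) !natrD !natrM; move: H.
set nn := n%:R * n%:R; lra.
Qed.

End Bounds.

Theorem corollary7p5 (F : rcfType) (k : fieldType)
    (I I1 I2 : idealr (mseries 3 k)) (s1 s : nat)
    (homI : homogeneous_ideal I) (cI : compressed_type2 I)
    (hom1 : homogeneous_ideal I1) (c1 : compressed_gorenstein I1)
    (hom2 : homogeneous_ideal I2) (c2 : compressed_gorenstein I2)
    (defI : forall f, (f \in I) = (f \in I1) && (f \in I2))
    (socI : socle_polynomial (quot_max I) ('X^s1 + 'X^s))
    (le_s1s : (s1 <= s)%N) (even_s : ~~ odd s) (ge6_s : (6 <= s)%N) :
  [/\ s%:R / 2 + 1 <= s1%:R :> F /\ s1%:R <= s%:R :> F,
      N1 s < N2 s :> F,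
      s1%:R < N1 s :> F -> exists2 r, (1 <= r)%N & class_G (quot_var I) r,
      N2 s <= s1%:R :> F -> class_H00 (quot_var I)
    & N1 s <= s1%:R :> F -> s1%:R < N2 s :> F ->
        class_H00 (quot_var I) \/
        exists2 r, (1 <= r)%N & class_G (quot_var I) r].
Proof.
have grI := homogeneous_graded homI.
have hI := compressed_hilbert homI cI le_s1s socI.
have [sdI dimI] := socle_polynomial_dims grI le_s1s socI.
have [J [grJ IJ typeJ sdJ hJ]] := compressed_socle_degree defI hom1 c1 hom2 c2 sdI.
have type2 : cm_type (quot_max I) = 2%N by case: cI.
pose tau := s./2; have s_tau : s = tau.*2 by rewrite even_halfK.
have tau3 : (3 <= tau)%N by lia.
have lt_s1 := socle_degree_lower s_tau tau3 le_s1s dimI grJ IJ sdJ hJ typeJ.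
pose n := (s1 - tau.+1)%N; have s1E : s1 = (tau.+1 + n)%N by rewrite subnKC.
have class := class_H00_or_G s_tau tau3 le_s1s grI hI sdI dimI grJ IJ hJ type2.
(* Assertion (c) is closed at once by [class]. *)
split=> //.
- rewrite ler_nat le_s1s; split=> //.
  have : (tau.+1)%:R <= s1%:R :> F by rewrite ler_nat.
  by rewrite s_tau -addnn -addn1 !natrD; lra.
- exact: N1_lt_N2.
- rewrite {1}s1E s_tau => /lt_N1.
  exact: (class_G_small_socle_degree s_tau tau3 le_s1s grI hI sdI dimI grJ IJ sdJ hJ typeJ type2).
- rewrite {1}s1E s_tau => /N2_le le_n.
  apply: (class_H00_large_socle_degree s_tau tau3 le_s1s grI hI sdI dimI grJ IJ sdJ hJ typeJ).
  have -> : (s1 - tau.+1 + 2 = n.+2)%N by lia.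
  have -> : (tau + 3 = tau.+3)%N by lia.
  have := bin2E tau.+2; have := bin2E tau; have := bin2E n.+1; clear -le_n.
  by move: 'C(_, 2) 'C(_, 2) 'C(_, 2) => A B C; lia.
Qed.
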